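(* Let $G$ be an undirected graph with $n$ vertices and $m$ edges and let $T$ be a DFS tree of $G$. There is a data structure $\mathcal{D}$ of size $O(m\log n)$, which can be built in $O(m\log n)$ time, that answers the queries $Query(T(w),x,y)$ and $Query(w,x,y)$ on $T$ in $O(\log^3 n)$ worst case time.
   Context: For a vertex $w$, $T(w)$ denotes the subtree of $T$ rooted at $w$. For vertices $x,y$ such that one is an ancestor of the other in $T$, $path(x,y)$ denotes the tree path in $T$ between $x$ and $y$ (an ancestor-descendant path). For vertices $w,x,y$ with $path(x,y)$ an ancestor-descendant path: $Query(w,x,y)$ returns, among all edges of $G$ joining $w$ to a vertex of $path(x,y)$, one whose endpoint on $path(x,y)$ is nearest to $x$ on $path(x,y)$ (or null if none exists); $Query(T(w),x,y)$ returns, among all edges of $G$ with one endpoint in $T(w)$ and the other on $path(x,y)$, one whose endpoint on $path(x,y)$ is nearest to $x$ (or null if none exists). *)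

(* Defs.v *)
From mathcomp Require Import all_boot.

Set Implicit Arguments.
Unset Strict Implicit.
Unset Printing Implicit Defensive.

(* A unit-cost word RAM.  Programs are structured programs over numbered
   registers and a word-addressed memory.  A program is a finite object and
   contains no Rocq function, so a program chosen before the input cannot
   compute anything free of charge. *)

Inductive binop := Add | Sub | Mul | Div | Mod | Lt | Eq.

Inductive expr :=
| Const of nat
| Reg of nat
| Read of expr
| Bin of binop & expr & expr.

Inductive cmd :=
| Skip
| Assign of nat & expr
| Write of expr & expr
| Seq of cmd & cmd
| If of expr & cmd & cmd
| While of expr & cmd.

Record state := State { reg : nat -> nat; mem : nat -> nat }.

Definition upd (f : nat -> nat) (i k : nat) : nat -> nat :=
  fun j => if j == i then k else f j.

(* [Sub] truncates at 0, and division by 0 yields 0. *)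
Definition binop_sem (o : binop) (k l : nat) : nat :=
  match o with
  | Add => k + l
  | Sub => k - l
  | Mul => k * l
  | Div => k %/ l
  | Mod => k %% l
  | Lt => k < l
  | Eq => k == l
  end.

(* A value that does not fit in a [b]-bit word is an error, not a wrap-around:
   a program which overflows has no execution at all. *)
Definition word (b k : nat) : option nat := if k < 2 ^ b then Some k else None.

Fixpoint eval (b : nat) (s : state) (a : expr) : option nat :=
  match a with
  | Const k => word b k
  | Reg i => word b (reg s i)
  | Read a1 => obind (fun i => word b (mem s i)) (eval b s a1)
  | Bin o a1 a2 =>
      obind (fun k => obind (fun l => word b (binop_sem o k l)) (eval b s a2))
            (eval b s a1)
  end.

Fixpoint expr_cost (a : expr) : nat :=
  match a with
  | Const _ | Reg _ => 1
  | Read a1 => (expr_cost a1).+1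
  | Bin _ a1 a2 => (expr_cost a1 + expr_cost a2).+1
  end.

(* [exec b c s t s']: on the [b]-bit machine, [c] started in [s] halts in [s']
   after [t] steps. *)
Inductive exec (b : nat) : cmd -> state -> nat -> state -> Prop :=
| ExecSkip s : exec b Skip s 1 s
| ExecAssign i a s k :
    eval b s a = Some k ->
    exec b (Assign i a) s (expr_cost a).+1 (State (upd (reg s) i k) (mem s))
| ExecWrite a1 a2 s i k :
    eval b s a1 = Some i -> eval b s a2 = Some k ->
    exec b (Write a1 a2) s (expr_cost a1 + expr_cost a2).+1
      (State (reg s) (upd (mem s) i k))
| ExecSeq c1 c2 s1 t1 s2 t2 s3 :
    exec b c1 s1 t1 s2 -> exec b c2 s2 t2 s3 ->
    exec b (Seq c1 c2) s1 (t1 + t2).+1 s3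
| ExecIf a c1 c2 s k t s' :
    eval b s a = Some k -> exec b (if k != 0 then c1 else c2) s t s' ->
    exec b (If a c1 c2) s (expr_cost a + t).+1 s'
| ExecWhileEnd a c s :
    eval b s a = Some 0 -> exec b (While a c) s (expr_cost a).+1 s
| ExecWhile a c s1 k t1 s2 t2 s3 :
    eval b s1 a = Some k -> k != 0 ->
    exec b c s1 t1 s2 -> exec b (While a c) s2 t2 s3 ->
    exec b (While a c) s1 (expr_cost a + t1 + t2).+1 s3.

(* [exec] is deterministic, so this bounds the running time of [c] from [s]. *)
Definition runs_within (b : nat) (c : cmd) (s : state) (bound : nat)
    (Q : state -> Prop) : Prop :=
  exists t s', [/\ exec b c s t s', t <= bound & Q s'].

Definition initial (l : seq nat) : state := State (fun=> 0) (nth 0 l).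

Definition holds (D : seq nat) (s : state) : Prop :=
  forall i, i < size D -> mem s i = nth 0 D i.

(* A rooted tree is given by its parent function, the root being its own
   parent, so [fconnect par v u] says that [u] is an ancestor of [v]. *)

Section Tree.

Variables (n : nat) (e : rel 'I_n) (r : 'I_n) (par : 'I_n -> 'I_n).

Definition edge_set : {set {set 'I_n}} :=
  [set [set p.1; p.2] | p : 'I_n * 'I_n & e p.1 p.2].

(* Every edge is listed exactly once, in an arbitrary order and with an
   arbitrary orientation. *)
Definition edge_list (es : seq ('I_n * 'I_n)) : Prop :=
  perm_eq [seq [set p.1; p.2] | p <- es] (enum edge_set).

(* The runs of depth-first search from [r]; the list holds the visited
   vertices, latest first.  The search always continues from the most recently
   visited vertex [u] that still has an unvisited neighbour, and makes [u] the
   parent of the neighbour [v] it moves to. *)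
Inductive dfs_run : seq 'I_n -> Prop :=
| DfsStart : dfs_run [:: r]
| DfsVisit later u earlier v :
    let visited := later ++ u :: earlier in
    dfs_run visited ->
    (forall x y, x \in later -> e x y -> y \in visited) ->
    e u v -> v \notin visited -> par v = u ->
    dfs_run (v :: visited).

(* The search from [r] must reach every vertex. *)
Definition dfs_tree : Prop :=
  par r = r /\ exists2 visited, dfs_run visited & forall v, v \in visited.

Definition subtree (w : 'I_n) : {set 'I_n} := [set v | fconnect par v w].

Definition anc_desc (x y : 'I_n) : bool := fconnect par x y || fconnect par y x.

(* The vertices of path(x,y), listed from [x] to [y]; meaningful when
   [anc_desc x y]. *)
Definition tree_path (x y : 'I_n) : seq 'I_n :=
  if fconnect par x y then traject par x (findex par x y).+1
  else rev (traject par y (findex par y x).+1).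

(* [o] is a correct answer to the query for an edge between [A] and
   path(x,y) nearest to [x]; the edge is oriented from [A] to the path. *)
Definition query_answer (A : {set 'I_n}) (x y : 'I_n)
    (o : option ('I_n * 'I_n)) : Prop :=
  let p := tree_path x y in
  let cand u v := [&& u \in A, v \in p & e u v] in
  match o with
  | None => forall u v, ~~ cand u v
  | Some (u, v) =>
      cand u v /\ forall u' v', cand u' v' -> index v p <= index v' p
  end.

Definition input (es : seq ('I_n * 'I_n)) : seq nat :=
  [:: n; size es] ++ [seq val (par v) | v <- enum 'I_n]
    ++ flatten [seq [:: val p.1; val p.2] | p <- es].

Definition query_args (s : state) (w x y : 'I_n) : Prop :=
  [/\ reg s 0 = w, reg s 1 = x & reg s 2 = y].

Definition returns (s : state) (o : option ('I_n * 'I_n)) : Prop :=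
  match o with
  | None => reg s 0 = 0
  | Some (u, v) => [/\ reg s 0 = 1, reg s 1 = u & reg s 2 = v]
  end.

(* On a memory that starts with [D], and whatever the other memory cells and
   registers contain, [q] answers within [bound] steps and leaves [D] intact. *)
Definition answers_within (b : nat) (q : cmd) (D : seq nat) (bound : nat)
    (A : {set 'I_n}) (w x y : 'I_n) : Prop :=
  forall s, holds D s -> query_args s w x y ->
    runs_within b q s bound (fun s' =>
      holds D s' /\ exists2 o, returns s' o & query_answer A x y o).

End Tree.

(* Main.v *)
(** Label the vertices by preorder, so that every subtree is an interval of
    labels, and count the edges between such an interval and a path from the
    root.  A persistent binary counting tree has, for each vertex [z], a version
    [V z] holding the labels [pre u] of all arcs [(v, u)] with [v] a weak
    ancestor of [z]; [V z] is the version of the parent plus [deg z] insertions,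
    which gives [O(m log n)] nodes in total.  The number [c z] of arcs from
    the ancestors of [z] into the query interval costs [O(log n)] and can only
    grow from a vertex to its children.

    For a path with top [a] and bottom [d], let [c0] be the count strictly above
    [a].  There is an edge iff [c0 < c d].  The highest [z] above [d] with
    [c z > c0] is the endpoint nearest to [a], and the highest [z] with
    [c z > c d - 1] is the endpoint nearest to [d]; both are found by binary
    lifting.  The other endpoint is found by bisection over the labels, comparing
    the version of [z] with that of its parent. *)

Require Import Defs.
From mathcomp Require Import all_boot.
From mathcomp Require Import zify.
Import Defs.

Set Implicit Arguments.
Unset Strict Implicit.
Unset Printing Implicit Defensive.

(** * Reasoning about programs *)

(** The machine has no wrap-around: a program that overflows has no execution, so correctness
    requires a bound on every intermediate value. This is settled once for all programs. Stored
    values stay below [W], so an expression with at most 12 leaves has value at most [W ^ 12];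
    loop-free code then becomes a total function [run] whose cost is read off its text, and only
    loops need invariants. Since [W <= 2 ^ (12 * lg)], words of more than [144 * lg] bits suffice,
    whence the factor 145.

    Counts are stored, rather than edges, because counts can be subtracted: an interval of labels is
    a difference of two prefixes, and the arcs at one vertex are a difference of two versions. A
    single vertex is an interval of length one, so both kinds of query share one search. Climbing
    and bisection each make [K = lg + 1] rounds with a bounded number of prefix counts of [K] steps,
    so a query costs O(log^2 n).

    When a query starts, the registers other than its arguments and the memory beyond the structure
    are arbitrary. Hence the input is part of the structure, and each query recomputes its base
    registers from it. *)

Fixpoint den (s : state) (a : expr) : nat :=
  match a with
  | Const k => k
  | Reg i => reg s i
  | Read a1 => mem s (den s a1)
  | Bin o a1 a2 => binop_sem o (den s a1) (den s a2)
  end.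

(** The exponent in the size bound: each leaf contributes a factor [W]. A read adds nothing, since
    the cell read is itself below [W]. *)
Fixpoint leaves (a : expr) : nat :=
  match a with
  | Const _ | Reg _ => 1
  | Read a1 => leaves a1
  | Bin _ a1 a2 => leaves a1 + leaves a2
  end.

Fixpoint simple (a : expr) : bool :=
  match a with
  | Const k => k <= 32
  | Reg i => i < 32
  | Read a1 => simple a1
  | Bin _ a1 a2 => simple a1 && simple a2
  end.

Definition max_leaves := 12.
Definition small_expr (a : expr) : bool := (leaves a <= max_leaves) && simple a.

Fixpoint reads_below (A : nat) (s : state) (a : expr) : Prop :=
  match a with
  | Const _ | Reg _ => True
  | Read a1 => reads_below A s a1 /\ den s a1 < A
  | Bin _ a1 a2 => reads_below A s a1 /\ reads_below A s a2
  end.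

(** Total semantics of loop-free code, meant to be evaluated by [simpl]. The value on [While] is a
    placeholder that [straight] excludes. *)
Fixpoint run (c : cmd) (s : state) : state :=
  match c with
  | Skip => s
  | Assign i a => State (upd (reg s) i (den s a)) (mem s)
  | Write a1 a2 => State (reg s) (upd (mem s) (den s a1) (den s a2))
  | Seq c1 c2 => run c2 (run c1 s)
  | If a c1 c2 => if den s a != 0 then run c1 s else run c2 s
  | While _ _ => s
  end.

Fixpoint straight (c : cmd) : bool :=
  match c with
  | Skip => true
  | Assign i a => small_expr a
  | Write a1 a2 => small_expr a1 && small_expr a2
  | Seq c1 c2 => straight c1 && straight c2
  | If a c1 c2 => [&& small_expr a, straight c1 & straight c2]
  | While _ _ => false
  end.

Fixpoint cost (c : cmd) : nat :=
  match c with
  | Skip => 1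
  | Assign _ a => (expr_cost a).+1
  | Write a1 a2 => (expr_cost a1 + expr_cost a2).+1
  | Seq c1 c2 => (cost c1 + cost c2).+1
  | If a c1 c2 => (expr_cost a + maxn (cost c1) (cost c2)).+1
  | While _ _ => 0
  end.

(* Beyond the input, memory is used as interleaved arrays: cell [x] of array
   [a] has address [B + a + 16 * x], where register 15 holds [B].  The arrays
   are 0: iterated parents, [par^(2^k) v] at [k * n + v]; 1, 2: lists of
   children; 3, 4: lists of arcs; 5: stack; 6: preorder labels; 7: the vertex
   visited after a subtree; 8: vertices by label; 9, 10: version of a vertex and
   of its parent; 11, 12, 13: left child, right child and count of a node. *)
Definition cell (a : nat) (x : expr) : expr :=
  Bin Add (Bin Add (Reg 15) (Const a)) (Bin Mul (Const 16) x).

(** A syntactic recogniser of addresses built by [cell], so that the arrays a program may write are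
    computed from its text. *)
Definition cell_array (a : expr) : option nat :=
  match a with
  | Bin Add (Bin Add (Reg 15) (Const k)) (Bin Mul (Const 16) _) =>
      if k < 16 then Some k else None
  | _ => None
  end.

Fixpoint regs_written (c : cmd) : seq nat :=
  match c with
  | Skip | Write _ _ => [::]
  | Assign i _ => [:: i]
  | Seq c1 c2 | If _ c1 c2 => regs_written c1 ++ regs_written c2
  | While _ c1 => regs_written c1
  end.

Fixpoint arrays_written (c : cmd) : seq nat :=
  match c with
  | Skip | Assign _ _ => [::]
  | Write a _ => if cell_array a is Some k then [:: k] else [::]
  | Seq c1 c2 | If _ c1 c2 => arrays_written c1 ++ arrays_written c2
  | While _ c1 => arrays_written c1
  end.

Fixpoint array_writes (c : cmd) : bool :=
  match c with
  | Skip | Assign _ _ => true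
  | Write a _ => cell_array a != None
  | Seq c1 c2 | If _ c1 c2 => array_writes c1 && array_writes c2
  | While _ c1 => array_writes c1
  end.

(* Registers 12 to 15 hold [2 ^ K], [K], [n] and [B]. *)
Definition tame (c : cmd) : bool :=
  array_writes c && all (fun i => (i < 12) || (15 < i)) (regs_written c).

(** * Frames, value bounds and timed specifications *)

Section Logic.

Variables (b W A B n K : nat) (inp : seq nat).
Fixpoint ok (c : cmd) (s : state) : Prop :=
  match c with
  | Skip => True
  | Assign i a => reads_below A s a /\ den s a < W
  | Write a1 a2 => [/\ reads_below A s a1, reads_below A s a2 & den s a2 < W]
  | Seq c1 c2 => ok c1 s /\ ok c2 (run c1 s)
  | If a c1 c2 =>
      reads_below A s a /\ (if den s a != 0 then ok c1 s else ok c2 s)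
  | While _ _ => False
  end.

Definition bounded (s : state) : Prop :=
  (forall i, i < 32 -> reg s i < W) /\ (forall i, i < A -> mem s i < W).

Lemma leaves_gt0 a : 0 < leaves a.
Proof. by elim: a => //= o a1 IH1 a2 IH2; rewrite addn_gt0 IH1. Qed.

Definition well_formed (s : state) : Prop :=
  [/\ bounded s, [/\ reg s 15 = B, reg s 14 = n, reg s 13 = K & reg s 12 = 2 ^ K]
    & forall i, i < B -> mem s i = nth 0 inp i].

(** What a program may change is read off its text, so facts about other registers and arrays pass
    through it without appearing in its specification. *)
Definition frame (c : cmd) (s s' : state) : Prop :=
  (forall i, i \notin regs_written c -> reg s' i = reg s i) /\
  (forall x, (forall a j, a \in arrays_written c -> x <> B + a + 16 * j) ->
     mem s' x = mem s x).

Lemma frame_refl c s : frame c s s.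
Proof. by []. Qed.

Lemma frame_trans c s1 s2 s3 : frame c s1 s2 -> frame c s2 s3 -> frame c s1 s3.
Proof.
move=> [r1 m1] [r2 m2]; split=> [i wi|x wx].
  by rewrite r2 // r1.
by rewrite m2 // m1.
Qed.

Lemma frame_seq c1 c2 s1 s2 s3 : frame c1 s1 s2 -> frame c2 s2 s3 ->
  frame (Seq c1 c2) s1 s3.
Proof.
move=> [r1 m1] [r2 m2]; split=> [i|x wx] /=.
  by rewrite mem_cat negb_or => /andP[w1 w2]; rewrite r2 // r1.
rewrite m2 ?m1 // => a j aw; apply: wx; rewrite /= mem_cat aw ?orbT //.
Qed.

Lemma frame_if (g : bool) a c1 c2 s s' : frame (if g then c1 else c2) s s' ->
  frame (If a c1 c2) s s'.
Proof.
move=> [r1 m1]; split=> [i|x wx] /=.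
  by rewrite mem_cat negb_or => /andP[w1 w2]; rewrite r1 //; case: (g).
by apply: m1 => k j; case: (g) => kw; apply: wx; rewrite /= mem_cat kw ?orbT.
Qed.

Lemma cell_arrayP a k s : cell_array a = Some k ->
  k < 16 /\ exists x, den s a = reg s 15 + k + 16 * den s x.
Proof.
rewrite /cell_array.
repeat match goal with |- context [match ?x with _ => _ end] => is_var x; destruct x => // end.
all: case: ltnP => // k16 [<-]; split => //.
all: by eexists.
Qed.

Lemma run_frame c s : reg s 15 = B -> tame c -> straight c ->
  frame c s (run c s).
Proof.
rewrite /tame.
elim: c s => //=.
- move=> i a s _ _ _; split=> [j|] //=; rewrite inE /upd => /negbTE -> //.
- move=> a1 a2 s sB; case E: (cell_array a1) => [k|] // _ _.
  have [k16 [x Dx]] := cell_arrayP s E.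
  split=> // y wy /=; rewrite /upd; case: eqP => // yE.
  case: (wy k (den s x)); rewrite /= ?E ?inE //; by rewrite -sB -Dx.
- move=> c1 IH1 c2 IH2 s sB; rewrite all_cat => /andP[/andP[w1 w2] /andP[r1 r2]].
  move=> /andP[s1 s2].
  have f1 := IH1 s sB (introT andP (conj w1 r1)) s1.
  apply: (frame_seq f1); apply: IH2 => //; last exact/andP.
  rewrite f1.1 //; apply/negP => in15.
  by move/allP/(_ _ in15): r1.
- move=> a c1 IH1 c2 IH2 s sB; rewrite all_cat => /andP[/andP[w1 w2] /andP[r1 r2]].
  move=> /and3P[_ s1 s2].
  apply: (@frame_if (den s a != 0)).
  case: (den s a != 0).
    by apply: IH1 => //; apply/andP.
  by apply: IH2 => //; apply/andP.
Qed.

Lemma array_writes_lt16 c a : a \in arrays_written c -> a < 16.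
Proof.
elim: c => //=.
- move=> a1 _; case E: (cell_array a1) => [k|] //.
  have [k16 _] := cell_arrayP (State id id) E.
  by rewrite inE => /eqP ->.
- by move=> c1 IH1 c2 IH2; rewrite mem_cat => /orP[/IH1|/IH2].
- by move=> _ c1 IH1 c2 IH2; rewrite mem_cat => /orP[/IH1|/IH2].
Qed.

(** Interleaving at work: two arrays occupy different residues modulo 16 from [B], so they never
    meet, however large an index is. *)
Lemma frame_array c s s' a j : frame c s s' -> a < 16 ->
  a \notin arrays_written c -> mem s' (B + a + 16 * j) = mem s (B + a + 16 * j).
Proof.
move=> [_ m1] a16 wa; apply: m1 => a' j' aw; have := array_writes_lt16 aw => a16'.
have ne : a' <> a by move=> e; move: wa; rewrite -e aw.
lia.
Qed.

Lemma frame_input c s s' i : frame c s s' -> i < B -> mem s' i = mem s i.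
Proof. by move=> [_ m1] iB; apply: m1 => a' j' _; lia. Qed.

Lemma frame_pure c s s' : frame c s s' -> arrays_written c = [::] ->
  mem s' =1 mem s.
Proof. by move=> [_ m1] w0 x; apply: m1 => a j; rewrite w0. Qed.

Lemma well_formed_frame c s s' : tame c -> frame c s s' -> bounded s' ->
  well_formed s -> well_formed s'.
Proof.
move=> /andP[_ /allP w] fr bs' [_ [r15 r14 r13 r12] inpE]; split=> //.
  by split; rewrite fr.1 //; apply/negP => /w.
by move=> i iB; rewrite (frame_input fr iB) inpE.
Qed.

Definition triple (c : cmd) (s : state) (t : nat) (Q : state -> Prop) : Prop :=
  runs_within b c s t (fun s' => [/\ well_formed s', frame c s s' & Q s']).

Lemma triple_weaken c s t t' (Q Q' : state -> Prop) :
  triple c s t Q -> t <= t' ->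
  (forall s', well_formed s' -> frame c s s' -> Q s' -> Q' s') ->
  triple c s t' Q'.
Proof.
move=> [t1 [s1 [e1 l1 [wf fr q]]]] le_t QQ.
exists t1, s1; split=> //; first exact: leq_trans le_t.
by split=> //; apply: QQ.
Qed.

Lemma triple_time c s t t' (Q : state -> Prop) :
  triple c s t Q -> t <= t' -> triple c s t' Q.
Proof. by move=> Ht le_t; apply: triple_weaken Ht le_t _. Qed.

Lemma triple_seq c1 c2 s t1 t2 (Q1 Q : state -> Prop) :
  triple c1 s t1 Q1 ->
  (forall s1, well_formed s1 -> frame c1 s s1 -> Q1 s1 -> triple c2 s1 t2 Q) ->
  triple (Seq c1 c2) s (t1 + t2).+1 Q.
Proof.
move=> [u1 [s1 [e1 l1 [wf1 fr1 q1]]]] /(_ s1 wf1 fr1 q1).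
move=> [u2 [s2 [e2 l2 [wf2 fr2 q2]]]].
exists (u1 + u2).+1, s2; split; [exact: ExecSeq e1 e2|lia|].
by split=> //; apply: frame_seq fr1 fr2.
Qed.

Hypothesis W_gt32 : 32 < W.
Hypothesis W_fits : W ^ max_leaves < 2 ^ b.

(** Multiplication is the worst case: it multiplies the bounds of the operands, while a sum is at
    most the product of two bounds that are at least 2, and the other operations exceed neither the
    left operand nor 1. *)
Lemma den_bound s a : bounded s -> simple a -> reads_below A s a ->
  den s a <= W ^ leaves a.
Proof.
have W_gt0 : 0 < W by lia.
move=> [bR bM]; elim: a => /=.
- by move=> k; rewrite expn1; lia.
- by move=> i /bR /ltnW; rewrite expn1.
- move=> a IH _ [_ /bM /ltnW le_W]; apply: leq_trans le_W _.
  by rewrite -{1}[W]expn1 leq_exp2l ?leaves_gt0 //; lia.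
move=> o a1 IH1 a2 IH2 /andP[s1 s2] [r1 r2].
move: (IH1 s1 r1) (IH2 s2 r2) => {IH1 IH2}.
have W_le a : W <= W ^ leaves a.
  by rewrite -{1}[W]expn1 leq_exp2l ?leaves_gt0 //; lia.
move: (W_le a1) (W_le a2); rewrite expnD.
move: (W ^ leaves a1) (W ^ leaves a2) (den s a1) (den s a2) => x y k l.
move=> Wx Wy kx ly.
have x_le : x <= x * y by rewrite leq_pmulr //; lia.
case: o => /=.
- by apply: leq_trans (leq_add kx ly) _; nia.
- by apply: leq_trans (leq_subr _ _) _; apply: leq_trans kx _.
- exact: leq_mul.
- by apply: leq_trans (leq_div _ _) _; apply: leq_trans kx _.
- by apply: leq_trans (leq_mod _ _) _; apply: leq_trans kx _.
- by case: (k < l) => //=; lia.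
- by case: (k == l) => //=; lia.
Qed.

Lemma eval_den s a : bounded s -> small_expr a -> reads_below A s a ->
  eval b s a = Some (den s a).
Proof.
move=> bs /andP[].
have fits a' : leaves a' <= max_leaves -> simple a' -> reads_below A s a' ->
    word b (den s a') = Some (den s a').
  move=> la sa ra; rewrite /word.
  have -> // : den s a' < 2 ^ b.
  apply: leq_ltn_trans W_fits; apply: leq_trans (den_bound bs sa ra) _.
  by rewrite leq_exp2l //; lia.
elim: a => [k|i|a IH|o a1 IH1 a2 IH2] la sa ra.
- exact: (fits (Const k)).
- exact: (fits (Reg i)).
- by move: (fits _ la sa ra) => /= <-; rewrite /= IH //; case: ra.
move: (fits _ la sa ra) => /= <-.
move: la sa ra => /= la /andP[s1 s2] [r1 r2].
by rewrite IH1 ?IH2 //; lia.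
Qed.

Lemma run_exec c s : bounded s -> straight c -> ok c s ->
  bounded (run c s) /\ exists2 t, exec b c s t (run c s) & t <= cost c.
Proof.
elim: c s => //=.
- by move=> s bs _ _; split=> //; exists 1 => //; constructor.
- move=> i a s bs sa [ra va]; split.
    split=> [j|]; last exact: bs.2.
    by rewrite /upd /=; case: eqP => // _; apply: bs.1.
  by exists (expr_cost a).+1 => //; constructor; apply: eval_den.
- move=> a1 a2 s bs /andP[s1 s2] [r1 r2 v2]; split.
    split=> [|j] /=; first exact: bs.1.
    by rewrite /upd /=; case: eqP => // _; apply: bs.2.
  by eexists; first by constructor; apply: eval_den.
- move=> c1 IH1 c2 IH2 s bs /andP[s1 s2] [o1 o2].
  have [b1 [t1 e1 l1]] := IH1 s bs s1 o1.
  have [b2 [t2 e2 l2]] := IH2 _ b1 s2 o2.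
  split=> //; exists (t1 + t2).+1; last by lia.
  exact: ExecSeq e1 e2.
move=> a c1 IH1 c2 IH2 s bs /and3P[sa s1 s2] [ra].
have ev := eval_den bs sa ra.
case z: (den s a != 0) => oc.
  have [b1 [t1 e1 l1]] := IH1 s bs s1 oc.
  split=> //; exists (expr_cost a + t1).+1; last by lia.
  by apply: ExecIf ev _; rewrite z.
have [b1 [t1 e1 l1]] := IH2 s bs s2 oc.
split=> //; exists (expr_cost a + t1).+1; last by lia.
by apply: ExecIf ev _; rewrite z.
Qed.

Lemma triple_straight c s t (Q : state -> Prop) :
  well_formed s -> straight c && tame c -> ok c s -> cost c <= t -> Q (run c s) ->
  triple c s t Q.
Proof.
move=> wf /andP[st tc] okc le_t q.
have [bs [_ _ _ _] _] := wf.
have [b1 [t1 e1 l1]] := run_exec bs st okc.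
have fr : frame c s (run c s) by apply: run_frame => //; case: wf => _ [].
exists t1, (run c s); split=> //; first exact: leq_trans le_t.
by split=> //; apply: well_formed_frame fr _ wf.
Qed.

Lemma triple_straight_wf c s t (Q : state -> Prop) :
  well_formed s -> straight c && tame c -> ok c s -> cost c <= t ->
  (well_formed (run c s) -> frame c s (run c s) -> Q (run c s)) ->
  triple c s t Q.
Proof.
move=> wf st okc le_t q.
apply: (triple_weaken (Q := fun s' => s' = run c s) (t := t)) => //.
  exact: triple_straight.
by move=> s' wf' fr' E; move: wf' fr'; rewrite E.
Qed.

Lemma triple_straight_seq c1 c2 s t (Q : state -> Prop) :
  well_formed s -> straight c1 && tame c1 -> ok c1 s ->
  (well_formed (run c1 s) -> frame c1 s (run c1 s) -> triple c2 (run c1 s) t Q) ->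
  triple (Seq c1 c2) s (cost c1 + t).+1 Q.
Proof.
move=> wf st okc rest.
apply: (triple_seq (Q1 := fun s1 => s1 = run c1 s)).
  exact: triple_straight wf st okc (leqnn _) _.
by move=> s1 wf1 fr1 E; move: wf1 fr1; rewrite E.
Qed.

Lemma triple_if a c1 c2 s t (Q : state -> Prop) :
  well_formed s -> small_expr a -> reads_below A s a ->
  triple (if den s a != 0 then c1 else c2) s t Q ->
  triple (If a c1 c2) s (expr_cost a + t).+1 Q.
Proof.
move=> [bs _ _] sa ra [u [s' [e l [wf fr q]]]].
exists (expr_cost a + u).+1, s'; split; [|lia|].
  exact: ExecIf (eval_den bs sa ra) e.
by split=> //; apply: frame_if fr.
Qed.

(* [k] counts the iterations that remain. *)
Lemma triple_while a c s k (I : nat -> state -> Prop) (t : nat -> nat) :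
  well_formed s -> small_expr a -> I k s ->
  (forall j s1, j < k -> well_formed s1 -> frame c s s1 -> I j.+1 s1 ->
     [/\ reads_below A s1 a, den s1 a <> 0 & triple c s1 (t j) (I j)]) ->
  (forall s1, well_formed s1 -> frame c s s1 -> I 0 s1 ->
     reads_below A s1 a /\ den s1 a = 0) ->
  triple (While a c) s (\sum_(j < k) ((expr_cost a).+1 + t j) + (expr_cost a).+1)
    (I 0).
Proof.
move=> wf sa Ik step stop.
(* The frame stays relative to the state before the loop, so that each round may use facts about
   that state. *)
suff: forall s1, well_formed s1 -> frame c s s1 -> I k s1 ->
    exists u s2, [/\ exec b (While a c) s1 u s2,
      u <= \sum_(j < k) ((expr_cost a).+1 + t j) + (expr_cost a).+1 &
      [/\ well_formed s2, frame c s s2 & I 0 s2]].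
  by move=> /(_ s wf (frame_refl _ _) Ik).
move: step; elim: {Ik} k => [|k IH] step s1 wf1 fr1 I1.
  have [ra z] := stop s1 wf1 fr1 I1.
  have [bs _ _] := wf1.
  exists (expr_cost a).+1, s1; split=> //; last by rewrite big_ord0.
  by constructor; rewrite eval_den // z.
have [ra z [u1 [s2 [e1 l1 [wf2 fr2 I2]]]]] := step k s1 (leqnn _) wf1 fr1 I1.
have fr02 := frame_trans fr1 fr2.
have [|u2 [s3 [e2 l2 q]]] := IH _ s2 wf2 fr02 I2.
  by move=> j s' lt_j; apply: step; lia.
have [bs _ _] := wf1.
exists (expr_cost a + u1 + u2).+1, s3; split=> //.
  by apply: ExecWhile (eval_den bs sa ra) _ e1 e2; apply/eqP.
by rewrite big_ord_recr /=; move: l1 l2; set S := \sum_(j < k) _; clear; lia.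
Qed.

Lemma triple_while_const a c s k t (I : nat -> state -> Prop) :
  well_formed s -> small_expr a -> I k s ->
  (forall j s1, j < k -> well_formed s1 -> frame c s s1 -> I j.+1 s1 ->
     [/\ reads_below A s1 a, den s1 a <> 0 & triple c s1 t (I j)]) ->
  (forall s1, well_formed s1 -> frame c s s1 -> I 0 s1 ->
     reads_below A s1 a /\ den s1 a = 0) ->
  triple (While a c) s (k * ((expr_cost a).+1 + t) + (expr_cost a).+1) (I 0).
Proof.
move=> wf sa Ik step stop.
have := triple_while (t := fun=> t) wf sa Ik step stop.
by rewrite sum_nat_const card_ord.
Qed.

End Logic.

(** * Preorder and climbing in a rooted tree *)

Section RootedTree.

Variables (n : nat) (r : 'I_n) (par : 'I_n -> 'I_n).
Hypothesis par_root : par r = r.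
Hypothesis reach_root : forall v, fconnect par v r.

Definition depth (v : 'I_n) : nat := findex par v r.

Lemma iter_root i : iter i par r = r.
Proof. by elim: i => //= i ->. Qed.

Lemma iter_depth v : iter (depth v) par v = r.
Proof. exact: iter_findex. Qed.

Lemma iter_deep i v : depth v <= i -> iter i par v = r.
Proof. by move=> le_i; rewrite -(subnK le_i) iterD iter_depth iter_root. Qed.

Lemma depth_lt v : depth v < n.
Proof.
apply: leq_trans (findex_max (reach_root v)) _.
by rewrite -[n in _ <= n]card_ord; apply: max_card.
Qed.

Lemma depth_min i v : iter i par v = r -> depth v <= i.
Proof.
move=> E; case: (ltnP i (order par v)) => lt_i.
  by rewrite /depth -E findex_iter.
by apply: leq_trans lt_i; apply/ltnW/findex_max.
Qed.

Lemma depth_par v : v != r -> depth v = (depth (par v)).+1.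
Proof.
move=> vr; have dv : 0 < depth v.
  by rewrite lt0n; apply: contraNneq vr => d0; rewrite -(iter_depth v) d0.
apply/eqP; rewrite eqn_leq; apply/andP; split.
  by apply: depth_min; rewrite iterSr iter_depth.
by rewrite -(ltn_predK dv) ltnS; apply: depth_min; rewrite -iterSr (ltn_predK dv) iter_depth.
Qed.

Lemma par_fixed v : par v = v -> v = r.
Proof.
move=> E; have it i : iter i par v = v by elim: i => //= i ->.
by rewrite -(iter_depth v) it.
Qed.

Lemma depth_iter i v : i <= depth v -> depth (iter i par v) = depth v - i.
Proof.
elim: i => [|i IH] lt_i; first by rewrite subn0.
have di := IH (ltnW lt_i).
have nr : iter i par v != r.
  apply: contraTneq lt_i => E; rewrite -leqNgt; exact: depth_min.
by move: (depth_par nr); rewrite di /= ; lia.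
Qed.

(** The bound by the depth makes the exponent unique ([iter_inj]): past it, the iterates repeat the
    root. *)
Lemma fconnect_iterP v z :
  reflect (exists2 i, i <= depth v & iter i par v = z) (fconnect par v z).
Proof.
apply: (iffP idP) => [vz|[i _ <-]]; last exact: fconnect_iter.
have E := iter_findex vz.
case: (leqP (findex par v z) (depth v)) => le_d; first by exists (findex par v z).
exists (depth v) => //; rewrite iter_depth -E iter_deep //; exact: ltnW.
Qed.

Lemma iter_inj i j v : i <= depth v -> j <= depth v ->
  iter i par v = iter j par v -> i = j.
Proof. by move=> li lj E; have := depth_iter li; rewrite E depth_iter //; lia. Qed.

Lemma fconnect_depth v z : fconnect par v z -> depth z <= depth v.
Proof. by case/fconnect_iterP => i li <-; rewrite depth_iter // leq_subr. Qed.

Lemma fconnect_anti v z : fconnect par v z -> fconnect par z v -> v = z.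
Proof.
move=> /fconnect_iterP[i li E] /fconnect_depth.
rewrite -E depth_iter // => le; have -> // : i = 0 by lia.
Qed.

Lemma fconnect_par z v :
  fconnect par z v = (z == v) || (z != r) && fconnect par (par z) v.
Proof.
case: (eqVneq z v) => [->|zv] /=; first exact: connect0.
case: (eqVneq z r) => [zr|zr] /=.
  apply/negbTE/fconnect_iterP => -[i _]; rewrite zr iter_root => rv.
  by rewrite zr rv eqxx in zv.
apply/idP/idP => [/fconnect_iterP[[|i] _ E]|].
- by rewrite -E eqxx in zv.
- by rewrite -E iterSr fconnect_iter.
by apply: connect_trans; apply: fconnect1.
Qed.

Lemma fconnect_par_self z : z != r -> fconnect par (par z) z = false.
Proof.
move=> zr; apply/negP => /fconnect_depth; rewrite (depth_par zr); lia.
Qed.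

(** * The preorder listing and its intervals *)

Definition children (z : 'I_n) : seq 'I_n :=
  [seq c <- enum 'I_n | (par c == z) && (c != z)].

Fixpoint preorder_upto (k : nat) (z : 'I_n) : seq 'I_n :=
  if k is k'.+1 then z :: flatten [seq preorder_upto k' c | c <- children z]
  else [::].

Definition preorder := preorder_upto n.

(** [x] is listed once for each step at which its chain of ancestors meets [z]. This one count
    yields both membership and the absence of repetitions. Steps past [depth x] are excluded because
    the chain then stays at the root. *)
Lemma count_preorder_upto k z x :
  count_mem x (preorder_upto k z) =
    \sum_(i < k | i <= depth x) (iter i par x == z).
Proof.
elim: k z => [|k IH] z; first by rewrite big_ord0.
rewrite /= count_flatten -map_comp sumnE big_map.
rewrite (eq_bigr (fun c => \sum_(i < k | i <= depth x) (iter i par x == c)));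
  last by move=> c _; rewrite -IH.
rewrite /children big_filter big_enum_cond exchange_big /=.
rewrite [RHS]big_mkcond big_ord_recl /= eq_sym; congr (_ + _).
rewrite [RHS]big_mkcond [LHS]big_mkcond /=; apply: eq_bigr => i _.
rewrite [bump 0 i]add1n; case: (leqP i (depth x)) => [le_i|gt_i] /=; last by rewrite ltnNge (ltnW gt_i).
set y := iter i par x.
rewrite big_mkcond (bigD1 y) //= eqxx big1 ?addn0; last first.
  by move=> c /negbTE; rewrite eq_sym => ->; case: ifP.

(* [y] is the root exactly when [i] has reached [depth x]; both sides are then 0, on the left
   because [children] excludes [z] itself, on the right by the range of the index. *)
case: (ltnP i (depth x)) => lt_i.
  have yr : y != r.
    by apply: contraTneq lt_i => E; rewrite -leqNgt; apply: depth_min.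
  rewrite /=; case: (eqVneq (par y) z) => //= E.
  case: (eqVneq y z) => // yz; move: yr; rewrite (par_fixed (v := y)) ?eqxx //.
  by rewrite E.
have yr : y = r by rewrite /y iter_deep.
by rewrite yr par_root; case: (eqVneq r z).
Qed.

Lemma count_preorder z x : count_mem x (preorder z) = fconnect par x z.
Proof.
rewrite count_preorder_upto; case: fconnect_iterP => [[i li E]|no].
  have lt_in : i < n by apply: leq_ltn_trans li (depth_lt x).
  rewrite (bigD1 (Ordinal lt_in)) //= E eqxx big1 ?addn0 // => j /andP[lj ne].
  case: eqP => // E'; case/eqP: ne; apply: val_inj; apply: iter_inj lj li _ => //=.
  by rewrite E'.
rewrite big1 // => i li; case: eqP => // E; case: no; by exists i.
Qed.

Lemma mem_preorder z x : (x \in preorder z) = fconnect par x z.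
Proof. by rewrite -has_pred1 has_count count_preorder lt0b. Qed.

Lemma preorder_uniq z : uniq (preorder z).
Proof.
apply: count_mem_uniq => x; rewrite count_preorder mem_preorder //.
Qed.

(** Fuel beyond [n - depth z] is never consumed: a child is one level deeper than its parent, and
    depths stay below [n]. *)
Lemma preorder_upto_stable k z : n - depth z <= k ->
  preorder_upto k z = preorder_upto k.+1 z.
Proof.
elim: k z => [|k IH] z le_k; first by have := depth_lt z; lia.
rewrite [LHS]/= [RHS]/=; congr (_ :: flatten _).
apply/eq_in_map => c; rewrite mem_filter => /andP[/andP[/eqP pc cz] _].
have cr : c != r by apply: contra_neq cz => cr; rewrite -pc cr par_root.
by apply: IH; have := depth_par cr; rewrite pc; lia.
Qed.

Lemma preorder_eq z : preorder z = z :: flatten (map preorder (children z)).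
Proof.
rewrite /preorder.
have n0 : 0 < n by case: n r => [[]|].
have -> : preorder_upto n z = preorder_upto n.-1.+1 z by rewrite (ltn_predK n0).
rewrite [LHS]/=; congr (_ :: flatten _).
apply/eq_in_map => c; rewrite mem_filter => /andP[/andP[/eqP pc cz] _].
have cr : c != r by apply: contra_neq cz => cr; rewrite -pc cr par_root.
rewrite (@preorder_upto_stable n.-1) ?(ltn_predK n0) //.
by have := depth_par cr; lia.
Qed.

Definition order_list := preorder r.
Definition pre (v : 'I_n) : nat := index v order_list.

Lemma order_list_uniq : uniq order_list.
Proof. exact: preorder_uniq. Qed.

Lemma mem_order_list v : v \in order_list.
Proof. by rewrite mem_preorder reach_root. Qed.

Lemma size_order_list : size order_list = n.
Proof.
rewrite -[RHS](card_ord n) cardE; apply: perm_size.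
apply: uniq_perm; rewrite ?order_list_uniq ?enum_uniq // => v.
by rewrite mem_order_list mem_enum.
Qed.

Lemma pre_lt v : pre v < n.
Proof. by rewrite -[n in _ < n]size_order_list index_mem mem_order_list. Qed.

Lemma nth_pre v : nth r order_list (pre v) = v.
Proof. by rewrite nth_index // mem_order_list. Qed.

Lemma pre_nth i : i < n -> pre (nth r order_list i) = i.
Proof. by move=> lt_i; rewrite /pre index_uniq ?order_list_uniq ?size_order_list. Qed.

Lemma pre_inj : injective pre.
Proof. by move=> u v E; rewrite -(nth_pre u) E nth_pre. Qed.

(** By induction on the depth: the block of [z] lies inside the block of its parent, and the block
    of the root is the whole list. *)
Lemma order_list_infix z :
  exists p q, order_list = p ++ preorder z ++ q /\ pre z = size p.
Proof.
suff [p [q E]] : exists p q, order_list = p ++ preorder z ++ q.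
  exists p, q; split=> //.
  rewrite /pre E index_cat preorder_eq /= eqxx addn0.
  have u := order_list_uniq.
  case: ifP => // zp; move: u; rewrite E cat_uniq => /and3P[_ /hasPn/(_ z)].
  by rewrite preorder_eq /= inE eqxx zp => /(_ isT).
have [k] := ubnP (depth z); elim: k z => // k IH z lt_k.
case: (eqVneq z r) => [->|zr]; first by exists [::], [::]; rewrite cats0.
have [|p [q E]] := IH (par z); first by have := depth_par zr; lia.
have zc : z \in children (par z).
  rewrite mem_filter eqxx mem_enum andbT /=.
  by apply: contra_neq zr => E'; apply: par_fixed.
case/splitPr: {1}_ / zc (preorder_eq (par z)) => c1 c2.
rewrite map_cat flatten_cat /= => E'.
exists (p ++ par z :: flatten (map preorder c1)),
  (flatten (map preorder c2) ++ q).
by rewrite E E' /= -?catA /= -?catA /= -?catA.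
Qed.

Lemma index_infix (T : eqType) (p q s : seq T) x : uniq (p ++ s ++ q) ->
  x \in p ++ s ++ q ->
  (x \in s) = (size p <= index x (p ++ s ++ q) < size p + size s).
Proof.
rewrite cat_uniq cat_uniq has_cat negb_or.
move=> /and3P[_ /andP[ps pq] /and3P[_ sq _]].
rewrite !index_cat !mem_cat.
case xp: (x \in p) => /=.
  move=> _; rewrite leqNgt index_mem xp /=.
  by apply/negP => xs; move/hasPn/(_ _ xs): ps; rewrite /= xp.
case xs: (x \in s) => /=; first by rewrite leq_addr ltn_add2l index_mem xs.
by rewrite ltn_add2l [_ + _ < _]ltnNge !leq_addr.
Qed.

Lemma subtree_interval z x :
  fconnect par x z = (pre z <= pre x < pre z + size (preorder z)).
Proof.
have [p [q [E pz]]] := order_list_infix z.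
have u := order_list_uniq; have m := mem_order_list.
rewrite -mem_preorder pz /pre E; apply: index_infix; by rewrite -E.
Qed.

Lemma pre_par z : z != r -> pre (par z) < pre z.
Proof.
move=> zr; rewrite ltn_neqAle; apply/andP; split.
  apply: contra_neq zr => /pre_inj; exact: par_fixed.
by have := subtree_interval (par z) z; rewrite fconnect1 => /esym/andP[].
Qed.

(** The default [n] is a sentinel for a subtree that ends the listing. The traversal gives [n] the
    label [n], so the label of [next_vertex z] is the end of the interval of [z] in every case. *)
Definition next_vertex (z : 'I_n) : nat :=
  nth n (map val order_list) (pre z + size (preorder z)).

Lemma pre_end_le z : pre z + size (preorder z) <= n.
Proof.
have [p [q [E ->]]] := order_list_infix z.
by have := size_order_list; rewrite E !size_cat; lia.
Qed.

Lemma next_vertex_le z : next_vertex z <= n.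
Proof.
rewrite /next_vertex; set i := _ + _; case: (ltnP i n) => lt_i.
  by rewrite (nth_map r) ?size_order_list //; apply/ltnW/ltn_ord.
by rewrite nth_default // size_map size_order_list.
Qed.

(** * Binary lifting along a monotone count *)

Variable c : 'I_n -> nat.
Hypothesis c_par : forall v, c (par v) <= c v.

Lemma c_iter i j v : i <= j -> c (iter j par v) <= c (iter i par v).
Proof.
move=> /subnK <-; elim: (j - i) => //= k IH; exact: leq_trans (c_par _) IH.
Qed.

(** [t] is the distance from [d] to its highest ancestor whose value exceeds [th]. The second
    alternative of the last clause absorbs exponents past the root, where the iterates no longer
    change. *)
Definition highest d th t : Prop :=
  [/\ t <= depth d, th < c (iter t par d) &
      forall i, th < c (iter i par d) -> i <= t \/ iter i par d = iter t par d].

Lemma highest_ex d th : th < c d -> exists t, highest d th t.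
Proof.
move=> lt_th.
pose Q i := (i <= depth d) && (th < c (iter i par d)).
have Q0 : exists i, Q i by exists 0; rewrite /Q leq0n.
have Qb i : Q i -> i <= depth d by case/andP.
case: (ex_maxnP Q0 Qb) => t /andP[le_t lt_t] tmax; exists t; split=> // i lt_i.
case: (leqP i (depth d)) => le_i; first by left; apply: tmax; apply/andP.
right; rewrite iter_deep ?(ltnW le_i) // in lt_i *.
have : Q (depth d) by rewrite /Q leqnn iter_depth.
by move/tmax => le_t'; rewrite iter_deep.
Qed.

(** One round of lifting. As [c] weakly decreases towards the root, its value [2 ^ k] steps above
    [z] tells which half of the window of length [2 ^ k.+1] contains [t]. *)
Lemma climb_step d th t k z : highest d th t ->
  (exists2 s, z = iter s par d & s <= t < s + 2 ^ k.+1) ->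
  exists2 s, (if th < c (iter (2 ^ k) par z) then iter (2 ^ k) par z else z)
               = iter s par d
    & s <= t < s + 2 ^ k.
Proof.
move=> [le_t lt_t tmax] [s -> /andP[st ts]].
rewrite -iterD; have := expnS 2 k; have := expn_gt0 2 k; rewrite addnC.
case: ifP => [lt_c|ge_c] /= pos e2; last first.
  exists s => //; rewrite st /= ltnNge; apply/negP => le_q.
  by have := c_iter d le_q; rewrite leqNgt (leq_ltn_trans _ lt_t) // leqNgt ge_c.
case: (tmax _ lt_c) => [le_q|->].
  by exists (s + 2 ^ k) => //; lia.
(* The jump lands on the target itself, possibly through an exponent past the root, so [t] serves as
   the new offset. *)
by exists t => //; lia.
Qed.

End RootedTree.

(** * Counting arcs *)

Section GraphFacts.

Variables (n : nat) (e : rel 'I_n) (r : 'I_n) (par : 'I_n -> 'I_n).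
Variable es : seq ('I_n * 'I_n).
Hypothesis n_gt1 : 1 < n.
Hypothesis e_sym : symmetric e.
Hypothesis dfs : dfs_tree e r par.
Hypothesis esE : edge_list e es.

Lemma dfs_root : par r = r.
Proof. by case: dfs. Qed.

Lemma dfs_reach v : fconnect par v r.
Proof.
have [pr [vis run_vis all_vis]] := dfs.
move: v (all_vis v) => {all_vis}.
elim: run_vis => [v|later u earlier v visited _ IH _ _ _ pv w].
  by rewrite inE => /eqP ->; apply: connect0.
rewrite inE => /orP[/eqP->|/IH //].
apply: connect_trans (fconnect1 par v) _; rewrite pv; apply: IH.
by rewrite mem_cat inE eqxx orbT.
Qed.

Lemma neighbour_ex v : exists u, e v u.
Proof.
have [pr [vis run_vis all_vis]] := dfs.
(* From the second visited vertex on, every visited vertex has a neighbour: a new vertex has the one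
   it was reached from, and the root has its first child. A run that stops at the root contradicts
   [n_gt1]. *)
suff [E|nb] : vis = [:: r] \/ forall v, v \in vis -> exists u, e v u.
- have /card_le1_eqP vr : #|'I_n| <= 1.
    apply/card_le1_eqP => x y _ _.
    by move: (all_vis x) (all_vis y); rewrite E !inE => /eqP -> /eqP ->.
  have : #|'I_n| <= 1 by apply/card_le1_eqP.
  by rewrite card_ord leqNgt n_gt1.
- exact: nb.
elim: run_vis => [|later u earlier w visited _ IH _ uw _ _]; first by left.
right=> x; rewrite inE => /orP[/eqP ->|xv]; first by exists u; rewrite e_sym.
case: IH => [E|IH]; last exact: IH.
have ur : u \in [:: r] by rewrite -E mem_cat inE eqxx orbT.
move: xv ur; rewrite E !inE => /eqP -> /eqP <-; by exists w.
Qed.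

(** Every vertex lies on an edge and an edge has at most two ends. This absorbs all terms in [n]
    into the bounds in terms of [m]. *)
Lemma vertices_le_edges : n <= 2 * #|edge_set e|.
Proof.
have cov : [set: 'I_n] \subset cover (edge_set e).
  apply/subsetP => v _; have [u vu] := neighbour_ex v.
  apply/bigcupP; exists [set v; u]; last by rewrite !inE eqxx.
  by apply/imsetP; exists (v, u); rewrite ?inE.
have := subset_leq_card cov; rewrite cardsT card_ord => /leq_trans; apply.
apply: leq_trans (leq_card_cover _) _.
rewrite mulnC -sum_nat_const; apply: leq_sum => S /imsetP[[u v] _ ->] /=.
by rewrite cards2; case: (_ == _).
Qed.

Lemma edges_gt0 : 0 < #|edge_set e|.
Proof. by have := vertices_le_edges; lia. Qed.

Lemma size_edge_list : size es = #|edge_set e|.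
Proof. by have /perm_size := esE; rewrite size_map cardE. Qed.

Lemma edges_le_square : #|edge_set e| <= n * n.
Proof.
apply: leq_trans (leq_imset_card _ _) _.
by apply: leq_trans (max_card _) _; rewrite card_prod card_ord.
Qed.

(** The order matters: the source of the [j]-th arc is the [j]-th endpoint in the edge part of the
    input, so sources can be read without a separate array. *)
Definition arcs_of : seq ('I_n * 'I_n) :=
  flatten [seq [:: (p.1, p.2); (p.2, p.1)] | p <- es].

Lemma size_arcs : size arcs_of = 2 * size es.
Proof. by rewrite /arcs_of; elim: es => //= p s ->; rewrite mulnS. Qed.

Lemma set2_inj (a b c d : 'I_n) : [set a; b] = [set c; d] ->
  (a = c /\ b = d) \/ (a = d /\ b = c).
Proof.
move/setP => E; move: (E a) (E b) (E c) (E d); rewrite !inE !eqxx ?orbT /=.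
move=> /esym/orP Ha /esym/orP Hb /orP Hc /orP Hd.
by case: Ha Hb Hc Hd => /eqP ? [] /eqP ? [] /eqP ? [] /eqP ?; subst; auto.
Qed.

Lemma mem_arcs v u : ((v, u) \in arcs_of) = e v u.
Proof.
have mem_es : (fun S => S \in [seq [set p.1; p.2] | p <- es]) =1
              (fun S => S \in edge_set e).
  by move=> S; rewrite (perm_mem esE) mem_enum.
apply/flattenP/idP => [[_ /mapP[p pes ->]]|vu].
  have : [set p.1; p.2] \in edge_set e by rewrite -mem_es; apply/mapP; exists p.
  move=> /imsetP[[c d]]; rewrite inE /= => cd /set2_inj pcd.
  rewrite !inE => /orP[] /eqP[-> ->]; case: pcd => -[-> ->] //; by rewrite e_sym.
have : [set v; u] \in edge_set e by apply/imsetP; exists (v, u); rewrite ?inE.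
rewrite -mem_es => /mapP[p pes /set2_inj pE].
exists [:: (p.1, p.2); (p.2, p.1)]; first by apply/mapP; exists p.
by rewrite !inE; case: pE => -[-> ->]; rewrite eqxx ?orbT.
Qed.

End GraphFacts.

(** * Queries expressed by arc counts *)

Section Answers.

Variables (n : nat) (e : rel 'I_n) (r : 'I_n) (par : 'I_n -> 'I_n).
Variable arcs : seq ('I_n * 'I_n).
Hypothesis e_sym : symmetric e.
Hypothesis par_root : par r = r.
Hypothesis reach_root : forall v, fconnect par v r.
Hypothesis mem_arcs : forall v u, ((v, u) \in arcs) = e v u.

Definition arcs_upto (P : pred 'I_n) (z : 'I_n) : nat :=
  count (fun a => fconnect par z a.1 && P a.2) arcs.
(** The root is its own parent, so its own arcs have to be left out by a separate case. *)
Definition arcs_above (P : pred 'I_n) (z : 'I_n) : nat :=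
  if z == r then 0 else arcs_upto P (par z).
Definition arcs_at (P : pred 'I_n) (z : 'I_n) : nat :=
  count (fun a => (z == a.1) && P a.2) arcs.

Lemma arcs_uptoE P z : arcs_upto P z = arcs_above P z + arcs_at P z.
Proof.
rewrite /arcs_above /arcs_upto /arcs_at.
case: (eqVneq z r) => [zr|zr].
  rewrite add0n; apply: eq_count => a /=.
  by rewrite (fconnect_par par_root reach_root) zr eqxx /= orbF.
rewrite -count_predUI -[LHS]addn0; congr (_ + _).
  apply: eq_count => a /=; rewrite (fconnect_par par_root reach_root) zr /=.
  by case: (_ == _); case: (fconnect _ _ _); case: (P _).
rewrite -(count_pred0 arcs); apply: eq_count => a /=.
case: (eqVneq z a.1) => [<-|_] /=; last by rewrite andbF.
by rewrite (fconnect_par_self par_root reach_root zr).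
Qed.

Lemma arcs_upto_par P z : arcs_upto P (par z) <= arcs_upto P z.
Proof.
case: (eqVneq z r) => [->|zr]; first by rewrite par_root.
by rewrite [leqRHS]arcs_uptoE /arcs_above (negbTE zr) leq_addr.
Qed.

Lemma arcs_at_gt0P (P : pred 'I_n) z :
  reflect (exists2 u, P u & e u z) (0 < arcs_at P z).
Proof.
rewrite -has_count; apply: (iffP hasP) => [[[v u] vu /andP[/eqP /= -> Pu]]|[u Pu uz]].
  by exists u => //; rewrite e_sym -mem_arcs.
by exists (z, u); rewrite ?mem_arcs ?[e z u]e_sym //= eqxx.
Qed.

Lemma index_iter x y i : fconnect par x y -> i <= findex par x y ->
  index (iter i par x) (traject par x (findex par x y).+1) = i.
Proof.
move=> xy le_i.
have sub : (findex par x y).+1 <= order par x by apply: findex_max.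
rewrite -(nth_traject par (le_i : i < _.+1)) index_uniq ?size_traject //.
have := orbit_uniq par x; rewrite /orbit -(subnKC sub) trajectD cat_uniq.
by case/andP.
Qed.

Lemma traject_uniq x y : fconnect par x y ->
  uniq (traject par x (findex par x y).+1).
Proof.
move=> xy; have sub : (findex par x y).+1 <= order par x by apply: findex_max.
have := orbit_uniq par x; rewrite /orbit -(subnKC sub) trajectD cat_uniq.
by case/andP.
Qed.

Lemma index_rev (T : eqType) (s : seq T) x : uniq s -> x \in s ->
  index x (rev s) = size s - (index x s).+1.
Proof.
move=> us xs; have lt := xs; rewrite -index_mem in lt.
have E : nth x (rev s) (size s - (index x s).+1) = x.
  by rewrite nth_rev; [rewrite subnSK // subKn ?nth_index // ltnW|lia].
rewrite -{1}E index_uniq ?rev_uniq // size_rev; lia.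
Qed.

Variables (A : {set 'I_n}) (x y : 'I_n).
Hypothesis xy_comparable : anc_desc par x y.

(** The path is always read upwards, from [bot] over [l] steps to [top]; [down] says that [x] is its
    upper end. *)
Let down := fconnect par y x.
Let top := if down then x else y.
Let bot := if down then y else x.
Let l := findex par bot top.

Lemma bot_top : fconnect par bot top.
Proof. by rewrite /bot /top /down; case: ifP => // yx; move: xy_comparable; rewrite /anc_desc yx orbF. Qed.

Lemma mem_tree_path v :
  (v \in tree_path par x y) = [exists i : 'I_l.+1, iter i par bot == v].
Proof.
have -> : (v \in tree_path par x y) = (v \in traject par bot l.+1).
  rewrite /tree_path /l /bot /top /down.
  case: ifP => xy; case: ifP => yx //; last 2 first.
  - by rewrite mem_rev.
  - by move: xy_comparable; rewrite /anc_desc xy yx.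
  by rewrite (fconnect_anti par_root reach_root xy yx).
apply/trajectP/existsP => [[i li ->]|[i /eqP <-]].
  by exists (Ordinal li).
by exists i.
Qed.

(** Being nearer to [x] means being higher if [x] is the upper end, and lower otherwise; this turns
    positions on the path into exponents of [par]. *)
Lemma index_tree_path i j : i <= l -> j <= l ->
  (if down then j <= i else i <= j) ->
  index (iter i par bot) (tree_path par x y)
    <= index (iter j par bot) (tree_path par x y).
Proof.
move=> il jl.
have ii := index_iter bot_top il; have ij := index_iter bot_top jl.
have u := traject_uniq bot_top.
have mi k : k <= l -> iter k par bot \in traject par bot l.+1.
  by move=> kl; apply/trajectP; exists k.
move=> ij_ord; rewrite /tree_path; case: ifP => xy.
  case E: down ij_ord => ij_ord.
    have l0 : l = 0.
      by rewrite /l /bot /top E (fconnect_anti par_root reach_root xy E) findex0.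
    by move: il jl; rewrite l0 !leqn0 => /eqP -> /eqP ->.
  have -> : traject par x (findex par x y).+1 = traject par bot l.+1.
    by rewrite /l /bot /top E.
  by rewrite ii ij.
have yx : down by move: xy_comparable; rewrite /anc_desc xy.
rewrite yx in ij_ord.
have -> : traject par y (findex par y x).+1 = traject par bot l.+1.
  by rewrite /bot /l /top /bot yx.
rewrite !index_rev // ?mi // ii ij !size_traject; lia.
Qed.

Let inA : pred 'I_n := fun u => u \in A.
Local Notation mass := (arcs_upto inA).
Local Notation above := (arcs_above inA).

Lemma mass_antitone i j : i <= j ->
  mass (iter j par bot) <= mass (iter i par bot).
Proof. exact: c_iter (@arcs_upto_par _) _ _ _. Qed.

Lemma iter_top : iter l par bot = top.
Proof. exact: iter_findex bot_top. Qed.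

Lemma l_le_depth : l <= depth r par bot.
Proof.
have [i li E] := (fconnect_iterP par_root reach_root _ _ bot_top).
apply: leq_trans li; rewrite leqNgt; apply/negP => lt_i.
have := index_iter bot_top (leqnn _).
by rewrite -/l iter_top -E (index_iter bot_top (ltnW lt_i)) => il; rewrite il ltnn in lt_i.
Qed.

Lemma mass_beyond i : l < i -> i <= depth r par bot ->
  mass (iter i par bot) <= above top.
Proof.
move=> li id; rewrite /arcs_above -iter_top.
case: eqP => [E|_]; last exact: (mass_antitone li).
have lE := iter_inj reach_root l_le_depth (leqnn _).
by move: li; rewrite (lE _) ?E ?iter_depth // ltnNge id.
Qed.

(** An edge at a path vertex [v] would give [above top <= above v < mass v <= mass bot]. *)
Lemma answer_none : mass bot <= above top -> query_answer e par A x y None.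
Proof.
move=> le_m; rewrite /query_answer /= => u v; apply/negP => /and3P[uA].
rewrite mem_tree_path => /existsP[[i li] /eqP /= vE] uv.
rewrite ltnS in li.
have : 0 < arcs_at inA v by apply/arcs_at_gt0P; exists u.
have top_le : above top <= above v.
  rewrite /arcs_above; case: (eqVneq top r) => // tr.
  have vr : v != r.
    apply: contra_neq tr => vr; rewrite -iter_top -(subnK li) iterD vE vr.
    exact: iter_root.
  by rewrite (negbTE vr) -iter_top -vE -!iterS; apply: mass_antitone.
have := mass_antitone (leq0n i); rewrite vE arcs_uptoE /=; lia.
Qed.

(** The chosen [z] has an incident arc into [A] because its parent fails the threshold:
    [above z <= th < mass z]. At the root, [above z] is 0. *)
Lemma answer_some t : above top < mass bot ->
  highest r par mass bot (if down then above top else (mass bot).-1) t ->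
  let z := iter t par bot in
  above z < mass z /\
  forall u, u \in A -> e u z -> query_answer e par A x y (Some (u, z)).
Proof.
move=> lt_m [td lt_t tmax] z.
set th := (if down then _ else _) in lt_t tmax.
have th_top : above top <= th by rewrite /th; case: ifP => // _; lia.
(* The search runs over the whole path to the root but cannot leave the query path: strictly above
   [top] the mass is at most [above top], hence at most [th]. *)
have tl : t <= l.
  by rewrite leqNgt; apply/negP => lt; have := mass_beyond lt td; lia.
have above_z : above z <= th.
  rewrite /arcs_above; case: eqP => // /eqP zr; rewrite leqNgt; apply/negP => lt.
  have [] := tmax t.+1 lt; first by rewrite ltnn.
  by rewrite /= => /(par_fixed reach_root) /eqP; rewrite (negbTE zr).
split=> [|u uA uz]; first exact: leq_ltn_trans lt_t.
split.
  rewrite uA uz andbT /= mem_tree_path; apply/existsP.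
  by exists (Ordinal (tl : t < l.+1)).
move=> u' v' /and3P[uA']; rewrite mem_tree_path => /existsP[[i li] /eqP /= <-] uv'.
rewrite ltnS in li.
have at_i : 0 < arcs_at inA (iter i par bot) by apply/arcs_at_gt0P; exists u'.
apply: index_tree_path => //; rewrite /th in lt_t tmax above_z.
have mi := arcs_uptoE inA (iter i par bot).
(* Nearest to the top: an arc at a path vertex lifts its mass past [above top], so maximality of [t]
   places the vertex at or below [z]. *)
case: ifP lt_t tmax above_z => _ lt_t tmax above_z.
  have top_le : above top <= above (iter i par bot).
    rewrite /arcs_above; case: (eqVneq top r) => // tr.
    have vr : iter i par bot != r.
      apply: contra_neq tr => vr; rewrite -iter_top -(subnK li) iterD vr.
      exact: iter_root.
    by rewrite (negbTE vr) -iter_top -!iterS; apply: mass_antitone.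
  have /tmax[//|E] : above top < mass (iter i par bot) by lia.
  have lE := iter_inj reach_root (leq_trans li l_le_depth) td E.
  by rewrite lE.
(* Nearest to the bottom: the mass of [z] already equals that of [bot], so a vertex strictly between
   them on the path, or [bot] itself, adds no arc. *)
rewrite leqNgt; apply/negP => it.
have := mass_antitone it; have := mass_antitone (leq0n i).
have : mass (iter i.+1 par bot) <= above (iter i par bot).
  rewrite /arcs_above; case: eqP => // E.
  have ir : depth r par bot <= i by apply: depth_min.
  by move: (leq_trans td ir); rewrite leqNgt it.
rewrite /z in lt_t *; rewrite /=; lia.
Qed.

End Answers.

(** * Persistent counting trees *)

Notation "c1 ;; c2" := (Seq c1 c2) (at level 60, right associativity).

Definition psum (f : nat -> nat) (p : nat) : nat := \sum_(0 <= j < p) f j.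

Lemma psum0 f : psum f 0 = 0.
Proof. by rewrite /psum big_geq. Qed.

Lemma psumD f p q : psum f (p + q) = psum f p + psum (fun j => f (p + j)) q.
Proof.
rewrite /psum (big_cat_nat (n := p)) ?leq_addr //=; congr (_ + _).
rewrite -{1}[p]add0n big_addn addKn; apply: eq_bigr => j _; by rewrite addnC.
Qed.

Lemma eq_psum f g p : (forall j, j < p -> f j = g j) -> psum f p = psum g p.
Proof. by move=> E; apply: eq_big_nat => j /andP[_]; apply: E. Qed.

(* Node [q] of a binary tree of height [k] counts the multiset [f] of keys
   below [2 ^ k]; nodes are numbered below [bound] and node 0 is its own child. *)
Fixpoint counts (lt rt ct : nat -> nat) (bound k q : nat) (f : nat -> nat) : Prop :=
  [/\ q < bound, ct q <= q, ct q = psum f (2 ^ k) &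
      if k is k'.+1 then
        counts lt rt ct bound k' (lt q) f /\
        counts lt rt ct bound k' (rt q) (fun j => f (2 ^ k' + j))
      else True].

Lemma counts_lt lt rt ct bound k q f : counts lt rt ct bound k q f -> q < bound.
Proof. by case: k => [|k] []. Qed.

(** Bounding a count by the number of its node keeps it below the capacity, hence inside a word,
    without tracking how many keys were inserted. *)
Lemma counts_le lt rt ct bound k q f : counts lt rt ct bound k q f -> ct q <= q.
Proof. by case: k => [|k] []. Qed.

Lemma counts_sum lt rt ct bound k q f :
  counts lt rt ct bound k q f -> ct q = psum f (2 ^ k).
Proof. by case: k => [|k] []. Qed.

(** Persistence: a version refers only to nodes below its bound, so nodes allocated later leave it
    intact. *)
Lemma counts_ext lt rt ct lt' rt' ct' bound bound' k q f f' :
  counts lt rt ct bound k q f -> bound <= bound' ->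
  (forall j, j < bound -> [/\ lt' j = lt j, rt' j = rt j & ct' j = ct j]) ->
  (forall j, j < 2 ^ k -> f' j = f j) ->
  counts lt' rt' ct' bound' k q f'.
Proof.
move=> + le_b E; elim: k q f f' => [|k IH] q f f' /= [lt_q le_q sum_q ch] Ef.
  have [_ _ c] := E _ lt_q; split=> //; rewrite ?c //.
    exact: leq_trans le_b.
  by rewrite sum_q; apply: eq_psum => j lt_j; rewrite Ef.
have [l r c] := E _ lt_q; split; rewrite ?c ?l ?r //.
- exact: leq_trans le_b.
- by rewrite sum_q; apply: eq_psum => j lt_j; rewrite Ef.
case: ch => cl cr; split.
  by apply: IH cl _ => j lt_j; apply: Ef; apply: leq_trans lt_j _; rewrite leq_exp2l.
by apply: IH cr _ => j lt_j; apply: Ef; rewrite expnS mul2n -addnn ltn_add2l.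
Qed.

(** Node 0, being its own child, is the empty tree of every height; memory that is initially zero
    already contains it. *)
Lemma counts_null lt rt ct bound k : lt 0 = 0 -> rt 0 = 0 -> ct 0 = 0 ->
  0 < bound -> counts lt rt ct bound k 0 (fun=> 0).
Proof.
move=> l r c b0.
have z f p : (forall j, f j = 0) -> psum f p = 0.
  by move=> f0; apply: big1 => j _.
elim: k => [|k IH] /=; split; rewrite ?c ?l ?r ?z //.
Qed.

(** Register 20 is the current node, 21 the key relative to its range, 22 the count so far, and 23
    the width of the range, halved in each round. A step to the right adds the count of the left
    child. *)
Definition prefix_body :=
  Assign 23 (Bin Div (Reg 23) (Const 2)) ;;
  If (Bin Lt (Reg 21) (Reg 23))
    (Assign 20 (Read (cell 11 (Reg 20))))
    (Assign 22 (Bin Add (Reg 22) (Read (cell 13 (Read (cell 11 (Reg 20)))))) ;;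
     Assign 21 (Bin Sub (Reg 21) (Reg 23)) ;;
     Assign 20 (Read (cell 12 (Reg 20)))).

Definition prefix_count :=
  (Assign 22 (Const 0) ;; Assign 23 (Reg 12)) ;;
  While (Bin Lt (Const 1) (Reg 23)) prefix_body.

Definition add_key (f : nat -> nat) (p : nat) : nat -> nat :=
  fun j => f j + (j == p).

Lemma psum_add_key f p q : psum (add_key f p) q = psum f q + (p < q).
Proof.
elim: q => [|q IH]; first by rewrite !psum0.
rewrite /psum !big_nat_recr //= -!/(psum _ _) IH /add_key eq_sym ltnS.
by case: ltngtP => _ /=; lia.
Qed.

(** Path copying: node 24 becomes the copy of node 20 and shares its untouched child. The next copy
    always takes the next free number, so the link to it is written before it exists. *)
Definition insert_body :=
  Assign 23 (Bin Div (Reg 23) (Const 2)) ;;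
  Write (cell 13 (Reg 24)) (Bin Add (Read (cell 13 (Reg 20))) (Const 1)) ;;
  If (Bin Lt (Reg 21) (Reg 23))
    (Write (cell 11 (Reg 24)) (Bin Add (Reg 24) (Const 1)) ;;
     Write (cell 12 (Reg 24)) (Read (cell 12 (Reg 20))) ;;
     Assign 20 (Read (cell 11 (Reg 20))))
    (Write (cell 12 (Reg 24)) (Bin Add (Reg 24) (Const 1)) ;;
     Write (cell 11 (Reg 24)) (Read (cell 11 (Reg 20))) ;;
     Assign 20 (Read (cell 12 (Reg 20))) ;;
     Assign 21 (Bin Sub (Reg 21) (Reg 23))) ;;
  Assign 24 (Bin Add (Reg 24) (Const 1)).

Definition insert :=
  (Assign 25 (Reg 24) ;; Assign 23 (Reg 12)) ;;
  While (Bin Lt (Const 1) (Reg 23)) insert_body ;;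
  (Write (cell 13 (Reg 24)) (Bin Add (Read (cell 13 (Reg 20))) (Const 1)) ;;
   Assign 24 (Bin Add (Reg 24) (Const 1))).

Ltac oblig :=
  repeat match goal with
  | |- _ /\ _ => split
  | |- [/\ _, _ & _] => split
  | |- True => exact Logic.I
  end;
  try solve [done | lia].

(** * Correctness of prefix counting and of insertion *)

Section Machine.

Variables (b W A B n K X : nat) (inp : seq nat).

Local Notation wf := (well_formed W A B n K inp).
Local Notation T := (triple b W A B n K inp).
Local Notation arr s a := (fun j => mem s (B + a + 16 * j)).

Lemma cell_eq a a' j j' : a < 16 -> a' < 16 ->
  (B + a + 16 * j == B + a' + 16 * j') = (a == a') && (j == j').
Proof.
move=> a16 a16'.
by apply/eqP/andP => [E|[/eqP -> /eqP ->]] //; split; apply/eqP; lia.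
Qed.

Lemma base_regs s : wf s ->
  [/\ reg s 15 = B, reg s 14 = n, reg s 13 = K & reg s 12 = 2 ^ K].
Proof. by case. Qed.

Hypothesis A_eq : A = B + 16 * X.

Lemma cell_lt a j : a < 16 -> j < X -> B + a + 16 * j < A.
Proof. by rewrite A_eq; lia. Qed.

Lemma cell_bound s a j : wf s -> a < 16 -> j < X -> mem s (B + a + 16 * j) < W.
Proof. by move=> [[_ bm] _ _] a16 jX; apply/bm/cell_lt. Qed.

Lemma reg_bound s i : wf s -> i < 32 -> reg s i < W.
Proof. by move=> [[br _] _ _]; apply: br. Qed.

Hypothesis W_gt32 : 32 < W.
Hypothesis W_fits : W ^ max_leaves < 2 ^ b.
Hypothesis A_ltW : A < W.
Hypothesis K_ltX : K < X.
Hypothesis P_ltX : 2 ^ K < X.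
Hypothesis n_ltP : n < 2 ^ K.

Lemma half_exp k : 2 ^ k.+1 %/ 2 = 2 ^ k.
Proof. by rewrite expnS mulKn. Qed.

Lemma pow_bound k : k <= K -> 2 ^ k < X.
Proof. by move=> kK; apply: leq_ltn_trans P_ltX; rewrite leq_exp2l. Qed.

Definition prefix_time : nat := K * 100 + 20.

Lemma prefix_count_triple s f : wf s ->
  counts (arr s 11) (arr s 12) (arr s 13) X K (reg s 20) f ->
  reg s 21 < 2 ^ K ->
  T prefix_count s prefix_time (fun s' => reg s' 22 = psum f (reg s 21)).
Proof.
move=> w cf lt_p.
have [bs [r15 r14 r13 r12] inpE] := w.
have ct_root := counts_sum cf.
pose total := psum f (2 ^ K).
have total_lt : total < X.
  rewrite /total -ct_root; apply: leq_ltn_trans (counts_le cf) (counts_lt cf).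
(* [g] is the multiset of the current subtree with keys shifted to start at 0. The last clause keeps
   the running count below [X], so that it fits a word. *)
pose I k s1 := exists g,
  [/\ counts (arr s 11) (arr s 12) (arr s 13) X k (reg s1 20) g,
      reg s1 21 < 2 ^ k, reg s1 23 = 2 ^ k,
      reg s1 22 + psum g (reg s1 21) = psum f (reg s 21) &
      reg s1 22 + psum g (2 ^ k) <= total].
apply: (triple_weaken (Q := I 0)).
- apply: triple_straight_seq => //.
    by rewrite /= /upd /= r12; split; split => //; lia.
  move=> w0 fr0.
  apply: (triple_while_const W_gt32 W_fits (k := K) (I := I) (t := cost prefix_body)) => //.
  - exists f; rewrite /= /upd /= r12; split=> //; lia.
  - move=> k s1 kK w1 fr1 [g [cg lt1 e23 e22 tot]].
    have mE x : mem s1 x = mem s x by rewrite (frame_pure fr1).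
    have [r15' _ _ _] := base_regs w1.
    have pk := pow_bound (ltnW kK).
    have [ltq leq sumq [cl cr]] := cg.
    have l_lt := counts_lt cl; have r_lt := counts_lt cr.
    have lsum := counts_sum cl.
    rewrite expnS mul2n -addnn psumD in tot.
    split=> //.
      by rewrite /= e23 -{1}(expn0 2) ltn_exp2l.
    apply: triple_straight => //.
      rewrite /= /upd /= e23 half_exp; split; first by oblig.
      split=> //; rewrite r15' !mE.
      by have b21 := reg_bound w1 (isT : 21 < 32); case: ltnP => /= le21; oblig.
    rewrite /I /prefix_body /= /upd /= e23 half_exp r15' !mE.
    case: ltnP => /= le21.
      exists g; split=> //; lia.
    exists (fun j => g (2 ^ k + j)); rewrite lsum; split => //.
    - by rewrite expnS in lt1; lia.
    - by rewrite -e22 -{2}(subnKC le21) psumD addnA.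
    - lia.
  by move=> s1 w1 fr1 [g [_ _ e23 _ _]]; rewrite /= e23.
- rewrite /prefix_time /=; lia.
move=> s' w' fr' [g [_ lt1 _ <- _]].
(* At height 0 the remaining key is below 1, hence 0, and nothing is left to add. *)
by case: (reg s' 21) lt1 => //; rewrite psum0 addn0.
Qed.

Definition insert_time : nat := K * 150 + 50.

Definition agree_below (s s' : state) (q : nat) : Prop :=
  forall j, j < q -> [/\ arr s' 11 j = arr s 11 j, arr s' 12 j = arr s 12 j &
                       arr s' 13 j = arr s 13 j].

Lemma insert_triple s f : wf s ->
  counts (arr s 11) (arr s 12) (arr s 13) (reg s 24) K (reg s 20) f ->
  reg s 21 < 2 ^ K -> reg s 24 + K + 1 <= X ->
  T insert s insert_time (fun s' =>
    [/\ reg s' 25 = reg s 24, reg s' 24 = reg s 24 + K + 1,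
        agree_below s s' (reg s 24) &
        counts (arr s' 11) (arr s' 12) (arr s' 13) (reg s 24 + K + 1) K (reg s 24)
          (add_key f (reg s 21))]).
Proof.
move=> w cf lt_p le_X.
have [r15 r14 r13 r12] := base_regs w.
set q0 := reg s 24 in cf le_X *; set p := reg s 21 in lt_p *.
set bd := q0 + K + 1 in le_X *.
(* The last clause of [I]: however memory beyond the current node is filled in,
   if the current node becomes correct, then so does the new root. *)
pose I k s1 := exists g,
  [/\ counts (arr s 11) (arr s 12) (arr s 13) q0 k (reg s1 20) g,
      [/\ reg s1 21 < 2 ^ k, reg s1 23 = 2 ^ k & reg s1 25 = q0],
      reg s1 24 + k = q0 + K,
      agree_below s s1 q0 &
      forall lt rt ct,
        (forall j, j < reg s1 24 ->
          [/\ lt j = arr s1 11 j, rt j = arr s1 12 j & ct j = arr s1 13 j]) ->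
        counts lt rt ct bd k (reg s1 24) (add_key g (reg s1 21)) ->
        counts lt rt ct bd K q0 (add_key f p)].
eapply triple_time.
- apply: triple_straight_seq => //.
    by rewrite /= /upd /= r12; oblig.
  move=> w0 fr0.
  apply: (triple_seq (Q1 := I 0)).
    apply: (triple_while_const W_gt32 W_fits (k := K) (I := I) (t := cost insert_body)) => //.
    - by exists f; rewrite /= /upd /= r12; split=> //; split.
    - move=> k s1 kK w1 fr1 [g [cg [lt1 e23 e25] e24 ag wand]].
      have [r15' _ _ _] := base_regs w1.
      have pk := pow_bound (ltnW kK).
      have [ltq leq sumq [cl cr]] := cg.
      have l_lt := counts_lt cl; have r_lt := counts_lt cr.
      have [aL aR aC] := ag _ ltq.
      have q_lt : reg s1 24 < X by lia.
      have q0_le : q0 <= reg s1 24 by lia.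
      split=> //.
        by rewrite /= e23 -{1}(expn0 2) ltn_exp2l.
      (* The fresh node lies above all old ones, so writing it cannot disturb the node being
         copied. *)
      have /negbTE ne : reg s1 20 != reg s1 24 by apply/eqP; lia.
      have b21 := reg_bound w1 (isT : 21 < 32).
      apply: triple_straight => //.
        rewrite /= /upd /= e23 half_exp r15' !cell_eq //= ne /= aL aR aC.
        by case: (ltnP (reg s1 21) _) => /= le21; oblig.
      rewrite /I /insert_body /= /upd /= e23 half_exp.
      case: (ltnP (reg s1 21) _) => /= le21; rewrite /upd /= r15' ?cell_eq //= ?ne /= ?aL ?aR.
      + exists g; split=> //; [lia| |].
          move=> j lt_j; have [a1 a2 a3] := ag j lt_j.
          have /negbTE nj : j != reg s1 24 by apply/eqP; lia.
          by rewrite /= !cell_eq //= nj.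
        move=> lt rt ct E c'; apply: wand => [j lt_j|].
          have [|-> -> ->] := E j; first by rewrite /= addn1 ltnW.
          have /negbTE nj : j != reg s1 24 by apply/eqP; lia.
          by rewrite /= !cell_eq //= nj.
        have [|l1 r1 c1] := E (reg s1 24); first by rewrite /= addn1.
        rewrite /= !cell_eq //= eqxx /= ?aR ?aL ?aC in l1 r1 c1.
        split; rewrite ?l1 ?r1 ?c1 ?aC ?sumq ?psum_add_key ?lt1 //; try lia.
        have E0 j : j < q0 ->
            [/\ lt j = arr s 11 j, rt j = arr s 12 j & ct j = arr s 13 j].
          move=> lt_j; have [|-> -> ->] := E j; first by rewrite /= addn1; lia.
          have [<- <- <-] := ag j lt_j.
          have /negbTE nj : j != reg s1 24 by apply/eqP; lia.
          by rewrite /= !cell_eq //= nj.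
        split; first by rewrite /= addn1 in c' *.
        apply: (counts_ext cr) => [|//|j lt_j]; first by lia.
        by rewrite /add_key; case: eqP => ?; lia.
      exists (fun j => g (2 ^ k + j)); split=> //.
      + by split=> //; rewrite expnS in lt1; lia.
      + lia.
      + move=> j lt_j; have [a1 a2 a3] := ag j lt_j.
        have /negbTE nj : j != reg s1 24 by apply/eqP; lia.
        by rewrite /= !cell_eq //= nj.
      move=> lt rt ct E c'; apply: wand => [j lt_j|].
        have [|-> -> ->] := E j; first by rewrite /= addn1 ltnW.
        have /negbTE nj : j != reg s1 24 by apply/eqP; lia.
        by rewrite /= !cell_eq //= nj.
      have [|l1 r1 c1] := E (reg s1 24); first by rewrite /= addn1.
      rewrite /= !cell_eq //= eqxx /= ?aR ?aL ?aC in l1 r1 c1.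
      split; rewrite ?l1 ?r1 ?c1 ?aC ?sumq ?psum_add_key ?lt1 //; try lia.
      have E0 j : j < q0 ->
          [/\ lt j = arr s 11 j, rt j = arr s 12 j & ct j = arr s 13 j].
        move=> lt_j; have [|-> -> ->] := E j; first by rewrite /= addn1; lia.
        have [<- <- <-] := ag j lt_j.
        have /negbTE nj : j != reg s1 24 by apply/eqP; lia.
        by rewrite /= !cell_eq //= nj.
      split.
        apply: (counts_ext cl) => [|//|j lt_j]; first by lia.
        by rewrite /add_key; case: eqP => ?; lia.
      rewrite /= addn1 in c' *.
      apply: (counts_ext c') => // j lt_j; rewrite /add_key; congr (_ + _).
      by rewrite -{1}(subnKC le21) eqn_add2l.
    by move=> s1 w1 fr1 [g [_ [_ e23 _] _ _ _]]; rewrite /= e23.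
  move=> s1 w1 fr1 [g [cg [lt1 e23 e25] e24 ag wand]].
  have [r15' _ _ _] := base_regs w1.
  have [ltq leq sumq _] := cg.
  have [aL aR aC] := ag _ ltq.
  have q0_le : q0 <= reg s1 24 by lia.
  have e0 : reg s1 21 = 0 by rewrite expn0 in lt1; lia.
  apply: triple_straight => //.
    by rewrite /= /upd /= r15' aC; oblig.
  rewrite /= /upd /= r15' e25; split=> //; first by lia.
    move=> j lt_j; have [a1 a2 a3] := ag j lt_j.
    have /negbTE nj : j != reg s1 24 by apply/eqP; lia.
    by rewrite /= !cell_eq //= nj.
  apply: wand => [j lt_j|].
    have /negbTE nj : j != reg s1 24 by apply/eqP; lia.
    by rewrite /= !cell_eq //= nj.
  have E24 : reg s1 24 < bd by lia.
  by split=> //; rewrite cell_eq //= eqxx /= ?aC; [lia|rewrite psum_add_key sumq e0].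
rewrite /insert_time /=; lia.
Qed.

End Machine.

(** * Construction and queries *)

(* Linked lists of numbers [j]; a link holds [j.+1], and 0 ends the list. *)
Fixpoint chain (next : nat -> nat) (p : nat) (l : seq nat) : Prop :=
  if l is j :: l' then p = j.+1 /\ chain next (next j) l' else p = 0.

Lemma chain_ext next next' p l : chain next p l ->
  (forall j, j \in l -> next' j = next j) -> chain next' p l.
Proof.
elim: l p => [|j l IH] p //= [-> c] E; split=> //.
rewrite E ?mem_head //; apply: IH c _ => i il; by rewrite E // inE il orbT.
Qed.

(** Array [a] holds the heads and [a.+1] the links. Each index is put in front of the list of its
    key, hence the [rev] in [bucket]. *)
Definition chains_body (a : nat) :=
  Assign 19 (Read (Bin Add (Reg 17) (Reg 16))) ;;
  Write (cell a.+1 (Reg 16)) (Read (cell a (Reg 19))) ;;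
  Write (cell a (Reg 19)) (Bin Add (Reg 16) (Const 1)) ;;
  Assign 16 (Bin Add (Reg 16) (Const 1)).

Definition build_chains (a : nat) :=
  Assign 16 (Const 0) ;; While (Bin Lt (Reg 16) (Reg 18)) (chains_body a).

Section Machine.

Variables (b W A B n K X : nat) (inp : seq nat).
Hypothesis W_gt32 : 32 < W.
Hypothesis W_fits : W ^ max_leaves < 2 ^ b.
Hypothesis A_eq : A = B + 16 * X.
Hypothesis A_ltW : A < W.

Local Notation wf := (well_formed W A B n K inp).
Local Notation T := (triple b W A B n K inp).
Local Notation arr s a := (fun j => mem s (B + a + 16 * j)).

Definition bucket (key : nat -> nat) (cnt v : nat) : seq nat :=
  rev [seq j <- iota 0 cnt | key j == v].

Lemma bucketS key cnt v :
  bucket key cnt.+1 v = if key cnt == v then cnt :: bucket key cnt v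
                        else bucket key cnt v.
Proof.
rewrite /bucket -[cnt.+1]addn1 iotaD filter_cat rev_cat /= add0n.
by case: ifP.
Qed.

Lemma bucket_lt key cnt v j : j \in bucket key cnt v -> j < cnt.
Proof. by rewrite mem_rev mem_filter mem_iota => /and3P[]. Qed.

Lemma build_chains_triple a s key : wf s -> a.+1 < 16 ->
  (forall j, j < X -> arr s a j = 0) ->
  reg s 18 <= X -> reg s 17 + reg s 18 <= B ->
  (forall j, j < reg s 18 -> mem s (reg s 17 + j) = key j /\ key j < X) ->
  T (build_chains a) s (reg s 18 * 60 + 40) (fun s' =>
    forall v, v < X ->
      chain (arr s' a.+1) (arr s' a v) (bucket key (reg s 18) v)).
Proof.
move=> w a16 z le18 le17 keyE.
set cnt := reg s 18 in le18 le17 keyE *.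
have st : straight (chains_body a) && tame (chains_body a).
  (* These tests compute only for a concrete array number, so all admissible numbers are checked. *)
  have /allP := isT : all (fun a => straight (chains_body a) && tame (chains_body a))
    (iota 0 15).
  by apply; rewrite mem_iota.
pose I k s1 := [/\ reg s1 16 + k = cnt &
  forall v, v < X -> chain (arr s1 a.+1) (arr s1 a v) (bucket key (reg s1 16) v)].
apply: (triple_time (t := _)).
- apply: triple_straight_seq => //; first by rewrite /=; oblig.
  move=> w0 fr0.
  apply: (triple_weaken (Q := I 0)).
  + apply: (triple_while_const W_gt32 W_fits (k := cnt) (I := I) (t := cost (chains_body a))) => //.
    move=> k s1 kc w1 fr1 [e16 ch].
      have [r15 _ _ _] := base_regs w1.
      have e18 : reg s1 18 = cnt by rewrite fr1.1.
      have e17 : reg s1 17 = reg s 17 by rewrite fr1.1.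
      have lt16 : reg s1 16 < cnt by lia.
      have [k1 k2] := keyE _ lt16.
      have keyE1 : mem s1 (reg s 17 + reg s1 16) = key (reg s1 16).
        rewrite -k1; have [_ _ inpE] := w1; have [_ _ inpE0] := w.
        by rewrite inpE ?inpE0 //; lia.
      split=> //; first by rewrite /= e18 lt16.
      apply: triple_straight => //.
        rewrite /= /upd /= r15 e17 keyE1.
        have hb : mem s1 (B + a + 16 * key (reg s1 16)) < W.
          by apply: (cell_bound A_eq w1); lia.
        by oblig.
      have a1 : (a.+1 == a) = false by lia.
      have a2 : (a == a.+1) = false by lia.
      split; first by rewrite /= /upd /=; lia.
      move=> v vX; rewrite /= /upd /= r15 e17 keyE1 addn1 !cell_eq //; try lia.
      rewrite !eqxx a2 /= bucketS [v == _]eq_sym.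
      have ext p : chain (arr s1 a.+1) p (bucket key (reg s1 16) v) ->
          chain (fun j =>
            if B + a.+1 + 16 * j == B + a + 16 * key (reg s1 16) then (reg s1 16).+1
            else if B + a.+1 + 16 * j == B + a.+1 + 16 * reg s1 16
                 then mem s1 (B + a + 16 * key (reg s1 16))
                 else mem s1 (B + a.+1 + 16 * j)) p (bucket key (reg s1 16) v).
        move=> c; apply: chain_ext c _ => j /bucket_lt lt_j.
        rewrite !cell_eq ?a1 ?eqxx //=; try lia.
        by have /negbTE -> : j != reg s1 16 by apply/eqP; lia.
      case: eqP => [vE|_]; last by apply: ext; apply: ch.
      split=> //; rewrite !cell_eq ?a1 ?eqxx //=; try lia.
      by apply: ext; rewrite vE; apply: ch.
    move=> s1 w1 fr1 [e16 _]; have e18 : reg s1 18 = cnt by rewrite fr1.1.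
    by rewrite /= e18 -e16 addn0 ltnn.
  + exact: leqnn.
  by move=> s' w' fr' [e16 ch] v vX; rewrite -e16 addn0; apply: ch.
rewrite /=; lia.
Qed.

End Machine.

(** Level [k] is level [k - 1] composed with itself. Subtracting [n] from the index moves one level
    down, and removing the remainder modulo [n] gives the start of that level. Level 0 is copied
    from the input. *)
Definition jump_body :=
  If (Bin Lt (Reg 16) (Reg 14))
    (Write (cell 0 (Reg 16)) (Read (Bin Add (Const 2) (Reg 16))))
    (Assign 18 (Bin Sub (Reg 16) (Reg 14)) ;;
     Write (cell 0 (Reg 16))
       (Read (cell 0 (Bin Add (Bin Sub (Reg 18) (Bin Mod (Reg 18) (Reg 14)))
                              (Read (cell 0 (Reg 18))))))) ;;
  Assign 16 (Bin Add (Reg 16) (Const 1)).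

Definition jump_phase :=
  (Assign 16 (Const 0) ;; Assign 17 (Bin Mul (Reg 13) (Reg 14))) ;;
  While (Bin Lt (Reg 16) (Reg 17)) jump_body.

Definition push_body :=
  Assign 11 (Bin Sub (Reg 10) (Const 1)) ;;
  If (Bin Eq (Reg 11) (Reg 9)) Skip
    (Write (cell 5 (Reg 8)) (Reg 11) ;; Assign 8 (Bin Add (Reg 8) (Const 1))) ;;
  Assign 10 (Read (cell 2 (Reg 11))).

(** After a pop, the entry beneath is the vertex visited once the whole subtree is finished, because
    the children are pushed on top of it. This fills array 7. *)
Definition visit :=
  Assign 8 (Bin Sub (Reg 8) (Const 1)) ;;
  Assign 9 (Read (cell 5 (Reg 8))) ;;
  Write (cell 6 (Reg 9)) (Reg 16) ;;
  Write (cell 8 (Reg 16)) (Reg 9) ;;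
  Write (cell 7 (Reg 9)) (Read (cell 5 (Bin Sub (Reg 8) (Const 1)))) ;;
  Assign 10 (Read (cell 1 (Reg 9))).

Definition order_body :=
  visit ;;
  While (Reg 10) push_body ;;
  Assign 16 (Bin Add (Reg 16) (Const 1)).

Definition last_jump (x : expr) :=
  Read (cell 0 (Bin Add (Bin Mul (Bin Sub (Reg 13) (Const 1)) (Reg 14)) x)).

(** The input does not name the root. Two jumps of [2 ^ (K - 1)] from vertex 0 climb [2 ^ K] levels,
    more than any depth, and so find it. The sentinel [n] gets the label [n] and the bottom of the
    stack. *)
Definition order_init :=
  Assign 7 (last_jump (Const 0)) ;;
  Assign 7 (last_jump (Reg 7)) ;;
  Write (cell 6 (Reg 14)) (Reg 14) ;;
  Write (cell 5 (Const 0)) (Reg 14) ;;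
  Write (cell 5 (Const 1)) (Reg 7) ;;
  Assign 8 (Const 2) ;;
  Assign 16 (Const 0).

Definition order_phase := order_init ;; While (Bin Lt (Reg 16) (Reg 14)) order_body.

(** Vertices are treated in preorder, so the version of the parent is available. The root starts
    from node 0, the empty tree. *)
Definition version_select :=
  Assign 9 (Read (cell 8 (Reg 16))) ;;
  Assign 17 (Read (Bin Add (Const 2) (Reg 9))) ;;
  If (Bin Eq (Reg 17) (Reg 9))
    (Assign 20 (Const 0)) (Assign 20 (Read (cell 9 (Reg 17)))) ;;
  Write (cell 10 (Reg 9)) (Reg 20) ;;
  Assign 10 (Read (cell 3 (Reg 9))).

(* The arcs [2 * i] and [2 * i + 1] are the two orientations of edge [i]. *)
Definition arc_fetch :=
  Assign 11 (Bin Sub (Reg 10) (Const 1)) ;;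
  Assign 18 (Read (Bin Add (Bin Add (Const 2) (Reg 14))
    (Bin Sub (Bin Add (Reg 11) (Const 1))
             (Bin Mul (Const 2) (Bin Mod (Reg 11) (Const 2)))))) ;;
  Assign 21 (Read (cell 6 (Reg 18))).

Definition arc_next := Assign 20 (Reg 25) ;; Assign 10 (Read (cell 4 (Reg 11))).

Definition arc_body := arc_fetch ;; insert ;; arc_next.

Definition version_store :=
  Write (cell 9 (Reg 9)) (Reg 20) ;; Assign 16 (Bin Add (Reg 16) (Const 1)).

Definition version_body :=
  version_select ;; While (Reg 10) arc_body ;; version_store.

Definition version_phase :=
  (Assign 24 (Const 1) ;; Assign 16 (Const 0)) ;;
  While (Bin Lt (Reg 16) (Reg 14)) version_body.

Definition clear_regs (l : seq nat) : cmd :=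
  foldr (fun i c => Assign i (Const 0) ;; c) Skip l.

Definition read_sizes :=
  Assign 14 (Read (Const 0)) ;;
  Assign 15 (Bin Add (Bin Add (Const 2) (Reg 14)) (Bin Mul (Const 2) (Read (Const 1)))) ;;
  Assign 13 (Const 0) ;;
  Assign 12 (Const 1).

Definition double_body :=
  Assign 12 (Bin Mul (Const 2) (Reg 12)) ;; Assign 13 (Bin Add (Reg 13) (Const 1)).

Definition double_loop := While (Bin Eq (Bin Lt (Reg 14) (Reg 12)) (Const 0)) double_body.

(** Shared by construction and queries. Registers 3 to 31 may hold values of any size when a query
    starts and are cleared first; registers 0 to 2 carry its arguments. *)
Definition setup := clear_regs (iota 3 29) ;; read_sizes ;; double_loop.

Definition child_chains :=
  (Assign 17 (Const 2) ;; Assign 18 (Reg 14)) ;; build_chains 1.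

Definition arc_chains :=
  (Assign 17 (Bin Add (Const 2) (Reg 14)) ;;
   Assign 18 (Bin Mul (Const 2) (Read (Const 1)))) ;; build_chains 3.

Definition construct :=
  jump_phase ;; child_chains ;; arc_chains ;; order_phase ;; version_phase.

Definition build := setup ;; construct.

Definition count_interval :=
  (Assign 20 (Reg 26) ;; Assign 21 (Reg 4)) ;; prefix_count ;;
  (Assign 27 (Reg 22) ;; Assign 20 (Reg 26) ;; Assign 21 (Reg 3)) ;; prefix_count ;;
  Assign 27 (Bin Sub (Reg 27) (Reg 22)).

Definition level_count :=
  (Assign 20 (Read (cell 9 (Reg 6))) ;; Assign 21 (Reg 28)) ;; prefix_count ;;
  (Assign 27 (Reg 22) ;; Assign 20 (Read (cell 10 (Reg 6))) ;; Assign 21 (Reg 28)) ;;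
  prefix_count ;;
  Assign 27 (Bin Sub (Reg 27) (Reg 22)).

(** On truth values, [a < b] means [b] and not [a]; the nested comparison thus tests whether the
    label of [y] lies in the interval of [x]. Registers 5 and 6 end up with the top and the bottom
    of the path, and 26 with the version just above the top. *)
Definition orient :=
  Assign 5 (Read (cell 6 (Reg 1))) ;;
  Assign 6 (Read (cell 6 (Reg 2))) ;;
  Assign 7 (Bin Lt (Bin Lt (Reg 6) (Reg 5))
                   (Bin Lt (Reg 6) (Read (cell 6 (Read (cell 7 (Reg 1))))))) ;;
  If (Reg 7) (Assign 5 (Reg 1) ;; Assign 6 (Reg 2)) (Assign 5 (Reg 2) ;; Assign 6 (Reg 1)) ;;
  Assign 26 (Read (cell 10 (Reg 5))).

Definition climb_fetch :=
  Assign 8 (Bin Sub (Reg 8) (Const 1)) ;;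
  Assign 10 (Read (cell 0 (Bin Add (Bin Mul (Reg 8) (Reg 14)) (Reg 6)))) ;;
  Assign 26 (Read (cell 9 (Reg 10))).

Definition climb_body :=
  climb_fetch ;; count_interval ;;
  If (Bin Lt (Reg 9) (Reg 27)) (Assign 6 (Reg 10)) Skip.

Definition climb := Assign 8 (Reg 13) ;; While (Reg 8) climb_body.

Definition pick_body :=
  (Assign 11 (Bin Div (Reg 11) (Const 2)) ;; Assign 28 (Bin Add (Reg 10) (Reg 11))) ;;
  If (Bin Lt (Reg 28) (Reg 4))
    (level_count ;; If (Bin Lt (Reg 9) (Reg 27)) Skip (Assign 10 (Reg 28)))
    Skip.

(** A bisection for the last label [p] of the interval such that the arcs at the vertex to labels
    below [p] are no more than those to labels below the interval; some arc then ends at the vertex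
    labelled [p]. *)
Definition pick :=
  Assign 28 (Reg 3) ;; level_count ;;
  (Assign 9 (Reg 27) ;; Assign 10 (Reg 3) ;; Assign 11 (Reg 12)) ;;
  While (Bin Lt (Const 1) (Reg 11)) pick_body ;;
  (Assign 0 (Const 1) ;; Assign 1 (Read (cell 8 (Reg 10))) ;; Assign 2 (Reg 6)).

Definition search :=
  orient ;; count_interval ;;
  (Assign 9 (Reg 27) ;; Assign 26 (Read (cell 9 (Reg 6)))) ;; count_interval ;;
  If (Bin Lt (Reg 9) (Reg 27))
    (If (Reg 7) Skip (Assign 9 (Bin Sub (Reg 27) (Const 1))) ;; climb ;; pick)
    (Assign 0 (Const 0)).

Definition load_subtree :=
  Assign 3 (Read (cell 6 (Reg 0))) ;;
  Assign 4 (Read (cell 6 (Read (cell 7 (Reg 0))))).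

Definition load_vertex :=
  Assign 3 (Read (cell 6 (Reg 0))) ;; Assign 4 (Bin Add (Reg 3) (Const 1)).

Definition query_subtree := setup ;; load_subtree ;; search.
Definition query_vertex := setup ;; load_vertex ;; search.

(** * Layout of the input and capacity of the arrays *)

Section Build.

Variables (n : nat) (r : 'I_n) (par : 'I_n -> 'I_n) (es : seq ('I_n * 'I_n)).
Variables (b W A K X : nat).
Let B := 2 + n + 2 * size es.
Local Notation inp := (input par es).
Local Notation arcs := (arcs_of es).

Local Notation wf := (well_formed W A B n K inp).
Local Notation T := (triple b W A B n K inp).
Local Notation arr s a := (fun j => mem s (B + a + 16 * j)).

Lemma input_par (v : 'I_n) : nth 0 inp (2 + v) = par v.
Proof.
rewrite /input /= nth_cat size_map size_enum_ord ltn_ord.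
by rewrite (nth_map v) add0n ?size_enum_ord ?nth_ord_enum ?ltn_ord.
Qed.

(** The target of an arc is the source of its twin; [j + 1 - 2 * (j %% 2)] exchanges [2 * i] and
    [2 * i + 1]. *)
Lemma input_arc j : j < 2 * size es ->
  nth 0 inp (2 + n + j) = (nth (r, r) arcs j).1 /\
  nth 0 inp (2 + n + (j + 1 - 2 * (j %% 2))) = (nth (r, r) arcs j).2.
Proof.
move=> lt_j.
have shift i : nth 0 inp (2 + n + i)
    = nth 0 (flatten [seq [:: val p.1; val p.2] | p <- es]) i.
  rewrite /input /= nth_cat size_map size_enum_ord.
  by rewrite ltnNge leq_addr /= addKn.
rewrite !shift /arcs_of; elim: es j lt_j {shift} => [|p s IH] [|[|j]] //= lt_j.
have [|<- <-] := IH j; first by lia.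
split=> //; rewrite (_ : _ - _ = (j + 1 - 2 * (j %% 2)).+2) //; lia.
Qed.

Hypothesis par_root : par r = r.
Hypothesis reach_root : forall v, fconnect par v r.
Hypothesis W_gt32 : 32 < W.
Hypothesis W_fits : W ^ max_leaves < 2 ^ b.
Hypothesis A_eq : A = B + 16 * X.
Hypothesis A_ltW : A < W.
Hypothesis K_gt0 : 0 < K.
Hypothesis P_ltX : 2 ^ K < X.
Hypothesis n_ltP : n < 2 ^ K.
Hypothesis Kn_leX : K * n <= X.
Hypothesis n_ltX : n.+1 < X.
Hypothesis nodes_leX : 1 + 2 * size es * (K + 1) <= X.

Lemma n_gt0 : 0 < n.
Proof. by case: n r => [[]|]. Qed.

(** * The table of iterated parents *)

Lemma jump_index k k' (v v' : 'I_n) : k * n + v = k' * n + v' -> k = k' /\ v = v'.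
Proof.
have divE k1 (v1 : 'I_n) : (k1 * n + v1) %/ n = k1.
  by rewrite divnMDl ?n_gt0 // divn_small // addn0.
move=> E; have kk : k = k' by rewrite -(divE k v) E divE.
by split=> //; apply: val_inj; move: E; rewrite kk => /addnI.
Qed.

Lemma jump_triple s : wf s ->
  T jump_phase s (K * n * 60 + 40) (fun s' =>
    forall k (v : 'I_n), k < K -> mem s' (B + 0 + 16 * (k * n + v)) = iter (2 ^ k) par v).
Proof.
move=> w; have [r15 r14 r13 r12] := base_regs w.
have n0 := n_gt0.
pose I k s1 := reg s1 16 + k = K * n /\
  forall k (v : 'I_n), k * n + v < reg s1 16 ->
    mem s1 (B + 0 + 16 * (k * n + v)) = iter (2 ^ k) par v.
apply: (triple_time (t := _)).
- apply: triple_straight_seq => //.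
    by rewrite /= /upd /= r13 r14; oblig.
  move=> w0 fr0.
  apply: (triple_weaken (Q := I 0)).
  + apply: (triple_while_const W_gt32 W_fits (k := K * n) (I := I) (t := cost jump_body)) => //.
      move=> k s1 kc w1 fr1 [e16 J].
      have [r15' r14' _ _] := base_regs w1.
      have e17 : reg s1 17 = K * n by rewrite fr1.1 //= /upd /= r13 r14.
      have lt16 : reg s1 16 < K * n by lia.
      set i := reg s1 16 in e16 J lt16 *.
      have lt_v : i %% n < n by rewrite ltn_mod.
      pose v := Ordinal lt_v; pose l := i %/ n.
      have iE : i = l * n + v by rewrite -divn_eq.
      have lK : l < K by rewrite ltn_divLR.
      have inE := input_par v.
      have memE x : x < B -> mem s1 x = nth 0 inp x by have [_ _ inpE] := w1; apply: inpE.
      split=> //; first by rewrite /= e17 -/i lt16.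
      have jumpE : n <= i -> exists2 l', l = l'.+1 &
          [/\ (i - n) - (i - n) %% n = l' * n, i - n = l' * n + v,
              mem s1 (B + 0 + 16 * (i - n)) = iter (2 ^ l') par v &
              mem s1 (B + 0 + 16 * (l' * n + iter (2 ^ l') par v)) = iter (2 ^ l) par v].
        move=> ni; exists l.-1; first by rewrite prednK // divn_gt0.
        have l0 : 0 < l by rewrite divn_gt0.
        have lE : l.-1.+1 = l by rewrite prednK.
        have lmul : l * n = n + l.-1 * n by rewrite -{1}lE mulSn.
        have iE' : i - n = l.-1 * n + v by rewrite iE lmul -addnA addKn.
        have vi : l.-1 * n + v < i by rewrite -iE'; lia.
        split=> //.
        - by rewrite iE' modnMDl modn_small ?ltn_ord // addnK.
        - by rewrite iE' J.
        rewrite J; first by rewrite -iterD addnn -mul2n -expnS lE.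
        by move: (ltn_ord (iter (2 ^ l.-1) par v)); lia.
      have vE : i < n -> v = i :> nat by move=> lt_in; rewrite /= modn_small.
      apply: triple_straight => //.
        rewrite /= /upd /= -/i r15' r14'.
        case: (ltnP i n) => /= cmp.
          rewrite memE; last by rewrite /B; lia.
          by rewrite -(vE cmp) inE; move: (ltn_ord (par v)) => lt_p; oblig; rewrite /B; lia.
        have [l' lE [E1 E2 E3 E4]] := jumpE cmp.
        rewrite ?r15' ?r14' E1 E3 E4.
        move: (ltn_ord (iter (2 ^ l') par v)) (ltn_ord (iter (2 ^ l) par v)) => lt1 lt2.
        have : l' * n + iter (2 ^ l') par v < K * n by rewrite -ltn_divLR // divnMDl // divn_small // addn0; lia.
        by move=> lt3; oblig.
      rewrite /I /jump_body /= /upd /= -/i r15' r14'.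
      have upd_ok (x y : nat) : x = B + 0 + 16 * i -> y = iter (2 ^ l) par v ->
          forall k0 (v0 : 'I_n), k0 * n + v0 < i + 1 ->
          (if B + 0 + 16 * (k0 * n + v0) == x then y
           else mem s1 (B + 0 + 16 * (k0 * n + v0))) = iter (2 ^ k0) par v0.
        move=> -> -> k0 v0 lt0; rewrite cell_eq // eqxx andTb iE.
        case: eqP => [E|ne]; first by have [-> ->] := jump_index E.
        by apply: J; rewrite iE; lia.
      case: (ltnP i n) => /= cmp; rewrite /upd /= -/i ?r15' ?r14'.
        split; first by lia.
        apply: upd_ok => //.
        rewrite memE; last by rewrite /B; lia.
        by rewrite -(vE cmp) inE /l divn_small.
      have [l' lE [E1 E2 E3 E4]] := jumpE cmp.
      split; first by lia.
      by apply: upd_ok => //; rewrite E1 E3 E4.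
    move=> s1 w1 fr1 [e16 _].
    have e17 : reg s1 17 = K * n by rewrite fr1.1 //= /upd /= r13 r14.
    by rewrite /= e17 -e16 addn0 ltnn.
  + exact: leqnn.
  move=> s' w' fr' [e16 J] k v kK; apply: J.
  by rewrite -[reg s' 16]addn0 e16 -ltn_divLR // divnMDl // divn_small // addn0.
rewrite /=; lia.
Qed.

(** * The traversal in preorder *)

Local Notation ol := (order_list r par).
Local Notation preorder := (preorder par).
Local Notation pre := (pre r par).

(** Unlike [children], this is what sorting by parent produces: the list of the root contains the
    root, which [push_body] skips. *)
Definition siblings (z : 'I_n) : seq 'I_n := [seq c <- enum 'I_n | par c == z].

Lemma children_siblings z : children par z = [seq c <- siblings z | c != z].
Proof.
rewrite /siblings -filter_predI; apply: eq_filter => c /=; by rewrite andbC.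
Qed.

Definition par_key (j : nat) : nat := nth 0 inp (2 + j).

Lemma bucket_siblings (z : 'I_n) : bucket par_key n z = map val (rev (siblings z)).
Proof.
rewrite /bucket map_rev; congr rev.
rewrite -val_enum_ord filter_map; congr map; apply: eq_filter => c /=.
by rewrite /par_key input_par.
Qed.

(* The stack of the traversal, from bottom to top; [n] marks the bottom. *)
Definition stack_cells (st : seq 'I_n) : seq nat := n :: map val (rev st).

Definition order_done (s : state) (i : nat) : Prop :=
  mem s (B + 6 + 16 * n) = n /\
  forall j, j < i -> let z : 'I_n := nth r ol j in
    [/\ mem s (B + 6 + 16 * z) = j, mem s (B + 8 + 16 * j) = z &
        mem s (B + 7 + 16 * z) = next_vertex r par z].

Definition stack_holds (s : state) (C : seq nat) : Prop :=
  forall j, j < size C -> mem s (B + 5 + 16 * j) = nth 0 C j.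

(** Each stacked vertex heads a non-empty block of the part still to be listed, so the stack cannot
    outgrow its array. *)
Lemma stack_size i st : ol = take i ol ++ flatten (map preorder st) ->
  i <= n -> i + size st <= n.
Proof.
move=> E le_i; have sz := size_order_list par_root reach_root.
rewrite -{2}sz E size_cat size_takel ?sz // leq_add2l.
elim: st {E} => //= z st IH.
by rewrite (preorder_eq par_root reach_root) /= size_cat; lia.
Qed.

(** The unlisted part of the order is the concatenation of the blocks of the stacked vertices.
    Replacing [z] by its children removes only [z], and the block of [z] is followed by the next
    stacked vertex or by the sentinel. *)
Lemma order_step i z st : ol = take i ol ++ flatten (map preorder (z :: st)) ->
  i < n ->
  [/\ nth r ol i = z,
      ol = take i.+1 ol ++ flatten (map preorder (children par z ++ st)) &
      next_vertex r par z = last n (map val (rev st))].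
Proof.
move=> E lt_i; have sz := size_order_list par_root reach_root.
have pe := preorder_eq par_root reach_root.
have st_i : size (take i ol) = i by rewrite size_takel // sz ltnW.
have iz : nth r ol i = z.
  by rewrite E nth_cat st_i ltnn subnn /= pe.
split=> //.
  rewrite (take_nth r) ?sz // iz {1}E -cats1 -catA; congr (_ ++ _).
  by rewrite /= pe map_cat flatten_cat.
have pz : pre z = i by rewrite -iz pre_nth.
rewrite /next_vertex pz {1}E map_cat nth_cat size_map st_i.
rewrite ltnNge leq_addr /= addKn map_cat nth_cat size_map ltnn subnn.
by case: st {E} => //= y st; rewrite pe rev_cons map_rcons last_rcons.
Qed.

(** The bucket lists vertices in decreasing order, so pushing them leaves the first child on top, as
    in [children]. *)
Lemma push_triple s (z : 'I_n) (st : seq 'I_n) : wf s -> reg s 9 = z -> reg s 8 = (size st).+1 ->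
  size st + size (children par z) < n ->
  chain (arr s 2) (reg s 10) (bucket par_key n z) ->
  stack_holds s (stack_cells st) ->
  T (While (Reg 10) push_body) s (size (siblings z) * 60 + 20) (fun s' =>
    reg s' 8 = (size (children par z ++ st)).+1 /\
    stack_holds s' (stack_cells (children par z ++ st))).
Proof.
move=> w e9 e8 lt_size ch sth.
pose I k s1 := exists old new : seq 'I_n,
  [/\ rev (siblings z) = old ++ new, size new = k,
      chain (arr s 2) (reg s1 10) (map val new),
      reg s1 8 = (size st + size [seq c <- old | c != z]).+1 &
      stack_holds s1 (stack_cells st ++ map val [seq c <- old | c != z])].
have all_new (old new : seq 'I_n) : rev (siblings z) = old ++ new ->
    size [seq c <- old | c != z] <= size (children par z).
  move=> E; rewrite children_siblings -(size_rev [seq _ <- siblings z | _]).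
  by rewrite -filter_rev E filter_cat size_cat leq_addr.
apply: (triple_time (t := _)).
  apply: (triple_weaken (Q := I 0)).
  - apply: (triple_while_const W_gt32 W_fits (k := size (siblings z)) (I := I)
      (t := cost push_body)) => //.
    + exists [::], (rev (siblings z)); split=> //.
      * by rewrite size_rev.
      * by rewrite -bucket_siblings.
      * by rewrite e8 addn0.
      * by rewrite cats0.
    + move=> k s1 kc w1 fr1 [old [[|c new] [E //= [sk] [e10 ch1] e8' sth1]]].
      have [r15 _ _ _] := base_regs w1.
      have e9' : reg s1 9 = z by rewrite fr1.1.
      have m2 x : mem s1 (B + 2 + 16 * x) = mem s (B + 2 + 16 * x).
        by rewrite (frame_array _ fr1).
      have cn := ltn_ord c.
      have /= le_old := all_new _ _ E.
      have ch2 : mem s1 (B + 2 + 16 * c) < W by apply: (cell_bound A_eq w1) => //; lia.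
      have E' : rev (siblings z) = rcons old c ++ new by rewrite cat_rcons.
      have /= le_old' := all_new _ _ E'.
      split=> //; first by rewrite e10.
      apply: triple_straight => //.
        rewrite /= /upd /= e10 subn1 e9' r15 /=.
        by case: eqP => _ /=; rewrite ?r15 ?cell_eq // ?e8' /=; oblig.
      rewrite /I /push_body /= /upd /= e10 subn1 /= e9'.
      exists (rcons old c), new; rewrite -E' filter_rcons -val_eqE /=.
      case: (eqVneq (val c) (val z)) => [_|ne] /=; rewrite r15.
        by rewrite m2; split.
      rewrite cell_eq //= m2 size_rcons e8'; split=> //; first by lia.
      set L := [seq _ <- old | _] in sth1 le_old *.
      have sC : size (stack_cells st ++ map val L) = (size st + size L).+1.
        by rewrite size_cat /= !size_map size_rev.
      move=> j; rewrite map_rcons -rcons_cat -rcons_cons -[n :: _]/(stack_cells st ++ _) size_rcons nth_rcons sC ltnS => le_j.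
      rewrite /= cell_eq //=.
      by case: ltngtP le_j => // lt_j _; apply: sth1; rewrite sC.
    + by move=> s1 w1 fr1 [old [[|c new] [] //= _ _ e10 _ _]].
  - exact: leqnn.
  move=> s' w' fr' [old [[|c new] [E // _ _ e8' sth']]].
  rewrite cats0 in E.
  have cE : [seq c <- old | c != z] = rev (children par z).
    by rewrite -E filter_rev -children_siblings.
  rewrite cE size_rev in e8' sth'; rewrite size_cat e8' addnC; split=> //.
  by rewrite /stack_cells rev_cat map_cat.
rewrite /=; lia.
Qed.

Lemma visit_triple s (z : 'I_n) (st : seq 'I_n) : wf s -> reg s 16 < n ->
  ol = take (reg s 16) ol ++ flatten (map preorder (z :: st)) ->
  reg s 8 = (size st).+2 -> stack_holds s (stack_cells (z :: st)) ->
  order_done s (reg s 16) ->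
  T visit s (cost visit) (fun s' =>
    [/\ reg s' 9 = z, reg s' 8 = (size st).+1,
        reg s' 10 = mem s (B + 1 + 16 * z), stack_holds s' (stack_cells st) &
        order_done s' (reg s 16).+1]).
Proof.
move=> w lt_i E e8 sth [done_n done_i].
have [r15 _ _ _] := base_regs w.
set i := reg s 16 in lt_i E done_i *.
have [iz _ nz] := order_step E lt_i.
have := stack_size E (ltnW lt_i); rewrite /= => le_st.
have zn := ltn_ord z.
have topE : mem s (B + 5 + 16 * (size st).+1) = z.
  rewrite sth /stack_cells /= rev_cons map_rcons.
    by rewrite nth_rcons size_map size_rev ltnn eqxx.
  by rewrite size_rcons size_map size_rev.
have nextE : mem s (B + 5 + 16 * size st) = next_vertex r par z.
  rewrite nz sth /stack_cells /= ?rev_cons ?map_rcons ?size_rcons ?size_map ?size_rev; last by lia.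
  rewrite -rcons_cons nth_rcons /= size_map size_rev ltnS leqnn.
  by rewrite (last_nth 0) size_map size_rev.
have nx_le := next_vertex_le par_root reach_root z.
have c1 : mem s (B + 1 + 16 * z) < W by apply: (cell_bound A_eq w) => //; lia.
have s1E : (size st).+2 - 1 = (size st).+1 by rewrite subn1.
have s2E : (size st).+1 - 1 = size st by rewrite subn1.
apply: triple_straight => //.
  rewrite /= /upd /= e8 s1E r15 topE s2E -/i ?cell_eq //= nextE.
  by oblig.
rewrite /= /upd /= e8 s1E r15 topE s2E -/i ?cell_eq //= nextE.
split=> //.
  move=> j; rewrite /= size_map size_rev ltnS => le_j; rewrite !cell_eq //=.
  rewrite sth /stack_cells /= ?rev_cons ?map_rcons ?size_rcons ?size_map ?size_rev; last by lia.
  by rewrite -rcons_cons nth_rcons /= size_map size_rev ltnS le_j.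
split.
  by rewrite /= !cell_eq //= (_ : n == z = false) //; apply/eqP; lia.
move=> j; rewrite ltnS leq_eqVlt => /orP[/eqP ->|lt_j] /=.
  by rewrite iz !cell_eq //= !eqxx.
have [d1 d2 d3] := done_i j lt_j.
have lt_jn := ltn_trans lt_j lt_i.
have ne : nth r ol j != z.
  rewrite -iz; apply: contraTneq lt_j => Ej; rewrite -leqNgt.
  by rewrite -(pre_nth par_root reach_root lt_i) -Ej (pre_nth par_root reach_root lt_jn).
move: ne; rewrite -val_eqE /= => /negbTE nz'.
have /negbTE nj : j != i by rewrite ltn_eqF.
by rewrite !cell_eq //= nz' nj.
Qed.

(** The amortisation behind the nested loops: every index lies in exactly one bucket, so the inner
    loops make [cnt] rounds altogether. *)
Lemma sum_buckets key cnt : (forall j, j < cnt -> key j < n) ->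
  \sum_(v < n) size (bucket key cnt v) = cnt.
Proof.
move=> lt_key; under eq_bigr => v _ do rewrite size_rev size_filter -sum1_count.
rewrite (exchange_big_dep predT) //= -[RHS](size_iota 0 cnt) -sum1_size big_seq [RHS]big_seq.
apply: eq_bigr => j; rewrite mem_iota => /andP[_ lt_j].
by rewrite (big_pred1 (Ordinal (lt_key j lt_j))).
Qed.

Lemma sum_order (F : 'I_n -> nat) : \sum_(i < n) F (nth r ol i) = \sum_(v < n) F v.
Proof.
have sz := size_order_list par_root reach_root.
rewrite -(big_mkord predT (fun i => F (nth r ol i))) -{1}sz -(big_nth r predT F).
have -> : \sum_(v < n) F v = \sum_(v <- enum 'I_n) F v by rewrite big_enum.
apply: perm_big; apply: uniq_perm; rewrite ?enum_uniq ?order_list_uniq // => v.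
by rewrite mem_enum (mem_order_list par_root reach_root).
Qed.

Lemma sum_siblings : \sum_(i < n) size (siblings (nth r ol i)) = n.
Proof.
rewrite (sum_order (fun z => size (siblings z))) -[RHS](@sum_buckets par_key n).
  by apply: eq_bigr => z _; rewrite bucket_siblings size_map size_rev.
by move=> j lt_j; rewrite /par_key (input_par (Ordinal lt_j)).
Qed.

Lemma order_triple s : wf s ->
  (forall v : 'I_n, chain (arr s 2) (mem s (B + 1 + 16 * v)) (bucket par_key n v)) ->
  (forall k (v : 'I_n), k < K -> mem s (B + 0 + 16 * (k * n + v)) = iter (2 ^ k) par v) ->
  T order_phase s (n * 400 + 400) (fun s' => order_done s' n).
Proof.
move=> w ch jmp; have [r15 r14 r13 r12] := base_regs w.
have n0 := n_gt0.
have sz := size_order_list par_root reach_root.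
pose v0 := Ordinal n0; pose v1 := iter (2 ^ (K - 1)) par v0.
have K1 : K - 1 < K by lia.
have j1 : mem s (B + 0 + 16 * ((K - 1) * n + 0)) = v1 by apply: (jmp (K - 1) v0 K1).
have j2 : mem s (B + 0 + 16 * ((K - 1) * n + v1)) = r.
  rewrite jmp // /v1 -iterD addnn -mul2n -expnS subn1 prednK // (iter_deep par_root reach_root) //.
  exact: leq_trans (ltnW (depth_lt reach_root _)) (ltnW n_ltP).
have v1n := ltn_ord v1; have rn := ltn_ord r.
have Kn : (K - 1) * n + n = K * n by rewrite addnC -mulSn subn1 prednK.
pose tm i := cost visit + size (siblings (nth r ol i)) * 60 + 60.
pose I k s1 := exists st : seq 'I_n,
  [/\ reg s1 16 + k = n,
      ol = take (reg s1 16) ol ++ flatten (map preorder st),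
      reg s1 8 = (size st).+1, stack_holds s1 (stack_cells st) &
      order_done s1 (reg s1 16)].
apply: (triple_time (t := _)).
  apply: triple_straight_seq => //.
    rewrite /= /upd /= r15 r14 r13 j1 j2.
    by oblig.
  move=> w0 fr0.
  apply: (triple_weaken (Q := I 0)).
  - apply: (triple_while W_gt32 W_fits (k := n) (I := I) (t := fun k => tm (n - k.+1))) => //.
    + exists [:: r]; rewrite /= /upd /= r15 r14 r13 j1 j2.
      split=> //; first by rewrite take0 /= cats0.
        by case=> [|[|j]] //= _; rewrite !cell_eq.
      by split=> //=; rewrite !cell_eq //= eqxx.
    + move=> k s1 kn w1 fr1 [st [e16 E e8 sth dn]].
      have [_ r14' _ _] := base_regs w1.
      have lt_i : reg s1 16 < n by lia.
      split=> //; first by rewrite /= r14' lt_i.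
      case: st E e8 sth => [|z st] E e8 sth.
        move: (congr1 size E); rewrite cats0 size_take sz lt_i => En; lia.
      have [iz E' _] := order_step E lt_i.
      apply: (triple_time (t := _)).
        apply: (triple_seq (visit_triple w1 lt_i E e8 sth dn)).
        move=> s2 w2 fr2 [f9 f8 f10 sth2 dn2].
        have f16 : reg s2 16 = reg s1 16 by rewrite fr2.1.
        have le_st := stack_size E' lt_i.
        rewrite size_cat in le_st.
        have ch2 : chain (arr s2 2) (reg s2 10) (bucket par_key n z).
          rewrite f10 (frame_array _ fr1) //; apply: (chain_ext (next := arr s 2)) => [|j _].
            rewrite (frame_array _ fr0) //; exact: ch.
          by rewrite /= (frame_array _ fr2) // (frame_array _ fr1) // (frame_array _ fr0).
        apply: (triple_seq (push_triple w2 f9 f8 _ ch2 sth2)); first by lia.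
        move=> s3 w3 fr3 [g8 sth3].
        have [r15' _ _ _] := base_regs w3.
        have g16 : reg s3 16 = reg s1 16 by rewrite fr3.1.
        apply: (triple_straight W_gt32 W_fits (t := 4)) => //.
          by rewrite /= g16; oblig.
        exists (children par z ++ st); rewrite /= /upd /= g16 addn1; split=> //.
        * by lia.
        * case: dn2 => dn2a dn2b; split=> [|j lt_j].
            by rewrite /= (frame_array _ fr3).
          by have := dn2b j lt_j; rewrite /= !(frame_array _ fr3).
      rewrite /tm (_ : n - k.+1 = reg s1 16); last by lia.
      by rewrite iz; lia.
    + move=> s1 w1 fr1 [st [e16 _ _ _ _]].
      have [_ r14' _ _] := base_regs w1.
      by rewrite /= r14' -e16 addn0 ltnn.
  - exact: leqnn.
  by move=> s' w' fr' [st [e16 _ _ _ dn]]; rewrite -e16 addn0.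
(* [triple_while] counts the rounds that remain while [tm] is indexed by label, hence the reversal
   of the sum. *)
have -> : \sum_(k < n) ((expr_cost (Bin Lt (Reg 16) (Reg 14))).+1 + tm (n - k.+1)) =
          n * (64 + cost visit) + n * 60.
  rewrite (reindex_inj rev_ord_inj) /=.
  rewrite (eq_bigr (fun i : 'I_n => 64 + cost visit + size (siblings (nth r ol i)) * 60)).
    by rewrite big_split /= sum_nat_const card_ord -big_distrl /= sum_siblings.
  move=> i _; rewrite subnSK // subKn ?(ltnW (ltn_ord i)) //; rewrite /tm /=; lia.
rewrite /=; lia.
Qed.

(** * The versions of the counting tree *)

Local Notation m2 := (2 * size es).
Local Notation tree s q k v f := (counts (arr s 11) (arr s 12) (arr s 13) q k v f).

Definition vcount (z : 'I_n) (k : nat) : nat :=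
  arcs_upto par arcs (fun u => pre u == k) z.
Definition ucount (z : 'I_n) (k : nat) : nat :=
  arcs_above r par arcs (fun u => pre u == k) z.

Definition arc_key (j : nat) : nat := nth 0 inp (2 + n + j).
Definition arc_end (j : nat) : 'I_n := (nth (r, r) arcs j).2.
Definition out_arcs (z : nat) : seq nat := bucket arc_key m2 z.

Lemma arcs_at_bucket P (z : 'I_n) :
  arcs_at arcs P z = count (fun j => P (arc_end j)) (out_arcs z).
Proof.
rewrite /arcs_at -{1}(mkseq_nth (r, r) arcs) count_map size_arcs.
rewrite count_rev count_filter; apply: eq_in_count => j.
rewrite mem_iota add0n => /andP[_ lt_j] /=.
have [kj _] := input_arc lt_j.
by rewrite /arc_key kj andbC eq_sym.
Qed.

Lemma vcountE z k :
  vcount z k = ucount z k + count (fun j => pre (arc_end j) == k) (out_arcs z).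
Proof. by rewrite /vcount (arcs_uptoE _ par_root reach_root) arcs_at_bucket. Qed.

Lemma size_arcs_input j : j < m2 -> j + 1 - 2 * (j %% 2) < m2.
Proof. lia. Qed.

Definition arc_time : nat := insert_time K + 120.

Lemma insert_arcs_triple s f l : wf s ->
  tree s (reg s 24) K (reg s 20) f ->
  chain (arr s 4) (reg s 10) l ->
  (forall j, j \in l -> j < m2) ->
  reg s 24 + (K + 1) * size l <= X ->
  (forall v : 'I_n, mem s (B + 6 + 16 * v) = pre v) ->
  T (While (Reg 10) arc_body) s (size l * arc_time + 20) (fun s' =>
    [/\ reg s' 24 = reg s 24 + (K + 1) * size l, agree_below B s s' (reg s 24) &
        tree s' (reg s' 24) K (reg s' 20)
          (fun k => f k + count (fun j => pre (arc_end j) == k) l)]).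
Proof.
move=> w tr ch l_lt le_X preE.
set q0 := reg s 24 in tr le_X *.
have K_ltX : K < X by apply: leq_ltn_trans P_ltX; apply/ltnW/ltn_expl.
pose I k s1 := exists old new,
  [/\ l = old ++ new /\ size new = k, chain (arr s 4) (reg s1 10) new,
      reg s1 24 = q0 + (K + 1) * size old, agree_below B s s1 q0 &
      tree s1 (reg s1 24) K (reg s1 20)
        (fun k => f k + count (fun j => pre (arc_end j) == k) old)].
apply: (triple_time (t := _)).
  apply: (triple_weaken (Q := I 0)).
  - apply: (triple_while_const W_gt32 W_fits (k := size l) (I := I)
      (t := cost arc_fetch + insert_time K + cost arc_next + 2)) => //.
    + exists [::], l; rewrite muln0 addn0; split=> //.
      by apply: counts_ext tr _ _ _ => // j _; rewrite addn0.
    + move=> k s1 kl w1 fr1 [old [[|j new] [[E //= [sk]] [e10 ch1] e24 ag tr1]]].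
      have [r15 r14 _ _] := base_regs w1.
      have lt_j : j < m2 by apply: l_lt; rewrite E mem_cat mem_head orbT.
      have [_ _ inpE] := w1.
      have [_ aE] := input_arc lt_j.
      have otherE : mem s1 (2 + n + (j + 1 - 2 * (j %% 2))) = arc_end j.
        by rewrite inpE ?aE // /B ltn_add2l size_arcs_input.
      have p6 : mem s1 (B + 6 + 16 * arc_end j) = pre (arc_end j).
        by rewrite (frame_array _ fr1).
      have m4 : mem s1 (B + 4 + 16 * j) = mem s (B + 4 + 16 * j).
        by rewrite (frame_array _ fr1).
      have pn := pre_lt par_root reach_root (arc_end j).
      have an := ltn_ord (arc_end j).
      have szl : size l = size old + (size new).+1 by rewrite E size_cat.
      have room : reg s1 24 + K + 1 <= X.
        by apply: leq_trans le_X; rewrite e24 szl; nia.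
      split=> //; first by rewrite /= e10.
      apply: (triple_time (t := _)).
        apply: triple_straight_seq => //.
          rewrite /= /upd /= e10 subn1 /= r14 otherE r15 p6.
          by oblig; rewrite ?/B; lia.
        move=> w2 fr2.
        pose s2 := run arc_fetch s1.
        have e20 : reg s2 20 = reg s1 20 by [].
        have e21 : reg s2 21 = pre (arc_end j).
          by rewrite /s2 /= /upd /= e10 subn1 /= r14 otherE r15.
        have e11 : reg s2 11 = j.
          by rewrite /s2 /= /upd /= e10 subn1.
        have lt21 : reg s2 21 < 2 ^ K by rewrite e21; apply: ltn_trans n_ltP.
        have ins := insert_triple A_eq W_gt32 W_fits A_ltW K_ltX P_ltX n_ltP
          (w2 : wf s2) tr1 lt21 room.
        apply: (triple_seq ins).
        move=> s3 w3 fr3 [e25 e24' ag3 tr3].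
        have [r15' _ _ _] := base_regs w3.
        have f11 : reg s3 11 = j by rewrite fr3.1.
        have m4' : mem s3 (B + 4 + 16 * j) = mem s (B + 4 + 16 * j).
          by rewrite (frame_array _ fr3) // -m4.
        apply: (triple_straight W_gt32 W_fits (t := cost arc_next)) => //.
          rewrite /= /upd /= f11 r15'.
          have r25 := reg_bound w3 (isT : 25 < 32).
          have jX : j < X by nia.
          have c4 := cell_bound A_eq w3 (isT : 4 < 16) jX.
          by oblig.
        exists (rcons old j), new; rewrite cat_rcons; split=> //.
        * by rewrite /= /upd /= f11 r15' m4'.
        * rewrite /= /upd /= e24' size_rcons; change (reg s1 24 + K + 1 = q0 + (K + 1) * (size old).+1).
          by rewrite e24; lia.
        * move=> i lt_i; have [a1 a2 a3] := ag i lt_i.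
          have [|b1 b2 b3] := ag3 i.
            by change (i < reg s1 24); rewrite e24; lia.
          by split; rewrite /= ?b1 ?b2 ?b3.
        rewrite /= /upd /= e24' e25; apply: counts_ext tr3 _ _ _ => // i _.
        rewrite /add_key -/s2 e21 -cats1 count_cat /= addn0 addnA; congr (_ + _ + nat_of_bool _).
        exact: eq_sym.
      by rewrite /=; lia.
    + by move=> s1 w1 fr1 [old [[|j new] [[_ //= _] e10 _ _ _]]]; rewrite e10.
  - exact: leqnn.
  move=> s' w' fr' [old [[|j new] [[E // _] _ e24 ag tr']]].
  by rewrite cats0 in E; rewrite E.
by rewrite /arc_time /=; lia.
Qed.

Definition versions_done (s : state) (i : nat) : Prop :=
  forall j, j < i -> let z : 'I_n := nth r ol j in
    tree s (reg s 24) K (mem s (B + 9 + 16 * z)) (vcount z) /\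
    tree s (reg s 24) K (mem s (B + 10 + 16 * z)) (ucount z).

Lemma agree_tree s s' q q' k v f : tree s q k v f -> q <= q' ->
  agree_below B s s' q -> tree s' q' k v f.
Proof. by move=> t le_q ag; apply: (counts_ext t le_q). Qed.

Lemma arc_key_lt j : j < m2 -> arc_key j < n.
Proof. by move=> lt_j; have [k _] := input_arc lt_j; rewrite /arc_key k ltn_ord. Qed.

(** Every insertion takes exactly [K + 1] nodes, so this number determines the next free node and,
    at the end, the space used. *)
Definition arcs_before (i : nat) : nat := \sum_(j < i) size (out_arcs (nth r ol j)).

Lemma arcs_beforeS i :
  arcs_before i.+1 = arcs_before i + size (out_arcs (nth r ol i)).
Proof. by rewrite /arcs_before big_ord_recr. Qed.

Lemma arcs_before_all : arcs_before n = m2.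
Proof.
rewrite /arcs_before (sum_order (fun z => size (out_arcs z))).
exact: sum_buckets arc_key_lt.
Qed.

Lemma arcs_before_le i : i <= n -> arcs_before i <= m2.
Proof.
rewrite -arcs_before_all => le_i; rewrite /arcs_before.
rewrite -!(big_mkord predT (fun j => size (out_arcs (nth r ol j)))).
by rewrite [leqRHS](big_cat_nat (n := i)) //= leq_addr.
Qed.

Definition null_node (s : state) : Prop :=
  [/\ mem s (B + 11 + 16 * 0) = 0, mem s (B + 12 + 16 * 0) = 0 &
      mem s (B + 13 + 16 * 0) = 0].

Definition version_inv (k : nat) (s : state) : Prop :=
  [/\ reg s 16 + k = n, null_node s,
      reg s 24 = 1 + (K + 1) * arcs_before (reg s 16) &
      versions_done s (reg s 16)].

Lemma version_select_triple s k (z := nth r ol (reg s 16)) : wf s -> version_inv k.+1 s ->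
  order_done s n ->
  chain (arr s 4) (mem s (B + 3 + 16 * z)) (out_arcs z) ->
  T version_select s (cost version_select) (fun s' =>
    [/\ reg s' 9 = z, chain (arr s' 4) (reg s' 10) (out_arcs z),
        mem s' (B + 10 + 16 * z) = reg s' 20,
        tree s' (reg s 24) K (reg s' 20) (ucount z) &
        version_inv k.+1 s']).
Proof.
move=> w [e16 nul e24 vd] [_ od] ch.
have [r15 r14 _ _] := base_regs w.
have lt_i : reg s 16 < n by lia.
have [d6 d8 _] := od _ lt_i; rewrite -/z in d6 d8.
have zn := ltn_ord z; have pzn := ltn_ord (par z).
have parE : mem s (2 + z) = par z.
  by have [_ _ inpE] := w; rewrite inpE ?input_par // /B; lia.
have b24 := reg_bound w (isT : 24 < 32).
have q0 : 0 < reg s 24 by rewrite e24.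
have c3 : mem s (B + 3 + 16 * z) < W by apply: (cell_bound A_eq w) => //; lia.
have [n1 n2 n3] := nul.
have ut : tree s (reg s 24) K (if par z == z :> nat then 0 else mem s (B + 9 + 16 * par z)) (ucount z).
  case: eqP => [pz|pz].
    have zr : z = r by apply: (par_fixed reach_root); apply: val_inj.
    have nt : tree s (reg s 24) K 0 (fun=> 0) by apply: counts_null.
    apply: (counts_ext nt) => // j _.
    by rewrite /ucount /arcs_above zr eqxx.
  have zr : z != r by apply/eqP => zr; apply: pz; rewrite zr par_root.
  (* In preorder the parent comes before [z], so its version is among those already stored. *)
  have lt_p : pre (par z) < reg s 16.
    by rewrite -(pre_nth par_root reach_root lt_i); apply: pre_par.
  have [t _] := vd _ lt_p; rewrite nth_pre // in t.
  apply: (counts_ext t) => // j _.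
  by rewrite /ucount /arcs_above (negbTE zr).
have v9 := cell_bound A_eq w (isT : 9 < 16) (ltn_trans pzn (ltnW n_ltX)).
apply: triple_straight => //.
  rewrite /= /upd /= r15 d8 parE.
  by case: (@eqP nat (par z) z) => E /=; rewrite ?r15 ?cell_eq //=; oblig; rewrite ?/B; lia.
have okz : tree s (reg s 24) K (reg (run version_select s) 20) (ucount z).
  rewrite /= /upd /= r15 d8 parE; move: ut.
  by case: (@eqP nat (par z) z) => E /=; rewrite ?r15.
have e9 : reg (run version_select s) 9 = z.
  by rewrite /= /upd /= r15 d8 parE; case: (@eqP nat (par z) z) => E /=.
have e10 : reg (run version_select s) 10 = mem s (B + 3 + 16 * z).
  by rewrite /= /upd /= r15 d8 parE; case: (@eqP nat (par z) z) => E /=; rewrite ?r15 ?cell_eq //=.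
have memE (a j : nat) : a < 16 -> a != 10 \/ j != z ->
    mem (run version_select s) (B + a + 16 * j) = mem s (B + a + 16 * j).
  move=> a16 ne; rewrite /= /upd /= r15 d8 parE.
  have /negbTE ne' : ~~ ((a == 10) && (j == z)).
    by case: ne => /negbTE ->; rewrite ?andbF.
  by case: (@eqP nat (par z) z) => E /=; rewrite ?r15 cell_eq // ne'.
have rE i : i \notin [:: 9; 17; 20; 10] -> reg (run version_select s) i = reg s i.
  rewrite !inE !negb_or => /and4P[/negbTE i9 /negbTE i17 /negbTE i20 /negbTE i10].
  by rewrite /= /upd /= r15 d8 parE; case: (@eqP nat (par z) z) => E /=; rewrite i9 i17 i20 i10.
have m10 : mem (run version_select s) (B + 10 + 16 * z) = reg (run version_select s) 20.
  by rewrite /= /upd /= r15 d8 parE; case: (@eqP nat (par z) z) => E /=; rewrite ?r15 eqxx.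
have ag q : agree_below B s (run version_select s) q.
  by move=> j _; split; apply: memE => //; left.
move: (run version_select s) okz e9 e10 memE rE m10 ag => s' okz e9 e10 memE rE m10 ag.
split=> //.
- rewrite e10; apply: chain_ext ch _ => j _; rewrite memE //; by left.
- exact: agree_tree okz _ (ag _).
split; rewrite ?rE //.
  by split; rewrite memE //; left.
move=> j lt_j; have [t1 t2] := vd j lt_j; rewrite rE //.
have ne : (nth r ol j : nat) != z.
  rewrite val_eqE; apply/eqP => E.
  have := pre_nth par_root reach_root (ltn_trans lt_j lt_i).
  by rewrite E (pre_nth par_root reach_root lt_i) => ij; rewrite ij ltnn in lt_j.
rewrite /= !memE //; [|by right|by right].
by split; [apply: agree_tree t1 _ (ag _)|apply: agree_tree t2 _ (ag _)].
Qed.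

Definition version_time : nat := n * 200 + m2 * arc_time + 100.

Lemma version_triple s : wf s -> order_done s n ->
  (forall v : 'I_n, chain (arr s 4) (mem s (B + 3 + 16 * v)) (out_arcs v)) ->
  null_node s ->
  T version_phase s version_time (fun s' => reg s' 24 <= X /\ versions_done s' n).
Proof.
move=> w od ch nul; have [r15 r14 r13 r12] := base_regs w.
pose tm i := cost version_select + size (out_arcs (nth r ol i)) * arc_time + 50.
have preE (v : 'I_n) : mem s (B + 6 + 16 * v) = pre v.
  have [_ d] := od; have [d6 _ _] := d _ (pre_lt par_root reach_root v).
  by rewrite nth_pre // in d6.
apply: (triple_time (t := _)).
  apply: triple_straight_seq => //; first by rewrite /=; oblig.
  move=> w0 fr0.
  apply: (triple_weaken (Q := version_inv 0)).
  - apply: (triple_while W_gt32 W_fits (k := n) (I := version_inv)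
      (t := fun k => tm (n - k.+1))) => //.
    + by split=> //=; rewrite /upd /= /arcs_before big_ord0 muln0.
    + move=> k s1 kn w1 fr1 inv.
      have [e16 nul1 e24 vd] := inv.
      have [_ r14' _ _] := base_regs w1.
      have lt_i : reg s1 16 < n by lia.
      split=> //; first by rewrite /= r14' lt_i.
      set z := nth r ol (reg s1 16).
      have od1 : order_done s1 n.
        case: od => od_n od_j; split=> [|j lt_j].
          by rewrite (frame_array _ fr1) // (frame_array _ fr0).
        by have := od_j j lt_j; rewrite /= !(frame_array _ fr1) // !(frame_array _ fr0).
      have ch1 : chain (arr s1 4) (mem s1 (B + 3 + 16 * z)) (out_arcs z).
        rewrite (frame_array _ fr1) // (frame_array _ fr0) //.
        apply: chain_ext (ch z) _ => j _.
        by rewrite (frame_array _ fr1) // (frame_array _ fr0).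
      have all_le := arcs_before_le lt_i.
      have beforeS := arcs_beforeS (reg s1 16); rewrite -/z in beforeS.
      apply: (triple_time (t := _)).
        apply: (triple_seq (version_select_triple w1 inv od1 ch1)); rewrite -/z.
        move=> s2 w2 fr2 [f9 ch2 m10 tr2 inv2].
        have [f16 nul2 f24 vd2] := inv2.
        have f24' : reg s2 24 = reg s1 24 by rewrite fr2.1.
        have f16' : reg s2 16 = reg s1 16 by rewrite fr2.1.
        have tr2' : tree s2 (reg s2 24) K (reg s2 20) (ucount z) by rewrite f24'.
        have lt_out j : j \in out_arcs z -> j < m2 by apply: bucket_lt.
        have room : reg s2 24 + (K + 1) * size (out_arcs z) <= X.
          apply: leq_trans nodes_leX; rewrite f24' e24 -addnA -mulnDr -beforeS.
          by rewrite leq_add2l mulnC leq_mul2r all_le orbT.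
        have preE2 (v : 'I_n) : mem s2 (B + 6 + 16 * v) = pre v.
          by rewrite (frame_array _ fr2) // (frame_array _ fr1) // (frame_array _ fr0).
        apply: (triple_seq (insert_arcs_triple w2 tr2' ch2 lt_out room preE2)).
        move=> s3 w3 fr3 [g24 ag3 tr3].
        have [r15' _ _ _] := base_regs w3.
        have g9 : reg s3 9 = z by rewrite fr3.1.
        have g16 : reg s3 16 = reg s1 16 by rewrite fr3.1.
        have le24 : reg s2 24 <= reg s3 24 by rewrite g24 leq_addr.
        have pos24 : 0 < reg s2 24 by rewrite f24.
        have b20 := reg_bound w3 (isT : 20 < 32).
        apply: (triple_straight W_gt32 W_fits (t := cost version_store)) => //.
          by rewrite /= /upd /= ?g9 g16 ?r15'; oblig.
        have memE (a j : nat) : a < 16 -> a != 9 \/ j != z ->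
            mem (run version_store s3) (B + a + 16 * j) = mem s3 (B + a + 16 * j).
          move=> a16 ne; rewrite /= /upd /= r15' g9 cell_eq //.
          by case: ne => /negbTE ->; rewrite ?andbF.
        have m9 : mem (run version_store s3) (B + 9 + 16 * z) = reg s3 20.
          by rewrite /= /upd /= r15' g9 eqxx.
        have h16 : reg (run version_store s3) 16 = (reg s1 16).+1.
          by rewrite /= /upd /= g16 addn1.
        have h24 : reg (run version_store s3) 24 = reg s3 24 by [].
        have ag q : agree_below B s3 (run version_store s3) q.
          by move=> j _; split; apply: memE => //; left.
        move: (run version_store s3) memE m9 h16 h24 ag => s4 memE m9 h16 h24 ag.
        have ag24 : agree_below B s2 s4 (reg s2 24).
          move=> j lt_j; have [<- <- <-] := ag3 j lt_j.
          by have [<- <- <-] := ag _ j (leqnn _).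
        split; first by rewrite h16; lia.
        * case: nul2 => n1 n2 n3; have [a1 a2 a3] := ag24 0 pos24.
          by split; rewrite ?a1 ?a2 ?a3.
        * by rewrite h24 g24 f24 f16' h16 beforeS mulnDr addnA.
        rewrite /versions_done h16 h24 => j; rewrite ltnS leq_eqVlt => /orP[/eqP ->|lt_j] /=.
          rewrite -/z m9 memE //; last by left.
          rewrite (frame_array _ fr3) // m10; split.
            apply: (counts_ext tr3) => // i lt_i'; first exact: ag lt_i'.
            by rewrite vcountE.
          exact: agree_tree tr2' le24 ag24.
        have lt_j2 : j < reg s2 16 by rewrite f16'.
        have [t1 t2] := vd2 j lt_j2.
        have ne : (nth r ol j : nat) != z.
          rewrite val_eqE; apply/eqP => E.
          have := pre_nth par_root reach_root (ltn_trans lt_j lt_i).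
          by rewrite E (pre_nth par_root reach_root lt_i) => ij; rewrite ij ltnn in lt_j.
        rewrite !memE //; [|by left|by right].
        rewrite !(frame_array _ fr3) //.
        by split; [apply: agree_tree t1 le24 ag24|apply: agree_tree t2 le24 ag24].
      rewrite /tm (_ : n - k.+1 = reg s1 16); last by lia.
      by rewrite -/z /=; lia.
    + move=> s1 w1 fr1 [e16 _ _ _]; have [_ r14' _ _] := base_regs w1.
      by rewrite /= r14' -e16 addn0 ltnn.
  - exact: leqnn.
  move=> s' w' fr' [e16 _ e24 vd]; rewrite addn0 in e16; rewrite e16 in e24 vd.
  by split=> //; apply: leq_trans nodes_leX; rewrite e24 arcs_before_all mulnC.
rewrite /version_time.
have -> : \sum_(k < n) ((expr_cost (Bin Lt (Reg 16) (Reg 14))).+1 + tm (n - k.+1)) =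
          n * (54 + cost version_select) + m2 * arc_time.
  rewrite (reindex_inj rev_ord_inj) /=.
  rewrite (eq_bigr (fun i : 'I_n =>
      54 + cost version_select + size (out_arcs (nth r ol i)) * arc_time)).
    rewrite big_split /= sum_nat_const card_ord -big_distrl /=.
    by rewrite -arcs_before_all.
  move=> i _; rewrite subnSK // subKn ?(ltnW (ltn_ord i)) //; rewrite /tm /=; lia.
move: (m2 * arc_time) => t; rewrite /=; lia.
Qed.

(** * Recovering the base registers *)

Hypothesis P_le : 2 ^ K.-1 <= n.
Local Notation bnd := (bounded W A).

Lemma clear_regs_exec l s : exists t s',
  [/\ exec b (clear_regs l) s t s', t <= size l * 3 + 1, mem s' = mem s &
      forall i, reg s' i = if i \in l then 0 else reg s i].
Proof.
elim: l s => [|i l IH] s.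
  by exists 1, s; split=> //; constructor.
have [t [s' [ex le_t ms rs]]] := IH (State (upd (reg s) i 0) (mem s)).
exists (2 + t).+1, s'; split=> //=.
- by apply: ExecSeq ex; apply: ExecAssign; rewrite /= /word expn_gt0.
- move=> j; rewrite rs inE /upd /=.
  by case: (j \in l); rewrite ?orbT ?orbF.
Qed.

(** [j] doublings remain. The loop cannot stop early, as every smaller power is at most
    [2 ^ K.-1 <= n], and it stops at [2 ^ K] because [n < 2 ^ K]. *)
Lemma double_loop_exec j s : j <= K -> bnd s -> reg s 14 = n ->
  reg s 12 = 2 ^ (K - j) -> reg s 13 = K - j ->
  exists t s', [/\ exec b double_loop s t s', t <= j * 20 + 10, mem s' = mem s, bnd s' &
     reg s' 12 = 2 ^ K /\ reg s' 13 = K /\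
     forall i, i != 12 -> i != 13 -> reg s' i = reg s i].
Proof.
have ev s1 : bnd s1 -> eval b s1 (Bin Eq (Bin Lt (Reg 14) (Reg 12)) (Const 0)) =
    Some (((reg s1 14 < reg s1 12) == 0 :> nat) : nat).
  by move=> bs; rewrite (eval_den W_gt32 W_fits bs).
elim: j s => [|j IH] s jK bs e14 e12 e13.
  rewrite subn0 in e12 e13.
  exists 6, s; split=> //.
  apply: (ExecWhileEnd (a := Bin Eq (Bin Lt (Reg 14) (Reg 12)) (Const 0))).
  by rewrite ev // e14 e12 n_ltP.
have e12' : 2 * reg s 12 = 2 ^ (K - j) by rewrite e12 -expnS; congr (2 ^ _); lia.
have le12 : reg s 12 <= n.
  by apply: leq_trans P_le; rewrite e12 leq_exp2l //; lia.
have lt_pow : 2 ^ (K - j) < W.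
  have : 2 ^ (K - j) <= 2 ^ K by rewrite leq_exp2l // leq_subr.
  by lia.
have K_ltP : K < 2 ^ K by rewrite ltn_expl.
have okb : ok W A double_body s.
  by rewrite /= /upd /= e12' e13; oblig.
have [bs' [t1 ex1 le1]] := run_exec W_gt32 W_fits bs (isT : straight double_body) okb.
have [|||||t [s' [ex le_t ms bs'' [r12 [r13 rr]]]]] := IH (run double_body s) => //.
- exact: ltnW.
- by rewrite /= /upd /= e13; lia.
exists (5 + t1 + t).+1, s'; split=> //.
- apply: ExecWhile ex1 ex; first by rewrite ev.
  by rewrite e14 ltnNge le12.
- by move: le1; rewrite /=; lia.
by split=> //; split=> // i i12 i13; rewrite rr //= /upd (negbTE i12) (negbTE i13).
Qed.

Definition setup_time : nat := K * 20 + 200.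

Lemma setup_runs s : (forall i, i < A -> mem s i < W) ->
  (forall i, i < B -> mem s i = nth 0 inp i) ->
  (forall i, i < 3 -> reg s i < W) ->
  runs_within b setup s setup_time (fun s' =>
    [/\ wf s', mem s' = mem s & forall i, i < 3 -> reg s' i = reg s i]).
Proof.
move=> bm inpE br.
have [t1 [s1 [ex1 le1 m1 r1]]] := clear_regs_exec (iota 3 29) s.
have b1 : bnd s1.
  split=> i lt_i; last by rewrite m1 bm.
  by rewrite r1 mem_iota; case: ifP => [_|ni]; [lia|apply: br; lia].
have nE : mem s 0 = n by rewrite inpE.
have mE : mem s 1 = size es by rewrite inpE.
have ok1 : ok W A read_sizes s1.
  rewrite /= /upd /= m1 nE mE; oblig; rewrite A_eq /B; lia.
have [b2 [t2 ex2 le2]] := run_exec W_gt32 W_fits b1 (isT : straight read_sizes) ok1.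
have [|||t3 [s3 [ex3 le3 m3 b3 [r12 [r13 rr]]]]] := @double_loop_exec K _ (leqnn K) b2.
- by rewrite /= /upd /= m1 nE.
- by rewrite subnn.
- by rewrite subnn.
exists (t1 + (t2 + t3).+1).+1, s3; split.
- exact: ExecSeq ex1 (ExecSeq ex2 ex3).
- by rewrite /setup_time; move: le1 le2 => /=; lia.
have m3s : mem s3 = mem s by rewrite m3 /= m1.
split=> //.
  split=> //; last by rewrite m3s.
  by split=> //; rewrite rr //= /upd /= m1 ?nE ?mE.
move=> i i3; rewrite rr; [|lia|lia].
by rewrite /= /upd; do 4![case: eqP => [?|_]; first by lia]; rewrite r1 mem_iota leqNgt i3.
Qed.

(** * The finished structure and its construction *)

Definition built (s : state) : Prop :=
  [/\ forall k (v : 'I_n), k < K -> mem s (B + 0 + 16 * (k * n + v)) = iter (2 ^ k) par v,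
      order_done s n,
      forall v : 'I_n, tree s X K (mem s (B + 9 + 16 * v)) (vcount v) &
      forall v : 'I_n, tree s X K (mem s (B + 10 + 16 * v)) (ucount v)].

Definition construct_time : nat :=
  K * n * 60 + n * 500 + 2 * m2 * 100 + version_time + 1000.

Lemma construct_triple s : wf s -> (forall x, B <= x -> mem s x = 0) ->
  T construct s construct_time built.
Proof.
move=> w z.
have zero a j : mem s (B + a + 16 * j) = 0 by rewrite z // -addnA leq_addr.
have mE : forall s', wf s' -> mem s' 1 = size es.
  by move=> s' [_ _ inpE]; rewrite inpE.
have n0 := n_gt0.
apply: (triple_time (t := _)).
  apply: (triple_seq (jump_triple w)).
  move=> s1 w1 fr1 jmp1.
  have [_ r14 _ _] := base_regs w1.
  have childs : T child_chains s1 (n * 60 + 60) (fun s' => forall v, v < X ->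
      chain (fun j => mem s' (B + 2 + 16 * j)) (mem s' (B + 1 + 16 * v))
        (bucket (par_key) n v)).
    apply: (triple_time (t := _)).
      apply: triple_straight_seq => //.
        by rewrite /= /upd /= r14; oblig.
      move=> w2 fr2.
      have e18 : reg (run (Assign 17 (Const 2) ;; Assign 18 (Reg 14)) s1) 18 = n.
        by rewrite /= /upd /= r14.
      apply: (triple_weaken (build_chains_triple W_gt32 W_fits A_eq A_ltW
        (key := par_key) w2 _ _ _ _ _)); rewrite ?e18 //.
      - by move=> j _; rewrite (frame_array _ fr2) // (frame_array _ fr1).
      - by lia.
      - by rewrite /= /upd /= /B; lia.
      - move=> j; rewrite /= /upd /= => lt_j.
        have [_ _ inpE] := w1; rewrite inpE; last by rewrite /B; lia.
        split=> //; rewrite /par_key (input_par (Ordinal lt_j)).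
        by move: (ltn_ord (par (Ordinal lt_j))); lia.
    by rewrite /=; lia.
  apply: (triple_seq childs) => s2 w2 fr2 ch2.
  have m1 := mE _ w2; have [_ r14' _ _] := base_regs w2.
  have arcl : T arc_chains s2 (m2 * 60 + 70) (fun s' => forall v, v < X ->
      chain (fun j => mem s' (B + 4 + 16 * j)) (mem s' (B + 3 + 16 * v))
        (out_arcs v)).
    apply: (triple_time (t := _)).
      apply: triple_straight_seq => //.
        by rewrite /= /upd /= r14' m1; oblig; rewrite ?A_eq /B; nia.
      move=> w3 fr3.
      set s2' := run _ s2 in w3 fr3 *.
      have e18 : reg s2' 18 = m2 by rewrite /s2' /= /upd /= m1.
      have e17 : reg s2' 17 = 2 + n by rewrite /s2' /= /upd /= r14'.
      apply: (triple_weaken (build_chains_triple W_gt32 W_fits A_eq A_ltW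
        (key := arc_key) w3 _ _ _ _ _)); rewrite ?e18 ?e17 //.
      - by move=> j _; rewrite (frame_array _ fr3) // (frame_array _ fr2) // (frame_array _ fr1).
      - by nia.
      - move=> j lt_j.
        have [_ _ inpE] := w3; rewrite inpE; last by rewrite /B; lia.
        by split=> //; have := arc_key_lt lt_j; lia.
    by rewrite /=; lia.
  apply: (triple_seq arcl) => s3 w3 fr3 ch3.
  have ch2' (v : 'I_n) : chain (fun j => mem s3 (B + 2 + 16 * j))
      (mem s3 (B + 1 + 16 * v)) (bucket (par_key) n v).
    rewrite (frame_array _ fr3) //.
    have vX : v < X by move: (ltn_ord v); lia.
    by apply: chain_ext (ch2 v vX) _ => j _; rewrite (frame_array _ fr3).
  have jmp3 k (v : 'I_n) : k < K -> mem s3 (B + 0 + 16 * (k * n + v)) = iter (2 ^ k) par v.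
    by move=> kK; rewrite (frame_array _ fr3) // (frame_array _ fr2) // jmp1.
  apply: (triple_seq (order_triple w3 ch2' jmp3)).
  move=> s4 w4 fr4 od4.
  have ch4 (v : 'I_n) : chain (fun j => mem s4 (B + 4 + 16 * j))
      (mem s4 (B + 3 + 16 * v)) (out_arcs v).
    rewrite (frame_array _ fr4) //.
    have vX : v < X by move: (ltn_ord v); lia.
    by apply: chain_ext (ch3 v vX) _ => j _; rewrite (frame_array _ fr4).
  have nul4 : null_node s4.
    by split; rewrite (frame_array _ fr4) // (frame_array _ fr3) //
      (frame_array _ fr2) // (frame_array _ fr1).
  apply: (triple_weaken (version_triple w4 od4 ch4 nul4) (leqnn _)).
  move=> s5 w5 fr5 [le24 vd]; split.
  - by move=> k v kK; rewrite (frame_array _ fr5) // (frame_array _ fr4) // jmp3.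
  - case: od4 => od_n od_j; split=> [|j lt_j].
      by rewrite (frame_array _ fr5).
    by have := od_j j lt_j; rewrite /= !(frame_array _ fr5).
  - move=> v; have [t _] := vd _ (pre_lt par_root reach_root v).
    by rewrite nth_pre // in t; apply: counts_ext t le24 _ _.
  - move=> v; have [_ t] := vd _ (pre_lt par_root reach_root v).
    by rewrite nth_pre // in t; apply: counts_ext t le24 _ _.
rewrite /construct_time /= /upd /=.
move: (version_time) => t; lia.
Qed.

Lemma size_input : size inp = B.
Proof.
rewrite /input /= size_cat size_map size_enum_ord /B !addSn add0n; congr (_.+2 + _).
by elim: es => //= p s IH; rewrite IH mulnS.
Qed.

Lemma input_lt x : x \in inp -> x < W.
Proof.
have nW : n < W by lia.
have esW : size es < W by nia.
rewrite /input /= !inE => /or3P[/eqP -> //|/eqP -> //|].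
rewrite mem_cat => /orP[/mapP[v _ ->]|/flattenP[_ /mapP[p _ ->]]].
  exact: ltn_trans nW.
by rewrite !inE => /orP[] /eqP -> ; apply: ltn_trans nW; apply: ltn_ord.
Qed.

Lemma build_runs : runs_within b build (initial inp) (setup_time + construct_time).+1
  (fun s' => wf s' /\ built s').
Proof.
have memW i : mem (initial inp) i < W.
  rewrite /=; case: (ltnP i (size inp)) => lt_i; last by rewrite nth_default //; lia.
  by apply/input_lt/mem_nth.
have regW i : reg (initial inp) i < W by rewrite /=; lia.
have [t1 [s1 [ex1 le1 [w1 m1 _]]]] :=
  @setup_runs (initial inp) (fun i _ => memW i) (fun i _ => erefl) (fun i _ => regW i).
have [|t2 [s2 [ex2 le2 [w2 _ bu]]]] := construct_triple w1.
  by move=> x xB; rewrite m1 /= nth_default // size_input.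
exists (t1 + t2).+1, s2; split=> //; first exact: ExecSeq ex1 ex2.
by rewrite ltnS leq_add.
Qed.

(** Everything in [built] concerns cells below [A]. Hence it carries over to any memory that begins
    with the recorded structure, whatever follows. *)
Lemma built_ext s s' : (forall x, x < A -> mem s' x = mem s x) -> built s -> built s'.
Proof.
move=> E [jmp od tv tu].
have cE a j : a < 16 -> j < X -> mem s' (B + a + 16 * j) = mem s (B + a + 16 * j).
  by move=> a16 jX; apply: E; rewrite A_eq; lia.
have vX (v : 'I_n) : v < X by move: (ltn_ord v); lia.
split.
- move=> k v kK; rewrite cE ?jmp //.
  have := ltn_ord v; have : k.+1 * n <= K * n by rewrite leq_mul2r kK orbT.
  by rewrite mulSn; lia.
- case: od => od_n od_j; split=> [|j lt_j]; first by rewrite cE //; lia.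
  by have [d1 d2 d3] := od_j j lt_j; rewrite /= !cE //; lia.
- move=> v; rewrite cE //; apply: (counts_ext (tv v)) => // j jX.
  by split; rewrite cE.
- move=> v; rewrite cE //; apply: (counts_ext (tu v)) => // j jX.
  by split; rewrite cE.
Qed.


(** * Counting in intervals of labels *)

Lemma psum_count (T' : Type) (Q : pred T') (key : T' -> nat) (l : seq T') p :
  psum (fun k => count (fun a => Q a && (key a == k)) l) p =
  count (fun a => Q a && (key a < p)) l.
Proof.
elim: p => [|p IH].
  rewrite psum0 (eq_count (a2 := pred0)) ?count_pred0 // => a /=.
  by rewrite ltn0 andbF.
rewrite /psum big_nat_recr //= -/(psum _ _) IH.
rewrite -count_predUI -[RHS]addn0; congr (_ + _).
  by apply: eq_count => a /=; rewrite -andb_orr ltnS [key a <= p]leq_eqVlt orbC.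
rewrite -(count_pred0 l); apply: eq_count => a /=.
by case: ltngtP; rewrite ?andbF.
Qed.

Lemma psum_vcount z p : psum (vcount z) p =
  arcs_upto par arcs (fun u => pre u < p) z.
Proof. exact: psum_count. Qed.

Lemma psum_ucount z p : psum (ucount z) p =
  arcs_above r par arcs (fun u => pre u < p) z.
Proof.
rewrite /arcs_above; case: eqP => E.
  by apply: big1 => k _; rewrite /ucount /arcs_above E eqxx.
rewrite -psum_vcount; apply: eq_psum => k _.
by rewrite /ucount /arcs_above; case: eqP.
Qed.

Lemma K_ltX : K < X.
Proof. by apply: leq_ltn_trans P_ltX; apply/ltnW/ltn_expl. Qed.

Lemma built_frame c s s' : frame B c s s' -> arrays_written c = [::] ->
  built s -> built s'.
Proof.
move=> fr c0; apply: (built_ext) => x _.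
exact: frame_pure fr c0 x.
Qed.

Lemma built_vertex s (z : 'I_n) : built s ->
  [/\ mem s (B + 6 + 16 * z) = pre z, mem s (B + 8 + 16 * pre z) = z &
      mem s (B + 7 + 16 * z) = next_vertex r par z].
Proof.
move=> [_ [_ od] _ _].
by have [d1 d2 d3] := od _ (pre_lt par_root reach_root z); rewrite nth_pre // in d1 d2 d3.
Qed.

Lemma built_next s (z : 'I_n) : built s ->
  mem s (B + 6 + 16 * next_vertex r par z) = pre z + size (preorder z).
Proof.
move=> bu; have [_ [od_n _] _ _] := bu.
have sz := size_order_list par_root reach_root.
rewrite /next_vertex; set i := pre z + _.
have := pre_end_le par_root reach_root z; rewrite -/i leq_eqVlt => /orP[/eqP ->|lt_i].
  by rewrite nth_default // size_map sz.
rewrite (nth_map r) ?sz //; have [-> _ _] := built_vertex (nth r ol i) bu.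
by rewrite pre_nth.
Qed.

Definition interval_time : nat := 2 * prefix_time K + 60.

Lemma count_interval_triple s f : wf s -> tree s X K (reg s 26) f ->
  reg s 3 < 2 ^ K -> reg s 4 < 2 ^ K ->
  T count_interval s interval_time (fun s' =>
    reg s' 27 = psum f (reg s 4) - psum f (reg s 3)).
Proof.
move=> w tr lt3 lt4.
have pc := prefix_count_triple (inp := inp) A_eq W_gt32 W_fits A_ltW K_ltX P_ltX n_ltP.
apply: (triple_time (t := _)).
  apply: triple_straight_seq => //.
    have b26 := reg_bound w (isT : 26 < 32); have b4 := reg_bound w (isT : 4 < 32).
    by rewrite /= /upd /=; oblig.
  move=> w1 fr1; apply: (triple_seq (pc _ f w1 tr lt4)).
  move=> s2 w2 fr2 e22.
  have b22 := reg_bound w2 (isT : 22 < 32).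
  have b26 := reg_bound w2 (isT : 26 < 32); have b3 := reg_bound w2 (isT : 3 < 32).
  have f26 : reg s2 26 = reg s 26 by rewrite fr2.1 // fr1.1.
  have f3 : reg s2 3 = reg s 3 by rewrite fr2.1 // fr1.1.
  apply: triple_straight_seq => //.
  move=> w3 fr3.
  have m3 a j : mem s2 (B + a + 16 * j) = mem s (B + a + 16 * j).
    by rewrite (frame_pure fr2) // (frame_pure fr1).
  have tr3 : tree s2 X K (reg s2 26) f.
    by rewrite f26; apply: (counts_ext tr) => // j _; rewrite !m3.
  have lt3' : reg s2 3 < 2 ^ K by rewrite f3.
  apply: (triple_seq (pc _ f w3 tr3 lt3')).
  move=> s4 w4 fr4 e22'.
  have f27 : reg s4 27 = reg s2 22 by rewrite fr4.1.
  have b27 := reg_bound w4 (isT : 27 < 32).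
  apply: (triple_straight W_gt32 W_fits (t := 4)) => //.
    by rewrite /= /upd /=; oblig.
  by rewrite /= /upd /= f27 e22 e22' /= /upd /= f3.
by rewrite /interval_time /=; lia.
Qed.

Lemma level_count_triple s f g (z : 'I_n) : wf s -> reg s 6 = z ->
  tree s X K (mem s (B + 9 + 16 * z)) f -> tree s X K (mem s (B + 10 + 16 * z)) g ->
  reg s 28 < 2 ^ K ->
  T level_count s interval_time (fun s' =>
    reg s' 27 = psum f (reg s 28) - psum g (reg s 28)).
Proof.
move=> w e6 tf tg lt28.
have pc := prefix_count_triple (inp := inp) A_eq W_gt32 W_fits A_ltW K_ltX P_ltX n_ltP.
have [r15 _ _ _] := base_regs w.
have zX : z < X by move: (ltn_ord z); lia.
have tfX := counts_lt tf; have tgX := counts_lt tg.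
apply: (triple_time (t := _)).
  apply: triple_straight_seq => //.
    have b28 := reg_bound w (isT : 28 < 32).
    by rewrite /= /upd /= e6 r15; oblig.
  set s1 := run _ s => w1 fr1.
  have tf1 : tree s1 X K (reg s1 20) f by rewrite /s1 /= /upd /= e6 r15.
  apply: (triple_seq (pc _ f w1 tf1 lt28)).
  move=> s2 w2 fr2 e22.
  have b22 := reg_bound w2 (isT : 22 < 32).
  have b28 := reg_bound w2 (isT : 28 < 32).
  have [r15' _ _ _] := base_regs w2.
  have f6 : reg s2 6 = z by rewrite fr2.1 // fr1.1.
  have f28 : reg s2 28 = reg s 28 by rewrite fr2.1 // fr1.1.
  have m3 a j : mem s2 (B + a + 16 * j) = mem s (B + a + 16 * j).
    by rewrite (frame_pure fr2) // (frame_pure fr1).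
  apply: triple_straight_seq => //.
    by rewrite /= /upd /= f6 r15' m3; oblig.
  set s3 := run _ s2 => w3 fr3.
  have tg3 : tree s3 X K (reg s3 20) g.
    by rewrite /s3 /= /upd /= f6 r15' m3; apply: (counts_ext tg) => // j _; rewrite !m3.
  have lt28' : reg s3 21 < 2 ^ K by rewrite /s3 /= /upd /= f28.
  apply: (triple_seq (pc _ g w3 tg3 lt28')).
  move=> s4 w4 fr4 e22'.
  have f27 : reg s4 27 = reg s2 22 by rewrite fr4.1.
  have b27 := reg_bound w4 (isT : 27 < 32).
  apply: (triple_straight W_gt32 W_fits (t := 4)) => //.
    by rewrite /= /upd /=; oblig.
  by rewrite /= /upd /= f27 e22 e22' /s1 /s3 /= /upd /= f28.
by rewrite /interval_time /=; lia.
Qed.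

(** * The search for a set of consecutively labelled vertices *)

Section Search.

Variables (e : rel 'I_n) (S : {set 'I_n}) (lo hi : nat).
Hypothesis e_sym : symmetric e.
Hypothesis mem_arcs : forall v u, ((v, u) \in arcs) = e v u.
Hypothesis S_interval : forall u, (u \in S) = (lo <= pre u < hi).
Hypothesis lo_le_hi : lo <= hi.
Hypothesis hi_le_n : hi <= n.

Local Notation mass := (arcs_upto par arcs (fun u => u \in S)).
Local Notation above := (arcs_above r par arcs (fun u => u \in S)).
Local Notation level z p := (arcs_at arcs (fun u => pre u < p) z).

Lemma count_S (Q : pred ('I_n * 'I_n)) :
  count (fun a => Q a && (a.2 \in S)) arcs =
  count (fun a => Q a && (pre a.2 < hi)) arcs -
  count (fun a => Q a && (pre a.2 < lo)) arcs.
Proof.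
apply/eqP; rewrite eq_sym -(eqn_add2r (count (fun a => Q a && (pre a.2 < lo)) arcs)).
rewrite subnK; last first.
  by apply: sub_count => a /andP[-> lt_a]; apply: leq_trans lo_le_hi.
rewrite -count_predUI -[X in X == _]addn0; apply/eqP; congr (_ + _).
  apply: eq_count => a /=; rewrite S_interval -andb_orr; congr (_ && _).
  by case: (leqP lo (pre a.2)) => //= lt; rewrite ?orbF // (leq_trans lt).
rewrite -(count_pred0 arcs); apply: eq_count => a /=; rewrite S_interval.
by case: (leqP lo (pre a.2)); rewrite ?andbF ?andFb ?andbF.
Qed.

Lemma mass_diff z :
  mass z = psum (vcount z) hi - psum (vcount z) lo.
Proof. by rewrite !psum_vcount; apply: count_S. Qed.

Lemma above_diff z :
  above z = psum (ucount z) hi - psum (ucount z) lo.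
Proof.
rewrite !psum_ucount /arcs_above; case: eqP => // _; exact: count_S.
Qed.

Lemma level_diff z p : level z p = psum (vcount z) p - psum (ucount z) p.
Proof. by rewrite psum_vcount psum_ucount (arcs_uptoE _ par_root reach_root) addKn. Qed.

Definition query_state (s : state) : Prop :=
  [/\ wf s, built s, reg s 3 = lo & reg s 4 = hi].

Lemma query_frame c s s' : frame B c s s' -> arrays_written c = [::] ->
  3 \notin regs_written c -> 4 \notin regs_written c -> wf s' ->
  query_state s -> query_state s'.
Proof.
move=> fr c0 w3 w4 w' [_ bu e3 e4]; split=> //; first exact: built_frame fr c0 bu.
  by rewrite fr.1.
by rewrite fr.1.
Qed.

Lemma count_mass_triple s (z : 'I_n) : query_state s ->
  reg s 26 = mem s (B + 9 + 16 * z) ->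
  T count_interval s interval_time (fun s' => query_state s' /\ reg s' 27 = mass z).
Proof.
move=> q e26; have [w [_ _ tv _] e3 e4] := q.
have tr : tree s X K (reg s 26) (vcount z) by rewrite e26.
have lt3 : reg s 3 < 2 ^ K by rewrite e3; lia.
have lt4 : reg s 4 < 2 ^ K by rewrite e4; lia.
apply: (triple_weaken (count_interval_triple w tr lt3 lt4) (leqnn _)).
move=> s' w' fr' ->; split; first exact: query_frame fr' _ _ _ w' q.
by rewrite e3 e4 mass_diff.
Qed.

Lemma count_above_triple s (z : 'I_n) : query_state s ->
  reg s 26 = mem s (B + 10 + 16 * z) ->
  T count_interval s interval_time (fun s' => query_state s' /\ reg s' 27 = above z).
Proof.
move=> q e26; have [w [_ _ _ tu] e3 e4] := q.
have tr : tree s X K (reg s 26) (ucount z) by rewrite e26.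
have lt3 : reg s 3 < 2 ^ K by rewrite e3; lia.
have lt4 : reg s 4 < 2 ^ K by rewrite e4; lia.
apply: (triple_weaken (count_interval_triple w tr lt3 lt4) (leqnn _)).
move=> s' w' fr' ->; split; first exact: query_frame fr' _ _ _ w' q.
by rewrite e3 e4 above_diff.
Qed.

Lemma level_triple s (z : 'I_n) : query_state s -> reg s 6 = z -> reg s 28 < 2 ^ K ->
  T level_count s interval_time (fun s' =>
    query_state s' /\ reg s' 27 = level z (reg s 28)).
Proof.
move=> q e6 lt28; have [w [_ _ tv tu] e3 e4] := q.
apply: (triple_weaken (level_count_triple w e6 (tv z) (tu z) lt28) (leqnn _)).
move=> s' w' fr' ->; split; first exact: query_frame fr' _ _ _ w' q.
by rewrite level_diff.
Qed.

Definition climb_time : nat := K * (interval_time + 60) + 20.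

Lemma climb_triple s (bot : 'I_n) th t : query_state s -> reg s 6 = bot ->
  reg s 9 = th -> highest r par mass bot th t ->
  T climb s climb_time (fun s' => query_state s' /\ reg s' 6 = iter t par bot).
Proof.
move=> q e6 e9 ht; have [w bu e3 e4] := q.
have [r15 r14 r13 r12] := base_regs w.
have n0 := n_gt0.
(* Distances to ancestors are at most a depth, hence below [n]; a window of length [2 ^ K] therefore
   contains [t] at the start. *)
have lt_t : t < 2 ^ K.
  have [td _ _] := ht; apply: leq_ltn_trans td _.
  exact: ltn_trans (depth_lt reach_root bot) n_ltP.
have mass_par := arcs_upto_par arcs par_root reach_root (fun u => u \in S).
pose I k s1 := [/\ query_state s1, reg s1 8 = k & exists z : 'I_n, reg s1 6 = z /\
  exists2 i, z = iter i par bot & i <= t < i + 2 ^ k].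
apply: (triple_time (t := _)).
  apply: triple_straight_seq => //.
    by have b13 := reg_bound w (isT : 13 < 32); rewrite /=; oblig.
  move=> w0 fr0.
  apply: (triple_weaken (Q := I 0)).
  - apply: (triple_while_const W_gt32 W_fits (k := K) (I := I)
      (t := cost climb_fetch + interval_time + 20)) => //.
    + split=> //.
      by exists bot; split=> //; exists 0 => //; rewrite add0n.
    + move=> k s1 kK w1 fr1 [q1 e8 [z [e6' zt]]].
      have [_ bu1 e3' e4'] := q1; have [jmp _ tv _] := bu1.
      have [r15' r14' _ _] := base_regs w1.
      have f9 : reg s1 9 = th by rewrite fr1.1.
      pose z' := iter (2 ^ k) par z.
      have jE : mem s1 (B + 0 + 16 * (k * n + z)) = z' by rewrite jmp.
      have zn := ltn_ord z; have zn' := ltn_ord z'.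
      have kn : k * n + n <= K * n by rewrite addnC -mulSn leq_mul2r kK orbT.
      have z'X : z' < X by lia.
      have tv' := cell_bound A_eq w1 (isT : 9 < 16) z'X.
      have KX := K_ltX.
      split=> //; first by rewrite /= e8.
      apply: (triple_time (t := _)).
        apply: triple_straight_seq => //.
          by rewrite /= /upd /= e8 subn1 /= r14' r15' e6' jE ?r15'; oblig.
        set s2 := run _ s1 => w2 fr2.
        have q2 : query_state s2 by apply: query_frame fr2 _ _ _ w2 q1.
        have e10 : reg s2 10 = z'.
          by rewrite /s2 /= /upd /= e8 subn1 /= r14' r15' e6' jE.
        have e26 : reg s2 26 = mem s2 (B + 9 + 16 * z').
          by rewrite /s2 /= /upd /= e8 subn1 /= r14' r15' e6' jE ?r15'.
        apply: (triple_seq (count_mass_triple q2 e26)) => s3 w3 fr3 [q3 e27].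
        have g9 : reg s3 9 = th by rewrite fr3.1 // fr2.1.
        have g8 : reg s3 8 = k by rewrite fr3.1 // /s2 /= /upd /= e8 subn1.
        have g6 : reg s3 6 = z by rewrite fr3.1 // fr2.1.
        have g10 : reg s3 10 = z' by rewrite fr3.1.
        have step := climb_step mass_par ht zt.
        apply: (triple_straight_wf W_gt32 W_fits (t := 10)) => //.
          by rewrite /= g9 e27 g10; case: ltnP => _ /=; oblig.
        set s4 := run _ s3 => w4 fr4.
        split; first exact: query_frame fr4 _ _ _ w4 q3.
          by rewrite fr4.1.
        move: step; rewrite -/z' => -[i zE it].
        exists (if th < mass z' then z' else z); split; last by exists i.
        rewrite /s4 /= g9 e27 g10; by case: ltnP.
      by rewrite /=; lia.
    + by move=> s1 w1 fr1 [_ e8 _]; rewrite /= e8.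
  - exact: leqnn.
  move=> s' w' fr' [q' _ [z [e6' [i zE]]]]; rewrite expn0 => it.
  by split=> //; rewrite e6' zE; have -> : i = t by lia.
rewrite /climb_time /=; lia.
Qed.

Definition pick_time : nat := interval_time + K * (interval_time + 70) + 100.

Lemma level_mono z p q : p <= q -> level z p <= level z q.
Proof.
by move=> pq; apply: sub_count => a /andP[-> lt_a]; apply: leq_trans pq.
Qed.

(** [mass z - above z] is the number of arcs at [z] into [S], so the level count rises between [lo]
    and [hi]. The witness precedes the first argument at which it exceeds its value at [lo]. *)
Lemma last_flat z : above z < mass z -> exists t,
  [/\ lo <= t < hi, level z t <= level z lo & level z lo < level z t.+1].
Proof.
rewrite (arcs_uptoE _ par_root reach_root) -[X in X < _]addn0 ltn_add2l.
rewrite /arcs_at count_S subn_gt0 => lt_lvl.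
have ex : exists p, (lo <= p) && (level z lo < level z p).
  by exists hi; rewrite lo_le_hi.
case: (ex_minnP ex) => -[|p] /andP[lo_p lt_p] pmin.
  by move: lt_p; rewrite ltnNge level_mono.
have lo_p' : lo <= p.
  by rewrite -ltnS ltn_neqAle lo_p andbT; apply: contraTneq lt_p => <-; rewrite ltnn.
exists p; split=> //.
  by rewrite lo_p' ltnNge /=; apply/negP => hp; have := pmin hi; rewrite lo_le_hi lt_lvl => /(_ isT); lia.
by rewrite leqNgt; apply/negP => lt; have := pmin p; rewrite lo_p' lt ltnn => /(_ isT).
Qed.

Lemma pick_triple s (z : 'I_n) : query_state s -> reg s 6 = z -> above z < mass z ->
  T pick s pick_time (fun s' => [/\ reg s' 0 = 1, reg s' 2 = z &
    exists2 u : 'I_n, reg s' 1 = u & (u \in S) && e u z]).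
Proof.
move=> q e6 lt_m; have [w bu e3 e4] := q.
have [r15 r14 r13 r12] := base_regs w.
have [t [/andP[lo_t t_hi] lvl_t lvl_t1]] := last_flat lt_m.
have b3 := reg_bound w (isT : 3 < 32).
pose I k s1 := [/\ query_state s1, reg s1 6 = z, reg s1 9 = level z lo, reg s1 11 = 2 ^ k &
  lo <= reg s1 10 <= t /\ t < reg s1 10 + 2 ^ k].
apply: (triple_time (t := _)).
  apply: triple_straight_seq => // w1 fr1.
  set s1 := run _ s in w1 fr1 *.
  have q1 : query_state s1 by apply: query_frame fr1 _ _ _ w1 q.
  have lt28 : reg s1 28 < 2 ^ K by rewrite /s1 /= /upd /= e3; lia.
  apply: (triple_seq (level_triple q1 e6 lt28)) => s2 w2 fr2 [q2 e27].
  have [_ r14' _ r12'] := base_regs w2.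
  have f6 : reg s2 6 = z by rewrite fr2.1.
  have f28 : reg s1 28 = lo by rewrite /s1 /= /upd /= e3.
  have [_ _ e3' e4'] := q2.
  apply: triple_straight_seq => //.
    have b27 := reg_bound w2 (isT : 27 < 32); have b3' := reg_bound w2 (isT : 3 < 32).
    by rewrite /= /upd /= r12'; oblig.
  set s3 := run _ s2 => w3 fr3.
  have q3 : query_state s3 by apply: query_frame fr3 _ _ _ w3 q2.
  apply: (triple_seq (Q1 := I 0)).
    apply: (triple_while_const W_gt32 W_fits (k := K) (I := I)
      (t := interval_time + 60)) => //.
    + split=> //; rewrite /s3 /= /upd /=.
      * by rewrite e27 f28.
      * by rewrite e3' lo_t leqnn; lia.
    + move=> k s4 kK w4 fr4 [q4 g6 g9 g11 [/andP[lo_p p_t] t_p]].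
      have [_ bu4 g3 g4] := q4.
      have pk : 2 ^ k < X by apply: leq_ltn_trans P_ltX; rewrite leq_exp2l // ltnW.
      split=> //; first by rewrite /= g11 -{1}(expn0 2) ltn_exp2l.
      have k2 : 2 ^ k.+1 %/ 2 = 2 ^ k by rewrite expnS mulKn.
      apply: (triple_time (t := _)).
        apply: triple_straight_seq => //.
          by rewrite /= /upd /= g11 k2; oblig.
        set s5 := run _ s4 => w5 fr5.
        have q5 : query_state s5 by apply: query_frame fr5 _ _ _ w5 q4.
        have h11 : reg s5 11 = 2 ^ k by rewrite /s5 /= /upd /= g11 k2.
        have h28 : reg s5 28 = reg s5 10 + 2 ^ k by rewrite /s5 /= /upd /= g11 k2.
        have h10 : reg s5 10 = reg s4 10 by [].
        have h6 : reg s5 6 = z by [].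
        have h9 : reg s5 9 = level z lo by [].
        have [_ _ h3 h4] := q5.
        rewrite -h10 in lo_p p_t t_p; rewrite expnS in t_p.
        clearbody s5.
        apply: triple_if => //; rewrite /= h4.
        (* A probe at or beyond [hi] is past [t] anyway. Skipping it also keeps the argument of the
           prefix count below [2 ^ K]. *)
        case: ltnP => /= lt_q; last first.
          apply: (triple_straight W_gt32 W_fits (t := interval_time + 20)) => //.
            by rewrite /=; lia.
          by split=> //=; rewrite h28 in lt_q; split; rewrite ?lo_p //; lia.
        have lt28' : reg s5 28 < 2 ^ K by lia.
        apply: (triple_time (t := _)).
          apply: (triple_seq (level_triple q5 h6 lt28')) => s6 w6 fr6 [q6 i27].
          have i9 : reg s6 9 = level z lo by rewrite fr6.1.
          have i10 : reg s6 10 = reg s5 10 by rewrite fr6.1.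
          have i28 : reg s6 28 = reg s5 28 by rewrite fr6.1.
          apply: (triple_straight_wf W_gt32 W_fits (t := 10)) => //.
            have b28 := reg_bound w6 (isT : 28 < 32).
            by rewrite /= i9 i27; case: ltnP => _ /=; oblig.
          set s7 := run _ s6 => w7 fr7.
          have q7 : query_state s7 by apply: query_frame fr7 _ _ _ w7 q6.
          split=> //.
          * by rewrite fr7.1 // fr6.1.
          * by rewrite fr7.1.
          * by rewrite fr7.1 // fr6.1.
          rewrite /s7 /= i9 i27; case: ltnP => cmp /=.
            rewrite i10; have : t < reg s5 28.
              rewrite ltnNge; apply/negP => le_t.
              by have := level_mono z le_t; lia.
            by rewrite h28 lo_p p_t; lia.
          rewrite /upd /= i28; have : reg s5 28 <= t.
            rewrite leqNgt; apply/negP => lt_t.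
            by have := level_mono z lt_t; lia.
          by rewrite h28; lia.
        by lia.
      by rewrite /=; lia.
    + by move=> s4 w4 fr4 [_ _ _ g11 _]; rewrite /= g11.
  move=> s4 w4 fr4 [q4 g6 g9 g11 [/andP[lo_p p_t] t_p]].
  have [_ bu4 g3 g4] := q4.
  have [r15' _ _ _] := base_regs w4.
  have g10 : reg s4 10 = t by rewrite expn0 in t_p; lia.
  have tn : t < n by lia.
  pose u := nth r ol t.
  have pu : pre u = t by rewrite /u pre_nth.
  have [_ uE _] := built_vertex u bu4; rewrite pu in uE.
  have un := ltn_ord u; have zn := ltn_ord z.
  apply: (triple_straight W_gt32 W_fits (t := 40)) => //.
    by rewrite /= /upd /= r15' g10 uE g6; oblig.
  rewrite /= /upd /= r15' g10 uE g6; split=> //; exists u => //.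
  (* The level count rises from [t] to [t.+1], so an arc at [z] ends at the vertex labelled [t]. *)
  have uz : e u z.
    have : 0 < arcs_at arcs (fun u' => pre u' == t) z.
      have E : level z t.+1 = level z t + arcs_at arcs (fun u' => pre u' == t) z.
        rewrite /arcs_at -count_predUI -[LHS]addn0; congr (_ + _).
          by apply: eq_count => a /=; rewrite -andb_orr ltnS [pre a.2 <= t]leq_eqVlt orbC.
        rewrite -(count_pred0 arcs); apply: eq_count => a /=.
        by case: ltngtP; rewrite ?andbF.
      by lia.
    case/(arcs_at_gt0P e_sym mem_arcs) => u' /eqP pu' u'z.
    by rewrite (_ : u = u') //; apply: (pre_inj par_root reach_root); rewrite pu.
  by rewrite uz S_interval pu lo_t t_hi.
by rewrite /pick_time /=; lia.
Qed.

Definition search_time : nat := 2 * interval_time + climb_time + pick_time + 300.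

Lemma orient_triple s (x y : 'I_n) : query_state s -> reg s 1 = x -> reg s 2 = y ->
  let down := fconnect par y x in
  let top := if down then x else y in
  T orient s 100 (fun s' => [/\ query_state s', reg s' 7 = down,
    reg s' 6 = (if down then y else x) &
    reg s' 26 = mem s' (B + 10 + 16 * top)]).
Proof.
move=> q e1 e2 down top; have [w bu e3 e4] := q.
have [r15 r14 r13 r12] := base_regs w.
have [x6 _ x7] := built_vertex x bu; have [y6 _ _] := built_vertex y bu.
have xe := built_next x bu.
have xn := ltn_ord x; have yn := ltn_ord y.
have px := pre_lt par_root reach_root x; have py := pre_lt par_root reach_root y.
have ex := pre_end_le par_root reach_root x.
have nx := next_vertex_le par_root reach_root x.
have downE : down = ((pre y < pre x) < (pre y < pre x + size (preorder x))) :> bool.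
  rewrite /down (subtree_interval par_root reach_root) [pre x <= pre y]leqNgt.
  by case: (pre y < pre x); case: (pre y < _).
have tn : (if down then x else y : 'I_n) < n by [].
have c10 : mem s (B + 10 + 16 * top) < W by apply: (cell_bound A_eq w) => //; rewrite /top; lia.
apply: (triple_straight_wf W_gt32 W_fits) => //.
  rewrite /= /upd /= e1 e2 r15 x6 y6 x7 xe -downE.
  move: c10; rewrite /top; case: (down) => /= c10; rewrite ?e1 ?e2 ?r15; oblig.
set s' := run _ s => w' fr'.
split; first exact: query_frame fr' _ _ _ w' q.
- by rewrite /s' /= /upd /= e1 e2 r15 x6 y6 x7 xe -downE; case: (down).
- by rewrite /s' /= /upd /= e1 e2 r15 x6 y6 x7 xe -downE; case: (down).
by rewrite /s' /= /upd /= e1 e2 r15 x6 y6 x7 xe -downE /top; case: (down) => /=; rewrite ?e1 ?e2 ?r15.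
Qed.

Lemma search_triple s (x y : 'I_n) : query_state s -> reg s 1 = x -> reg s 2 = y ->
  anc_desc par x y ->
  T search s search_time (fun s' =>
    exists2 o, returns s' o & query_answer e par S x y o).
Proof.
move=> q e1 e2 xy.
have nonep := answer_none e_sym par_root reach_root mem_arcs (A := S) xy.
have somep := answer_some e_sym par_root reach_root mem_arcs (A := S) xy.
have ori := orient_triple q e1 e2.
set down := fconnect par y x in ori nonep somep.
set top := if down then x else y in ori nonep somep.
set bot := if down then y else x in ori nonep somep.
apply: (triple_time (t := _)).
  apply: (triple_seq ori) => s1 w1 fr1 [q1 e7 e6 e26].
  have b6 : reg s1 6 = bot by rewrite e6 /bot; case: (down).
  apply: (triple_seq (count_above_triple q1 e26)) => s2 w2 fr2 [q2 e27].
  have [_ bu2 _ _] := q2.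
  have [r15 _ _ _] := base_regs w2.
  have f6 : reg s2 6 = bot by rewrite fr2.1.
  have botn := ltn_ord bot.
  have botX : bot < X by lia.
  have c9 := cell_bound A_eq w2 (isT : 9 < 16) botX.
  have b27 := reg_bound w2 (isT : 27 < 32).
  apply: triple_straight_seq => //.
    by rewrite /= /upd /= f6 r15; oblig.
  set s3 := run _ s2 => w3 fr3.
  have q3 : query_state s3 by apply: query_frame fr3 _ _ _ w3 q2.
  have g26 : reg s3 26 = mem s3 (B + 9 + 16 * bot) by rewrite /s3 /= /upd /= f6 r15.
  have g9 : reg s3 9 = above top by rewrite /s3 /= /upd /= e27.
  apply: (triple_seq (count_mass_triple q3 g26)) => s4 w4 fr4 [q4 h27].
  have h9 : reg s4 9 = above top by rewrite fr4.1.
  have h6 : reg s4 6 = bot by rewrite fr4.1 // fr3.1.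
  have h7 : reg s4 7 = down by rewrite fr4.1 // fr3.1 // fr2.1.
  have b27' := reg_bound w4 (isT : 27 < 32).
  apply: (triple_if W_gt32 W_fits (t := climb_time + pick_time + 50)) => //.
  rewrite /= h9 h27; case: ltnP => /= cmp; last first.
    apply: (triple_straight W_gt32 W_fits) => //.
      by rewrite /=; oblig.
      by rewrite /=; lia.
    by exists None => //; apply: nonep.
  pose th := if down then above top else (mass bot).-1.
  have th_lt : th < mass bot by rewrite /th; case: ifP => // _; rewrite ltn_predL; apply: leq_ltn_trans cmp.
  have [t ht] := highest_ex par_root reach_root th_lt.
  apply: (triple_time (t := _)).
    apply: triple_straight_seq => //.
      by rewrite /= h7; case: (down) => /=; oblig.
    set s5 := run _ s4 => w5 fr5.
    have q5 : query_state s5 by apply: query_frame fr5 _ _ _ w5 q4.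
    have i6 : reg s5 6 = bot by rewrite fr5.1.
    have i9 : reg s5 9 = th.
      by rewrite /s5 /= h7 /th; case: (down) => /=; rewrite ?h27 ?subn1.
    apply: (triple_seq (climb_triple q5 i6 i9 ht)) => s6 w6 fr6 [q6 j6].
    have [lt_m ans] := somep t cmp ht.
    apply: (triple_weaken (pick_triple q6 j6 lt_m) (leqnn _)).
    move=> s7 w7 fr7 [k0 k2 [u k1 /andP[uS uz]]].
    by exists (Some (u, iter t par bot)) => //; apply: ans.
  by rewrite /=; lia.
by rewrite /search_time /=; lia.
Qed.

End Search.

(** * Complete queries *)

Definition query_time : nat := setup_time + search_time + 100.

(** [load] stands for either way of computing the interval of labels, so both queries share this
    proof. [s] need only agree with the built state [sf] below [A]. *)
Lemma query_runs (e : rel 'I_n) (S : {set 'I_n}) lo hi load sf s (w x y : 'I_n) :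
  symmetric e -> (forall v u, ((v, u) \in arcs) = e v u) ->
  (forall u, (u \in S) = (lo <= pre u < hi)) -> lo <= hi -> hi <= n ->
  arrays_written load = [::] -> {subset regs_written load <= [:: 3; 4]} ->
  (forall s1, wf s1 -> built s1 -> reg s1 0 = w ->
     T load s1 50 (fun s2 => reg s2 3 = lo /\ reg s2 4 = hi)) ->
  wf sf -> built sf -> (forall i, i < A -> mem s i = mem sf i) ->
  reg s 0 = w -> reg s 1 = x -> reg s 2 = y -> anc_desc par x y ->
  runs_within b (setup ;; load ;; search) s query_time (fun s' =>
    mem s' =1 mem s /\ exists2 o, returns s' o & query_answer e par S x y o).
Proof.
move=> e_sym mem_e SE lo_hi hi_n load_pure load_regs load_ok wsf busf sE e0 e1 e2 xy.
have [[_ bmf] _ inpf] := wsf.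
have [|||t1 [s1 [ex1 le1 [w1 m1 r1]]]] :=
    @setup_runs s.
- by move=> i iA; rewrite sE ?bmf.
- by move=> i iB; rewrite sE ?inpf //; lia.
- move=> i i3; have := (ltn_ord w, ltn_ord x, ltn_ord y) => -[[w_n x_n] y_n].
  by case: i i3 => [|[|[|i]]] //= _; rewrite ?e0 ?e1 ?e2; lia.
have bu1 : built s1.
  apply: (built_ext) busf.
  by move=> z zA; rewrite m1 sE.
have f0 : reg s1 0 = w by rewrite r1.
have [t2 [s2 [ex2 le2 [w2 fr2 [e3 e4]]]]] := load_ok s1 w1 bu1 f0.
have q2 : query_state lo hi s2.
  by split=> //; apply: built_frame fr2 load_pure bu1.
have keep i : i < 3 -> reg s2 i = reg s i.
  move=> i3; rewrite fr2.1 ?r1 //; apply/negP => /load_regs.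
  by rewrite !inE; lia.
have [||t3 [s3 [ex3 le3 [w3 fr3 [o ret ans]]]]] :=
  @search_triple e S lo hi e_sym mem_e SE lo_hi hi_n s2 x y q2 _ _ xy.
- by rewrite keep.
- by rewrite keep.
exists (t1 + (t2 + t3).+1).+1, s3; split.
- exact: ExecSeq ex1 (ExecSeq ex2 ex3).
- by rewrite /query_time; lia.
split; last by exists o.
by move=> z; rewrite (frame_pure fr3) // (frame_pure fr2) // m1.
Qed.

Lemma load_subtree_triple s (w : 'I_n) : wf s -> built s -> reg s 0 = w ->
  T load_subtree s 50 (fun s' =>
    reg s' 3 = pre w /\ reg s' 4 = pre w + size (preorder w)).
Proof.
move=> wfs bu e0; have [r15 _ _ _] := base_regs wfs.
have [w6 _ w7] := built_vertex w bu; have we := built_next w bu.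
have wn := ltn_ord w; have pw := pre_lt par_root reach_root w.
have ew := pre_end_le par_root reach_root w.
have nw := next_vertex_le par_root reach_root w.
apply: (triple_straight W_gt32 W_fits) => //.
  by rewrite /= /upd /= e0 r15 w6 w7 we; oblig.
by rewrite /= /upd /= e0 r15 w6 w7 we.
Qed.

Lemma load_vertex_triple s (w : 'I_n) : wf s -> built s -> reg s 0 = w ->
  T load_vertex s 50 (fun s' => reg s' 3 = pre w /\ reg s' 4 = (pre w).+1).
Proof.
move=> wfs bu e0; have [r15 _ _ _] := base_regs wfs.
have [w6 _ _] := built_vertex w bu.
have wn := ltn_ord w; have pw := pre_lt par_root reach_root w.
apply: (triple_straight W_gt32 W_fits) => //.
  by rewrite /= /upd /= e0 r15 w6; oblig.
by rewrite /= /upd /= e0 r15 w6 addn1.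
Qed.

End Build.

(** * Arithmetic of sizes and running times *)

Lemma layout_fits n m lg L : L = 2 ^ lg -> lg < L -> 1 < L -> n < 2 * L -> m <= n * n ->
  2 + n + 2 * m + 16 * (2 * m * (lg.+1 + 1) + 2) + 33 <= 2 ^ (12 * lg).
Proof.
move=> LE lgL L1 nL mn.
have m4 : m <= 4 * (L * L) by nia.
have lg2 : lg.+1 + 1 <= 2 * L by lia.
have mlg : m * (lg.+1 + 1) <= 8 * (L * (L * L)).
  by apply: leq_trans (leq_mul m4 lg2) _; lia.
have L1' : 2 * L <= L * L by rewrite leq_mul2r L1 orbT.
have L2 : 4 <= L * L by lia.
have L3 : 2 * (L * L) <= L * (L * L) by rewrite leq_mul2r L1 orbT.
(* [m] is at most quadratic and [lg] at most linear in [L], so the size is cubic. As [L >= 2], the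
   factor [512 = 2 ^ 9] is at most [L ^ 9], which gives [L ^ 12]. *)
have bound : 2 + n + 2 * m + 16 * (2 * m * (lg.+1 + 1) + 2) + 33 <= 512 * (L * (L * L)) by lia.
apply: leq_trans bound _.
have -> : 2 ^ (12 * lg) = L ^ 9 * L ^ 3 by rewrite -expnD LE -expnM mulnC.
by rewrite -[L * (L * L)]/(L ^ 3) leq_mul2r (_ : 512 = 2 ^ 9) // leq_exp2r // L1 orbT.
Qed.

Lemma build_time_le n (es : seq ('I_n * 'I_n)) lg : n <= 2 * size es -> 0 < size es -> 0 < lg ->
  (setup_time lg.+1 + construct_time es lg.+1).+1 <= 90 * 90 * (size es * lg).
Proof.
rewrite /construct_time /version_time /arc_time /insert_time /setup_time.
move: (size es) => m nm m0 lg0.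
(* With [n <= 2 * m] and both [m] and [lg] positive, every term, constants included, is bounded by a
   multiple of [m * lg]. *)
have h1 : n * lg <= 2 * (m * lg) by rewrite mulnA leq_mul2r nm orbT.
have h2 : m <= m * lg by rewrite leq_pmulr.
have h3 : lg <= m * lg by rewrite leq_pmull.
have -> : lg.+1 * n * 60 = 60 * (n * lg) + 60 * n by lia.
have -> : 2 * m * (lg.+1 * 150 + 50 + 120) = 300 * (m * lg) + 640 * m by lia.
lia.
Qed.

Lemma query_time_le lg : 0 < lg -> query_time lg.+1 <= 90 * 90 * lg ^ 3.
Proof.
move=> lg0; rewrite /query_time /search_time /climb_time /pick_time /interval_time.
rewrite /prefix_time /setup_time.
(* The time is quadratic in [lg]: about [lg] rounds, each with prefix counts of about [lg] steps. *)
have h1 : lg * lg <= lg ^ 3 by rewrite -[lg * lg]/(lg ^ 2) leq_pexp2l.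
have h2 : lg <= lg ^ 3 by rewrite -{1}[lg]expn1 leq_pexp2l.
have h3 : 0 < lg ^ 3 by rewrite expn_gt0 lg0.
have -> : lg.+1 * (2 * (lg.+1 * 100 + 20) + 60 + 60) = 200 * (lg * lg) + 560 * lg + 360 by lia.
have -> : lg.+1 * (2 * (lg.+1 * 100 + 20) + 60 + 70) = 200 * (lg * lg) + 570 * lg + 370 by lia.
lia.
Qed.

Theorem theorem4 :
  exists (build query_subtree query_vertex : cmd) (c C : nat),
  forall (n : nat) (e : rel 'I_n) (r : 'I_n) (par : 'I_n -> 'I_n)
         (es : seq ('I_n * 'I_n)) (b : nat),
    1 < n ->
    symmetric e -> irreflexive e ->
    dfs_tree e r par ->
    edge_list e es ->
    c * trunc_log 2 n <= b ->
    let m := #|edge_set e| in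
    let lg := trunc_log 2 n in
    exists D : seq nat,
      [/\ size D <= C * (m * lg),
          forall k, k \in D -> k < 2 ^ b,
          runs_within b build (initial (input par es)) (C * (m * lg)) (holds D)
        & forall w x y : 'I_n, anc_desc par x y ->
            answers_within e par b query_subtree D (C * lg ^ 3)
              (subtree par w) w x y /\
            answers_within e par b query_vertex D (C * lg ^ 3)
              [set w] w x y].
Proof.
(* [145 = 12 * 12 + 1]: stored values are below [2 ^ (12 * lg)] and intermediate ones involve at
   most 12 such factors; the extra 1 makes the bound strict. The second constant serves size,
   construction time and query time at once. *)
exists build, query_subtree, query_vertex, 145, (90 * 90).
move=> n e r par es b n_gt1 e_sym _ dfs esE b_ge m lg.
have par_root := dfs_root dfs; have reach := dfs_reach dfs.
have mE : size es = m := size_edge_list esE.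
have n_le : n <= 2 * size es by rewrite mE; apply: vertices_le_edges n_gt1 e_sym dfs.
have m_gt0 : 0 < size es by rewrite mE; apply: edges_gt0 n_gt1 e_sym dfs.
have m_le : size es <= n * n by rewrite mE; apply: edges_le_square.
have memE := mem_arcs e_sym esE.
have lg_gt0 : 0 < lg by rewrite trunc_log_gt0.
have /andP[lg_le n_lt] : 2 ^ lg <= n < 2 ^ lg.+1.
  by apply: trunc_log_bounds => //; apply: ltnW.
have lg_ltL : lg < 2 ^ lg by apply: ltn_expl.
(* [K] is the least exponent with [n < 2 ^ K]. Each of the [2 * size es] arcs takes [K + 1] nodes;
   the remaining 2 are the null node and a spare cell. *)
pose K := lg.+1; pose X := 2 * size es * (K + 1) + 2.
pose A := 2 + n + 2 * size es + 16 * X; pose W := A + 33.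
have W_gt32 : 32 < W by rewrite /W; lia.
have L1 : 1 < 2 ^ lg by rewrite -{1}(expn0 2) ltn_exp2l.
have W_le : W <= 2 ^ (12 * lg).
  by apply: layout_fits (erefl _) lg_ltL L1 _ m_le; rewrite -expnS.
have W_fits : W ^ max_leaves < 2 ^ b.
  apply: (@leq_ltn_trans ((2 ^ (12 * lg)) ^ max_leaves)); first by rewrite leq_exp2r.
  rewrite -expnM ltn_exp2l //; apply: leq_trans b_ge; rewrite /max_leaves -/lg; lia.
have A_ltW : A < W by rewrite /W; lia.
have K_gt0 : 0 < K by [].
have mlg_ge : 2 * size es <= 2 * size es * lg by rewrite leq_pmulr.
have P_ltX : 2 ^ K < X by rewrite /X /K expnS; lia.
have Kn_leX : K * n <= X.
  by apply: leq_trans (leq_mul (leqnn K) n_le) _; rewrite /X; lia.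
have n_ltX : n.+1 < X by rewrite /X /K; lia.
have nodes_leX : 1 + 2 * size es * (K + 1) <= X by rewrite /X; lia.
have P_le : 2 ^ K.-1 <= n by [].
have [t [sf [ex le_t [wf bu]]]] := @build_runs n r par es b W A K X par_root reach
  W_gt32 W_fits (erefl A) A_ltW K_gt0 P_ltX n_lt Kn_leX n_ltX nodes_leX P_le.
have [[_ bmf] _ _] := wf.
(* The structure is the whole initial segment of the memory, the input followed by the interleaved
   arrays, because [setup] reads the sizes from the input. *)
pose D := [seq mem sf i | i <- iota 0 A].
have szD : size D = A by rewrite size_map size_iota.
have nthD i : i < A -> nth 0 D i = mem sf i.
  by move=> iA; rewrite (nth_map 0) ?size_iota // nth_iota.
have W_lt : W < 2 ^ b.
  by apply: leq_ltn_trans W_fits; rewrite -{1}[W]expn1 leq_pexp2l //; lia.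
exists D; split.
- rewrite szD /A /X /K -mE; have := mlg_ge; lia.
- move=> k /mapP[i]; rewrite mem_iota => /andP[_ iA] ->.
  by apply: ltn_trans W_lt; apply: bmf.
- exists t, sf; split=> //; last by move=> i; rewrite szD => /nthD.
  by apply: leq_trans le_t _; rewrite -mE; apply: build_time_le.
move=> w x y xy.
have holdsE s : holds D s -> forall i, i < A -> mem s i = mem sf i.
  by move=> hs i iA; rewrite hs ?szD // nthD.
have fin s s' : holds D s -> mem s' =1 mem s -> holds D s'.
  by move=> hs E i iD; rewrite E hs.
split=> s hs [e0 e1 e2].
- have [||||t' [s' [ex' le' [ms ans]]]] := @query_runs n r par es b W A K X
    par_root reach W_gt32 W_fits (erefl A) A_ltW K_gt0 P_ltX n_lt Kn_leX n_ltX nodes_leX P_le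
    e (subtree par w) (pre r par w) (pre r par w + size (preorder par w))
    load_subtree sf s w x y e_sym memE _ (leq_addr _ _) _ (erefl _) _ _
    wf bu (holdsE s hs) e0 e1 e2 xy.
  + by move=> u; rewrite inE (subtree_interval par_root reach).
  + exact: pre_end_le.
  + by [].
  + by move=> s1 w1 b1 f0; apply: load_subtree_triple.
  exists t', s'; split=> //; last by split=> //; apply: fin ms.
  by apply: leq_trans le' (query_time_le lg_gt0).
have [||||t' [s' [ex' le' [ms ans]]]] := @query_runs n r par es b W A K X
    par_root reach W_gt32 W_fits (erefl A) A_ltW K_gt0 P_ltX n_lt Kn_leX n_ltX nodes_leX P_le
    e [set w] (pre r par w) (pre r par w).+1
    load_vertex sf s w x y e_sym memE _ (leqnSn _) _ (erefl _) _ _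
    wf bu (holdsE s hs) e0 e1 e2 xy.
- move=> u; rewrite inE ltnS -eqn_leq eq_sym; apply/eqP/eqP => [-> //|].
  by move/(pre_inj par_root reach).
- exact: pre_lt.
- by [].
- by move=> s1 w1 b1 f0; apply: load_vertex_triple.
exists t', s'; split=> //; last by split=> //; apply: fin ms.
by apply: leq_trans le' (query_time_le lg_gt0).
Qed.
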